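(* Let $\Omega$ be a hyperbolic domain in the complex plane and let $\lambda=\lambda_\Omega$ be its hyperbolic metric of constant Gaussian curvature $-4$. Let $R:(-1,1)\to(0,\infty)$ be smooth and let $\rho(u,v)=R(u)$ on $(-1,1)\times\mathbb{R}$ have non-negative Gaussian curvature. Let $f:\Omega\to(-1,1)$ be a $\rho$-harmonic function. Then $$d_h(f(z),f(w))\le\frac{4}{\pi}\,d_\lambda(z,w)\quad\text{for all } z,w\in\Omega,$$ and this inequality is sharp, i.e. the constant $4/\pi$ cannot be replaced by a smaller constant valid for all such $\Omega$, $R$ and $f$.
   Context: $\mathbb{D}=\{z\in\mathbb{C}:|z|<1\}$. A hyperbolic domain is a domain in $\mathbb{C}$ whose universal cover is conformally equivalent to $\mathbb{D}$. The Gaussian curvature of a smooth conformal metric density $\varrho>0$ is $\mathcal{K}_\varrho=-\Delta\log\varrho/\varrho^2$; for $\rho(u,v)=R(u)$ it is $\mathcal{K}_\rho(u,v)=-\frac{1}{R(u)^2}\left(\frac{R'(u)}{R(u)}\right)'$. The hyperbolic metric $\lambda_\Omega$ is the complete conformal metric density on $\Omega$ of constant curvature $-4$ (for $\mathbb{D}$, $\lambda_{\mathbb{D}}(z)=1/(1-|z|^2)$), and $d_\lambda$ is the distance on $\Omega$ induced by the length element $\lambda_\Omega(z)|dz|$. The hyperbolic distance on $\mathbb{D}$ is $d_h(z,w)=\tanh^{-1}\frac{|z-w|}{|1-z\bar w|}$; it is applied to the real points $f(z),f(w)\in(-1,1)\subset\mathbb{D}$. A real-valued $\mathcal{C}^2$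 function $f:\Omega\to(-1,1)$ is $\rho$-harmonic, where $\rho(u,v)=R(u)$, if $$\Delta f+\frac{R'(f)}{R(f)}|\nabla f|^2=0\quad\text{on }\Omega.$$ *)

(* Defs.v *)
(* Stdlib reals with Coquelicot. *)
From Stdlib Require Import Reals.
From Coquelicot Require Import Coquelicot.

Open Scope R_scope.

(* Functions on a subset of C are total functions on C, constrained only on
   that subset; all subsets on which one differentiates are open. *)

Definition unit_disk (z : C) : Prop := Cmod z < 1.

Definition connected_set (A : C -> Prop) : Prop :=
  forall U V : C -> Prop,
    open U -> open V ->
    (forall z, A z -> U z \/ V z) ->
    (forall z, A z -> U z -> V z -> False) ->
    (exists z, A z /\ U z) -> (exists z, A z /\ V z) -> False.

Definition plane_domain (Omega : C -> Prop) : Prop :=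
  open Omega /\ connected_set Omega /\ (exists z, Omega z).

(* [U] is evenly covered by [p], viewed as a map defined on [X]: the sheets
   [V i] partition the preimage of [U], and [s i] is the inverse of the
   homeomorphism that [p] induces from [V i] onto [U]. *)
Definition evenly_covered (X : C -> Prop) (p : C -> C) (U : C -> Prop) : Prop :=
  exists (I : Type) (V : I -> C -> Prop) (s : I -> C -> C),
    (forall i, open (V i)) /\
    (forall z, (X z /\ U (p z)) <-> exists i, V i z) /\
    (forall i j z, V i z -> V j z -> i = j) /\
    (forall i z, V i z -> continuous p z /\ s i (p z) = z) /\
    (forall i w, U w -> continuous (s i) w /\ V i (s i w) /\ p (s i w) = w).

Definition covering_map (X Y : C -> Prop) (p : C -> C) : Prop :=
  (forall z, X z -> Y (p z)) /\
  (forall w, Y w -> exists z, X z /\ p z = w) /\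
  (forall w, Y w ->
    exists U : C -> Prop,
      open U /\ U w /\ (forall v, U v -> Y v) /\ evenly_covered X p U).

Definition holomorphic_on (X : C -> Prop) (p : C -> C) : Prop :=
  forall z, X z -> @ex_derive C_AbsRing C_NormedModule p z.

(* The disk is simply connected, so a holomorphic covering of [Omega] by the
   disk is the same thing as a conformal equivalence between the disk and the
   universal cover of [Omega] (with the complex structure lifted from it). *)
Definition hyperbolic_domain (Omega : C -> Prop) : Prop :=
  plane_domain Omega /\
  exists p : C -> C, holomorphic_on unit_disk p /\ covering_map unit_disk Omega p.

Definition partial_x (f : C -> R) (z : C) : R := Derive (fun t => f (t, Im z)) (Re z).
Definition partial_y (f : C -> R) (z : C) : R := Derive (fun t => f (Re z, t)) (Im z).

Fixpoint Ck_on (k : nat) (Omega : C -> Prop) (f : C -> R) : Prop :=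
  (forall z, Omega z -> continuous f z) /\
  match k with
  | O => True
  | S k' =>
      (forall z, Omega z ->
         ex_derive (fun t => f (t, Im z)) (Re z) /\
         ex_derive (fun t => f (Re z, t)) (Im z)) /\
      Ck_on k' Omega (partial_x f) /\ Ck_on k' Omega (partial_y f)
  end.

Definition smooth_on (Omega : C -> Prop) (f : C -> R) : Prop :=
  forall k, Ck_on k Omega f.

Definition laplacian (f : C -> R) (z : C) : R :=
  partial_x (partial_x f) z + partial_y (partial_y f) z.

Definition grad_norm_sqr (f : C -> R) (z : C) : R :=
  partial_x f z ^ 2 + partial_y f z ^ 2.

Definition conformal_density (Omega : C -> Prop) (lam : C -> R) : Prop :=
  (forall z, Omega z -> 0 < lam z) /\ smooth_on Omega lam.

Definition gaussian_curvature (lam : C -> R) (z : C) : R :=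
  - laplacian (fun w => ln (lam w)) z / lam z ^ 2.

(* Two-sided differentiability at 0 and 1 is no restriction: a C^1 arc on
   [0,1] extends to the line, and the extension may leave [Omega]. *)
Definition C1_arc (Omega : C -> Prop) (g : R -> C) : Prop :=
  forall t, 0 <= t <= 1 ->
    Omega (g t) /\
    ex_derive (fun s => Re (g s)) t /\ ex_derive (fun s => Im (g s)) t /\
    continuous (Derive (fun s => Re (g s))) t /\
    continuous (Derive (fun s => Im (g s))) t.

Definition arc_length (lam : C -> R) (g : R -> C) : R :=
  RInt (fun t =>
    lam (g t) * Cmod (Derive (fun s => Re (g s)) t, Derive (fun s => Im (g s)) t)) 0 1.

(* Piecewise C^1 curves in [Omega], as finite concatenations of C^1 arcs. *)
Inductive path_of_length (Omega : C -> Prop) (lam : C -> R) : C -> C -> R -> Prop :=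
  | path_nil : forall z, Omega z -> path_of_length Omega lam z z 0
  | path_cons : forall g w l,
      C1_arc Omega g -> path_of_length Omega lam (g 1) w l ->
      path_of_length Omega lam (g 0) w (arc_length lam g + l).

(* On a domain the infimum is over a nonempty set of nonnegative reals, so
   [real] loses nothing. *)
Definition metric_dist (Omega : C -> Prop) (lam : C -> R) (z w : C) : R :=
  real (Glb_Rbar (path_of_length Omega lam z w)).

Definition complete_density (Omega : C -> Prop) (lam : C -> R) : Prop :=
  forall u : nat -> C,
    (forall n, Omega (u n)) ->
    (forall eps, 0 < eps -> exists N, forall m n,
       (N <= m)%nat -> (N <= n)%nat -> metric_dist Omega lam (u m) (u n) < eps) ->
    exists z, Omega z /\ is_lim_seq (fun n => metric_dist Omega lam (u n) z) 0.

(* On a hyperbolic domain these conditions determine [lam] on [Omega]. *)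
Definition hyperbolic_metric (Omega : C -> Prop) (lam : C -> R) : Prop :=
  conformal_density Omega lam /\
  (forall z, Omega z -> gaussian_curvature lam z = -4) /\
  complete_density Omega lam.

Definition artanh (x : R) : R := / 2 * ln ((1 + x) / (1 - x)).

Definition disk_dist (z w : C) : R :=
  artanh (Cmod (z - w)%C / Cmod (1 - z * Cconj w)%C).

Definition smooth_on_unit_interval (r : R -> R) : Prop :=
  forall n t, -1 < t < 1 -> ex_derive_n r n t.

(* The density rho(u,v) = r(u) on the strip (-1,1) x R. *)
Definition strip_density (r : R -> R) (w : C) : R := r (Re w).

Definition rho_harmonic (Omega : C -> Prop) (r : R -> R) (f : C -> R) : Prop :=
  (forall z, Omega z -> -1 < f z < 1) /\
  Ck_on 2 Omega f /\
  (forall z, Omega z ->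
     laplacian f z + Derive r (f z) / r (f z) * grad_norm_sqr f z = 0).

(* Main.v *)
Require Import Defs.
From Stdlib Require Import Reals Lra Lia Psatz Classical ClassicalEpsilon IndefiniteDescription Wf_nat.
From Coquelicot Require Import Coquelicot.
Open Scope R_scope.

(** The inequality is infinitesimal: it says that [artanh o f] has gradient at most
    [4 / PI * lam], and it is integrated along curves
    ([rho_harmonic_contraction], [gradient_bound_path]).

    Let [F] be a primitive of [r]. Then [h = F o f] is an ordinary harmonic
    function. Since the curvature of [rho] is [- (ln r)'' / r ^ 2], non-negative
    curvature means that [r] is log-concave; hence [r] is bounded and [h] takes
    values in a bounded interval (a, b). The proof then combines three facts.

    - A harmonic function from the disk to (a, b) satisfies
      [|grad h| (0) <= 2 (b - a) / PI * sin (PI (h(0) - a) / (b - a))]: the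
      gradient is a first Fourier coefficient of the boundary values, whose mean
      is [h(0)] ([harmonic_schwarz]). This is the Schwarz-Pick lemma for maps into
      a strip, and it holds at the other points of the disk by composition with
      automorphisms.

    - A log-concave density satisfies
      [(b - a) sin (PI (F - a) / (b - a)) <= 2 r(u) (1 - u ^ 2)]
      ([log_concave_profile]), so that the previous bound, divided by [r(f)], is at
      most [4 / PI * (1 - f ^ 2)].

    - If [p] is a holomorphic covering of [Omega] by the disk, then [lam], pulled
      back by [p], is at least the hyperbolic density of the disk
      ([complete_density_bound]). Here [lam] is known only as a complete density
      of curvature -4. The logarithm [w] of the ratio of the hyperbolic density to
      the pullback is nonnegative by the Ahlfors-Schwarz lemma and satisfies
      [laplacian w = 4 (1 - exp (- 2 w)) * density ^ 2]. If [w] were positive at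
      some point, the maximum principle would give steps of bounded hyperbolic
      length along which [w] grows by a fixed amount, and a Harnack-type gradient
      estimate would keep [w] large between them ([defect_escape]). The image of
      this path in [Omega] would have finite length, hence a limit by completeness;
      by the covering property the path itself would converge in the disk, where
      [w] is finite.

    Pulling back requires that [p] be smooth with [p' <> 0]. This is derived from
    Goursat's lemma: primitives exist even in the presence of a point where only
    continuity is known, which gives Cauchy's formula, the differentiability of
    [p'] ([cderiv_holo]), the removability of singularities and, applied to local
    inverses of the covering, the absence of critical points
    ([derivative_neq_0]).

    The constant is attained in the limit by the disk, [r = 1] and
    [f(z) = 2 / PI * arg ((1 + z) / (1 - z))], for points close to 0
    ([contraction_sharp]). *)

(** * Differential calculus in the plane *)

(** Total differentiability at [z], which, unlike the existence of partial
    derivatives, is stable under composition. *)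
Definition has_grad (u : C -> R) (z : C) (a b : R) : Prop :=
  differentiable_pt_lim (fun x y => u (x, y)) (fst z) (snd z) a b.

Lemma locally_square (z : C) (P : C -> Prop) :
  locally z P <->
  exists d : posreal, forall x y,
    Rabs (x - fst z) < d -> Rabs (y - snd z) < d -> P (x, y).
Proof.
destruct z as [x0 y0]; split.
- intros H; apply (locally_2d_locally (fun x y => P (x, y))).
  destruct H as [d H]; exists d; intros [x y] Hxy; apply H, Hxy.
- intros H; apply (locally_2d_locally (fun x y => P (x, y))) in H.
  destruct H as [d H]; exists d; intros [x y] Hxy; apply (H (x, y)), Hxy.
Qed.

Lemma continuous_of_2d (u : C -> R) (z : C) :
  continuity_2d_pt (fun x y => u (x, y)) (fst z) (snd z) -> continuous u z.
Proof.
intros H; apply continuity_2d_pt_filterlim in H; destruct z as [x y].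
refine (filterlim_ext _ _ _ H); intros [a b]; reflexivity.
Qed.

Lemma continuous_to_2d (u : C -> R) (z : C) :
  continuous u z -> continuity_2d_pt (fun x y => u (x, y)) (fst z) (snd z).
Proof.
intros H; apply continuity_2d_pt_filterlim; destruct z as [x y].
refine (filterlim_ext _ _ _ H); intros [a b]; reflexivity.
Qed.

Lemma has_grad_eq u z a b a' b' :
  has_grad u z a b -> a = a' -> b = b' -> has_grad u z a' b'.
Proof. intros H <- <-; exact H. Qed.

Lemma has_grad_ext_loc u v z a b :
  locally z (fun w => u w = v w) -> has_grad u z a b -> has_grad v z a b.
Proof.
intros H; apply differentiable_pt_lim_ext.
apply locally_square in H; destruct H as [d H]; exists d; exact H.
Qed.

Lemma has_grad_ext u v z a b :
  (forall w, u w = v w) -> has_grad u z a b -> has_grad v z a b.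
Proof. intros H; apply has_grad_ext_loc; apply filter_forall; exact H. Qed.

Lemma has_grad_continuous u z a b : has_grad u z a b -> continuous u z.
Proof.
intros H; apply continuous_of_2d, differentiable_continuity_pt.
exists a, b; exact H.
Qed.

Lemma has_grad_partial u z a b :
  has_grad u z a b -> partial_x u z = a /\ partial_y u z = b.
Proof. intros H; exact (differentiable_pt_lim_unique _ _ _ _ _ H). Qed.

Lemma has_grad_partial_x u z a b : has_grad u z a b -> partial_x u z = a.
Proof. intros H; apply (has_grad_partial _ _ _ _ H). Qed.

Lemma has_grad_partial_y u z a b : has_grad u z a b -> partial_y u z = b.
Proof. intros H; apply (has_grad_partial _ _ _ _ H). Qed.

Lemma has_grad_curve u (x y : R -> R) t a b x' y' :
  has_grad u (x t, y t) a b -> is_derive x t x' -> is_derive y t y' ->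
  is_derive (fun s => u (x s, y s)) t (a * x' + b * y').
Proof.
intros H Hx Hy; apply is_derive_Reals.
apply (derivable_pt_lim_comp_2d (fun x y => u (x, y))).
- exact H.
- apply is_derive_Reals, Hx.
- apply is_derive_Reals, Hy.
Qed.

Lemma has_grad_comp (u q1 q2 : C -> R) z a b a1 b1 a2 b2 :
  has_grad u (q1 z, q2 z) a b -> has_grad q1 z a1 b1 -> has_grad q2 z a2 b2 ->
  has_grad (fun w => u (q1 w, q2 w)) z (a * a1 + b * a2) (a * b1 + b * b2).
Proof.
intros H H1 H2; destruct z as [x0 y0].
exact (differentiable_pt_lim_comp (fun x y => u (x, y))
  (fun x y => q1 (x, y)) (fun x y => q2 (x, y)) _ _ _ _ _ _ _ _ H H1 H2).
Qed.

Lemma has_grad_fun_Re (F : R -> R) z l :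
  is_derive F (fst z) l -> has_grad (fun w => F (fst w)) z l 0.
Proof.
intros H; apply is_derive_Reals in H.
exact (differentiable_pt_lim_proj1_0 F _ (snd z) _ H).
Qed.

Lemma has_grad_const (k : R) z : has_grad (fun _ => k) z 0 0.
Proof. apply (has_grad_fun_Re (fun _ => k)); apply @is_derive_const. Qed.

Lemma has_grad_Re z : has_grad (fun w => fst w) z 1 0.
Proof. apply (has_grad_fun_Re (fun x => x)); apply @is_derive_id. Qed.

Lemma has_grad_Im z : has_grad (fun w => snd w) z 0 1.
Proof.
intros eps; exists eps; intros u v _ _; simpl.
replace (v - snd z - (0 * (u - fst z) + 1 * (v - snd z))) with 0 by ring.
rewrite Rabs_R0; apply Rmult_le_pos; [apply Rlt_le, cond_pos|].
apply Rle_trans with (1 := Rabs_pos _) (2 := Rmax_l _ _).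
Qed.

Lemma has_grad_fun (F : R -> R) u z l a b :
  is_derive F (u z) l -> has_grad u z a b ->
  has_grad (fun w => F (u w)) z (l * a) (l * b).
Proof.
intros HF Hu.
refine (has_grad_eq _ _ _ _ _ _ (has_grad_comp (fun w => F (fst w)) u
  (fun _ => 0) z l 0 a b 0 0 _ Hu (has_grad_const _ _)) _ _); [|ring|ring].
apply has_grad_fun_Re, HF.
Qed.

Lemma has_grad_lin (k l : R) z : has_grad (fun w => k * fst w + l * snd w) z k l.
Proof.
intros eps; exists eps; intros u v _ _; simpl.
match goal with |- Rabs ?e <= _ => replace e with 0 by ring end.
rewrite Rabs_R0; apply Rmult_le_pos; [apply Rlt_le, cond_pos|].
apply Rle_trans with (1 := Rabs_pos _) (2 := Rmax_l _ _).
Qed.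

Lemma has_grad_plus u v z a b a' b' :
  has_grad u z a b -> has_grad v z a' b' ->
  has_grad (fun w => u w + v w) z (a + a') (b + b').
Proof.
intros Hu Hv; apply has_grad_ext with (fun w => 1 * u w + 1 * v w).
{ intros w; ring. }
refine (has_grad_eq _ _ _ _ _ _
  (has_grad_comp _ u v z _ _ _ _ _ _ (has_grad_lin 1 1 _) Hu Hv) _ _); ring.
Qed.

Lemma has_grad_scal k u z a b :
  has_grad u z a b -> has_grad (fun w => k * u w) z (k * a) (k * b).
Proof.
intros Hu; apply (has_grad_fun (fun x => k * x)); [|exact Hu].
auto_derive; trivial; ring.
Qed.

Lemma has_grad_opp u z a b : has_grad u z a b -> has_grad (fun w => - u w) z (- a) (- b).
Proof.
intros Hu; apply has_grad_ext with (fun w => (-1) * u w); [intros w; ring|].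
refine (has_grad_eq _ _ _ _ _ _ (has_grad_scal (-1) _ _ _ _ Hu) _ _); ring.
Qed.

Lemma has_grad_minus u v z a b a' b' :
  has_grad u z a b -> has_grad v z a' b' ->
  has_grad (fun w => u w - v w) z (a - a') (b - b').
Proof. intros Hu Hv; apply has_grad_plus, has_grad_opp; assumption. Qed.

Lemma has_grad_sqr u z a b :
  has_grad u z a b -> has_grad (fun w => u w ^ 2) z (2 * u z * a) (2 * u z * b).
Proof.
intros Hu; apply (has_grad_fun (fun x => x ^ 2)); [|exact Hu].
auto_derive; trivial; simpl; ring.
Qed.

(* Polarization reduces products to squares of sums. *)
Lemma has_grad_mult u v z a b a' b' :
  has_grad u z a b -> has_grad v z a' b' ->
  has_grad (fun w => u w * v w) z (a * v z + u z * a') (b * v z + u z * b').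
Proof.
intros Hu Hv.
apply has_grad_ext with (fun w => / 4 * ((u w + v w) ^ 2 - (u w - v w) ^ 2)).
{ intros w; field. }
refine (has_grad_eq _ _ _ _ _ _ (has_grad_scal _ _ _ _ _ (has_grad_minus _ _ _ _ _ _ _
  (has_grad_sqr _ _ _ _ (has_grad_plus _ _ _ _ _ _ _ Hu Hv))
  (has_grad_sqr _ _ _ _ (has_grad_minus _ _ _ _ _ _ _ Hu Hv)))) _ _); field.
Qed.

Lemma has_grad_inv u z a b :
  u z <> 0 -> has_grad u z a b ->
  has_grad (fun w => / u w) z (- a / u z ^ 2) (- b / u z ^ 2).
Proof.
intros H0 Hu.
refine (has_grad_eq _ _ _ _ _ _ (has_grad_fun Rinv u z (- / u z ^ 2) a b _ Hu) _ _);
  [|field; exact H0|field; exact H0].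
auto_derive; [exact H0|field; exact H0].
Qed.

Lemma has_grad_ln u z a b :
  0 < u z -> has_grad u z a b ->
  has_grad (fun w => ln (u w)) z (a / u z) (b / u z).
Proof.
intros H0 Hu.
refine (has_grad_eq _ _ _ _ _ _ (has_grad_fun ln u z (/ u z) a b _ Hu) _ _);
  [|field; lra|field; lra].
apply is_derive_Reals, derivable_pt_lim_ln, H0.
Qed.

(** One continuous partial derivative and the existence of the other suffice;
    this is what turns [Ck_on] into total differentiability. *)
Lemma has_grad_of_partials (X : C -> Prop) (u : C -> R) (z : C) :
  open X -> X z ->
  (forall w, X w -> ex_derive (fun t => u (t, snd w)) (fst w) /\
                    ex_derive (fun t => u (fst w, t)) (snd w)) ->
  continuous (partial_x u) z ->
  has_grad u z (partial_x u z) (partial_y u z).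
Proof.
intros HX Hz Hd Hc; destruct z as [x y].
apply (filterdiff_differentiable_pt_lim (fun x y => u (x, y))).
apply (is_derive_filterdiff (fun x y => u (x, y)) x y
  (fun a b => partial_x u (a, b)) (partial_y u (x, y))).
- assert (H : locally ((x, y) : C) X) by (apply HX, Hz).
  destruct H as [d H]; exists d; intros w Hw; specialize (H w Hw).
  destruct (Hd w H) as [H1 _].
  destruct w as [a b]; apply Derive_correct, H1.
- apply Derive_correct, (Hd (x, y) Hz).
- refine (filterlim_ext _ _ _ Hc); intros [a b]; reflexivity.
Qed.

(** * Functions with continuous second partial derivatives *)

Lemma Ck_continuous k X u z : Ck_on k X u -> X z -> continuous u z.
Proof. destruct k; intros H; apply H. Qed.

Lemma partial_x_ext_on (X : C -> Prop) u v z :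
  open X -> (forall w, X w -> u w = v w) -> X z -> partial_x u z = partial_x v z.
Proof.
intros HX H Hz; apply Derive_ext_loc.
assert (L : locally z X) by (apply HX, Hz).
apply locally_square in L; destruct L as [d L]; exists d; intros t Ht; apply H.
apply L; [exact Ht|unfold Im; rewrite Rminus_diag, Rabs_R0; apply cond_pos].
Qed.

Lemma partial_y_ext_on (X : C -> Prop) u v z :
  open X -> (forall w, X w -> u w = v w) -> X z -> partial_y u z = partial_y v z.
Proof.
intros HX H Hz; apply Derive_ext_loc.
assert (L : locally z X) by (apply HX, Hz).
apply locally_square in L; destruct L as [d L]; exists d; intros t Ht; apply H.
apply L; [unfold Re; rewrite Rminus_diag, Rabs_R0; apply cond_pos|exact Ht].
Qed.

Lemma open_locally (X : C -> Prop) z : open X -> X z -> locally z X.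
Proof. intros HX Hz; apply HX, Hz. Qed.

Lemma continuous_ext_on (X : C -> Prop) (u v : C -> R) z :
  open X -> X z -> (forall w, X w -> u w = v w) -> continuous u z -> continuous v z.
Proof.
intros HX Hz H; apply continuous_ext_loc.
apply filter_imp with (2 := open_locally _ _ HX Hz); intros w Hw; apply H, Hw.
Qed.

Lemma is_derive_row u z a b :
  has_grad u z a b -> is_derive (fun t => u (t, snd z)) (fst z) a.
Proof.
intros H; destruct z as [x y].
evar (l : R); replace a with l; [refine (has_grad_curve u (fun t => t) (fun _ => y) x a b 1 0 H _ _)|].
- apply @is_derive_id.
- apply @is_derive_const.
- unfold l; ring.
Qed.

Lemma is_derive_column u z a b :
  has_grad u z a b -> is_derive (fun t => u (fst z, t)) (snd z) b.
Proof.
intros H; destruct z as [x y].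
evar (l : R); replace b with l; [refine (has_grad_curve u (fun _ => x) (fun t => t) y a b 0 1 H _ _)|].
- apply @is_derive_const.
- apply @is_derive_id.
- unfold l; ring.
Qed.

Lemma Ck_on_ext k (X : C -> Prop) u v :
  open X -> (forall w, X w -> u w = v w) -> Ck_on k X u -> Ck_on k X v.
Proof.
intros HX; revert u v; induction k as [|k IH]; intros u v H [H0 H1].
- split; [|trivial].
  intros z Hz; apply (continuous_ext_on X u); auto.
- destruct H1 as (H1 & H2 & H3); split; [|split; [|split]].
  + intros z Hz; apply (continuous_ext_on X u); auto.
  + intros z Hz; specialize (H1 z Hz).
    pose proof (open_locally _ _ HX Hz) as L.
    apply locally_square in L; destruct L as [d L].
    split; [apply ex_derive_ext_loc with (2 := proj1 H1)
           |apply ex_derive_ext_loc with (2 := proj2 H1)];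
      exists d; intros t Ht; apply H, L; try exact Ht;
      unfold Re, Im; rewrite Rminus_diag, Rabs_R0; apply cond_pos.
  + apply IH with (2 := H2); intros w Hw; apply (partial_x_ext_on X); auto.
  + apply IH with (2 := H3); intros w Hw; apply (partial_y_ext_on X); auto.
Qed.

Lemma Ck_on_subset k (X Y : C -> Prop) u :
  (forall z, X z -> Y z) -> Ck_on k Y u -> Ck_on k X u.
Proof.
intros HXY; revert u; induction k as [|k IH]; intros u [A B]; split; auto.
destruct B as (B1 & B2 & B3); split; auto.
Qed.

Lemma Ck_on_intro k (X : C -> Prop) u u1 u2 :
  open X -> (forall z, X z -> has_grad u z (u1 z) (u2 z)) ->
  Ck_on k X u1 -> Ck_on k X u2 -> Ck_on (S k) X u.
Proof.
intros HX H H1 H2; split; [|split; [|split]].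
- intros z Hz; apply (has_grad_continuous _ _ _ _ (H z Hz)).
- intros z Hz; split.
  + exists (u1 z); apply (is_derive_row u z _ _ (H z Hz)).
  + exists (u2 z); apply (is_derive_column u z _ _ (H z Hz)).
- apply (Ck_on_ext k X u1); auto.
  intros w Hw; symmetry; apply (has_grad_partial_x _ _ _ _ (H w Hw)).
- apply (Ck_on_ext k X u2); auto.
  intros w Hw; symmetry; apply (has_grad_partial_y _ _ _ _ (H w Hw)).
Qed.

Lemma Ck_on_grad k (X : C -> Prop) u z :
  open X -> Ck_on (S k) X u -> X z -> has_grad u z (partial_x u z) (partial_y u z).
Proof.
intros HX (_ & H1 & H2 & _) Hz; apply (has_grad_of_partials X); auto.
apply (Ck_continuous k X); assumption.
Qed.

(** [u1, u2] is the gradient of [u] on [X] and [u11, u12, u21, u22] are the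
    derivatives of [u1] and [u2]. Composite functions are handled through this
    relation, since iterated [Derive] does not compute. *)
Definition second_order (X : C -> Prop) (u u1 u2 u11 u12 u21 u22 : C -> R) : Prop :=
  forall z, X z ->
    has_grad u z (u1 z) (u2 z) /\ has_grad u1 z (u11 z) (u12 z) /\
    has_grad u2 z (u21 z) (u22 z).

Lemma C2_second_order (X : C -> Prop) u :
  open X -> Ck_on 2 X u ->
  second_order X u (partial_x u) (partial_y u)
    (partial_x (partial_x u)) (partial_y (partial_x u))
    (partial_x (partial_y u)) (partial_y (partial_y u)).
Proof.
intros HX H z Hz; split; [apply (Ck_on_grad 1 X); auto|].
destruct H as (_ & _ & H2 & H3); split; apply (Ck_on_grad 0 X); auto.
Qed.

Lemma second_order_C2 (X : C -> Prop) u u1 u2 u11 u12 u21 u22 :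
  open X -> second_order X u u1 u2 u11 u12 u21 u22 ->
  (forall z, X z -> continuous u11 z /\ continuous u12 z /\
                    continuous u21 z /\ continuous u22 z) ->
  Ck_on 2 X u.
Proof.
intros HX H Hc; apply (Ck_on_intro 1 X u u1 u2); auto.
- intros z Hz; apply H, Hz.
- apply (Ck_on_intro 0 X u1 u11 u12); auto.
  + intros z Hz; apply H, Hz.
  + split; [intros z Hz; apply (Hc z Hz)|trivial].
  + split; [intros z Hz; apply (Hc z Hz)|trivial].
- apply (Ck_on_intro 0 X u2 u21 u22); auto.
  + intros z Hz; apply H, Hz.
  + split; [intros z Hz; apply (Hc z Hz)|trivial].
  + split; [intros z Hz; apply (Hc z Hz)|trivial].
Qed.

Lemma second_order_laplacian (X : C -> Prop) u u1 u2 u11 u12 u21 u22 z :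
  open X -> second_order X u u1 u2 u11 u12 u21 u22 -> X z ->
  laplacian u z = u11 z + u22 z.
Proof.
intros HX H Hz; unfold laplacian; f_equal.
- rewrite (partial_x_ext_on X (partial_x u) u1); auto.
  + apply (has_grad_partial_x _ _ _ _ (proj1 (proj2 (H z Hz)))).
  + intros w Hw; apply (has_grad_partial_x _ _ _ _ (proj1 (H w Hw))).
- rewrite (partial_y_ext_on X (partial_y u) u2); auto.
  + apply (has_grad_partial_y _ _ _ _ (proj2 (proj2 (H z Hz)))).
  + intros w Hw; apply (has_grad_partial_y _ _ _ _ (proj1 (H w Hw))).
Qed.

Lemma C2_continuous_second (X : C -> Prop) u z :
  Ck_on 2 X u -> X z ->
  continuous (partial_x (partial_x u)) z /\ continuous (partial_y (partial_x u)) z /\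
  continuous (partial_x (partial_y u)) z /\ continuous (partial_y (partial_y u)) z.
Proof.
intros (_ & _ & (_ & _ & H1 & H2) & (_ & _ & H3 & H4)) Hz.
repeat split; apply (Ck_continuous 0 X); assumption.
Qed.

(* Pointwise forms, which unify with continuity goals written with [+] and [*]. *)
Lemma cont_plus (u v : C -> R) z :
  continuous u z -> continuous v z -> continuous (fun w => u w + v w) z.
Proof. intros; apply (continuous_plus (V := R_NormedModule)); assumption. Qed.

Lemma cont_mult (u v : C -> R) z :
  continuous u z -> continuous v z -> continuous (fun w => u w * v w) z.
Proof. intros; apply (continuous_mult (K := R_AbsRing)); assumption. Qed.

Lemma cont_opp (u : C -> R) z : continuous u z -> continuous (fun w => - u w) z.
Proof. intros; apply (continuous_opp (V := R_NormedModule)); assumption. Qed.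

Lemma cont_minus (u v : C -> R) z :
  continuous u z -> continuous v z -> continuous (fun w => u w - v w) z.
Proof. intros; apply cont_plus; [|apply cont_opp]; assumption. Qed.

Lemma cont_const (k : R) (z : C) : continuous (fun _ : C => k) z.
Proof. apply continuous_const. Qed.

Lemma cont_pow (u : C -> R) n z : continuous u z -> continuous (fun w => u w ^ n) z.
Proof.
intros H; induction n as [|n IH]; [apply cont_const|].
apply cont_mult; assumption.
Qed.

Ltac cont_R := repeat match goal with
  | |- continuous (fun _ => _ + _) _ => apply cont_plus
  | |- continuous (fun _ => _ - _) _ => apply cont_minus
  | |- continuous (fun _ => _ * _) _ => apply cont_mult
  | |- continuous (fun _ => _ ^ _) _ => apply cont_pow
  | |- continuous (fun _ => - _) _ => apply cont_opp
  | _ => assumption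
  end.

Lemma second_order_fun (X : C -> Prop) (F F1 F2 : R -> R) u u1 u2 u11 u12 u21 u22 :
  second_order X u u1 u2 u11 u12 u21 u22 ->
  (forall z, X z -> is_derive F (u z) (F1 (u z)) /\ is_derive F1 (u z) (F2 (u z))) ->
  second_order X (fun z => F (u z)) (fun z => F1 (u z) * u1 z) (fun z => F1 (u z) * u2 z)
    (fun z => F2 (u z) * u1 z * u1 z + F1 (u z) * u11 z)
    (fun z => F2 (u z) * u2 z * u1 z + F1 (u z) * u12 z)
    (fun z => F2 (u z) * u1 z * u2 z + F1 (u z) * u21 z)
    (fun z => F2 (u z) * u2 z * u2 z + F1 (u z) * u22 z).
Proof.
intros H HF z Hz; destruct (H z Hz) as (Hu & Hu1 & Hu2), (HF z Hz) as [HF1 HF2].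
split; [|split].
- apply has_grad_fun; assumption.
- apply (has_grad_mult (fun w => F1 (u w))); [apply has_grad_fun|]; assumption.
- apply (has_grad_mult (fun w => F1 (u w))); [apply has_grad_fun|]; assumption.
Qed.

Lemma C2_fun (X : C -> Prop) (F F1 F2 : R -> R) u :
  open X -> Ck_on 2 X u ->
  (forall z, X z -> is_derive F (u z) (F1 (u z)) /\ is_derive F1 (u z) (F2 (u z)) /\
                    continuous F2 (u z)) ->
  Ck_on 2 X (fun z => F (u z)) /\
  (forall z, X z -> partial_x (fun z => F (u z)) z = F1 (u z) * partial_x u z /\
                    partial_y (fun z => F (u z)) z = F1 (u z) * partial_y u z) /\
  (forall z, X z -> laplacian (fun z => F (u z)) z =
                    F1 (u z) * laplacian u z + F2 (u z) * grad_norm_sqr u z).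
Proof.
intros HX Hu HF.
assert (S : second_order X u _ _ _ _ _ _) by (apply C2_second_order; assumption).
assert (S' : forall z, X z ->
   is_derive F (u z) (F1 (u z)) /\ is_derive F1 (u z) (F2 (u z)))
  by (intros z Hz; split; apply (HF z Hz)).
pose proof (second_order_fun X F F1 F2 u _ _ _ _ _ _ S S') as T.
split; [|split].
- apply (second_order_C2 X _ _ _ _ _ _ _ HX T).
  intros z Hz; destruct (C2_continuous_second X u z Hu Hz) as (c1 & c2 & c3 & c4).
  destruct (S z Hz) as (g & g1 & g2), (HF z Hz) as (F'1 & F'2 & F'3).
  assert (k0 : continuous (fun w => F2 (u w)) z).
  { apply (continuous_comp u F2); [apply (has_grad_continuous _ _ _ _ g)|exact F'3]. }
  assert (k1 : continuous (fun w => F1 (u w)) z).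
  { apply (continuous_comp u F1); [apply (has_grad_continuous _ _ _ _ g)|].
    apply (ex_derive_continuous F1); exists (F2 (u z)); exact F'2. }
  pose proof (has_grad_continuous _ _ _ _ g1); pose proof (has_grad_continuous _ _ _ _ g2).
  refine (conj _ (conj _ (conj _ _))); cont_R.
- intros z Hz; apply has_grad_partial, T, Hz.
- intros z Hz; rewrite (second_order_laplacian _ _ _ _ _ _ _ _ _ HX T Hz).
  unfold laplacian, grad_norm_sqr; ring.
Qed.

Lemma C2_plus (X : C -> Prop) u v :
  open X -> Ck_on 2 X u -> Ck_on 2 X v ->
  Ck_on 2 X (fun z => u z + v z) /\
  (forall z, X z -> laplacian (fun z => u z + v z) z = laplacian u z + laplacian v z).
Proof.
intros HX Hu Hv.
pose proof (C2_second_order X u HX Hu) as S; pose proof (C2_second_order X v HX Hv) as T.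
assert (W : second_order X (fun z => u z + v z)
  (fun z => partial_x u z + partial_x v z) (fun z => partial_y u z + partial_y v z)
  (fun z => partial_x (partial_x u) z + partial_x (partial_x v) z)
  (fun z => partial_y (partial_x u) z + partial_y (partial_x v) z)
  (fun z => partial_x (partial_y u) z + partial_x (partial_y v) z)
  (fun z => partial_y (partial_y u) z + partial_y (partial_y v) z)).
{ intros z Hz; destruct (S z Hz) as (a & b & c), (T z Hz) as (a' & b' & c').
  repeat split; apply has_grad_plus; assumption. }
split.
- apply (second_order_C2 X _ _ _ _ _ _ _ HX W).
  intros z Hz; destruct (C2_continuous_second X u z Hu Hz) as (c1 & c2 & c3 & c4).
  destruct (C2_continuous_second X v z Hv Hz) as (d1 & d2 & d3 & d4).
  refine (conj _ (conj _ (conj _ _))); cont_R.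
- intros z Hz; rewrite (second_order_laplacian _ _ _ _ _ _ _ _ _ HX W Hz).
  unfold laplacian; ring.
Qed.

Lemma C2_scal (X : C -> Prop) k u :
  open X -> Ck_on 2 X u ->
  Ck_on 2 X (fun z => k * u z) /\
  (forall z, X z -> laplacian (fun z => k * u z) z = k * laplacian u z).
Proof.
intros HX Hu.
destruct (C2_fun X (fun x => k * x) (fun _ => k) (fun _ => 0) u HX Hu) as (H1 & _ & H2).
- intros z Hz; split; [auto_derive; trivial; ring|split].
  + apply @is_derive_const.
  + apply continuous_const.
- split; [exact H1|intros z Hz; rewrite (H2 z Hz); ring].
Qed.

(** * Maxima on closed disks *)

Definition dist2 (c z : C) : R := (fst z - fst c) ^ 2 + (snd z - snd c) ^ 2.

Lemma sqr_le_Rabs x r : 0 <= r -> x ^ 2 <= r ^ 2 -> Rabs x <= r.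
Proof.
intros Hr H.
rewrite <- (Rabs_pos_eq r Hr); apply Rsqr_le_abs_0; unfold Rsqr; nra.
Qed.

Lemma dist2_fst c z r : 0 <= r -> dist2 c z <= r ^ 2 -> Rabs (fst z - fst c) <= r.
Proof.
intros Hr H; apply sqr_le_Rabs; [exact Hr|].
unfold dist2 in H; pose proof (pow2_ge_0 (snd z - snd c)); lra.
Qed.

Lemma dist2_snd c z r : 0 <= r -> dist2 c z <= r ^ 2 -> Rabs (snd z - snd c) <= r.
Proof.
intros Hr H; apply sqr_le_Rabs; [exact Hr|].
unfold dist2 in H; pose proof (pow2_ge_0 (fst z - fst c)); lra.
Qed.

Lemma has_grad_dist2 c z :
  has_grad (dist2 c) z (2 * (fst z - fst c)) (2 * (snd z - snd c)).
Proof.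
refine (has_grad_eq _ _ _ _ _ _ (has_grad_plus _ _ _ _ _ _ _
  (has_grad_sqr _ _ _ _ (has_grad_minus _ _ _ _ _ _ _ (has_grad_Re z) (has_grad_const (fst c) z)))
  (has_grad_sqr _ _ _ _ (has_grad_minus _ _ _ _ _ _ _ (has_grad_Im z) (has_grad_const (snd c) z))))
  _ _); ring.
Qed.

Lemma dist2_continuous c z : continuous (dist2 c) z.
Proof. apply (has_grad_continuous _ _ _ _ (has_grad_dist2 c z)). Qed.

Lemma continuous_lt (u : C -> R) z k : continuous u z -> u z < k -> locally z (fun w => u w < k).
Proof.
intros H Hk; apply (H (fun y => y < k)); exists (mkposreal _ (proj2 (Rlt_0_minus _ _) Hk)); intros y Hy.
unfold ball in Hy; simpl in Hy; unfold AbsRing_ball, abs, minus, plus, opp in Hy; simpl in Hy.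
apply Rabs_def2 in Hy; lra.
Qed.

Lemma continuous_gt (u : C -> R) z k : continuous u z -> k < u z -> locally z (fun w => k < u w).
Proof.
intros H Hk; assert (H' : continuous (fun w => - u w) z) by (apply cont_opp, H).
apply filter_imp with (2 := continuous_lt _ z (- k) H' ltac:(lra)).
intros w; lra.
Qed.

Lemma open_dist2 c k : open (fun z => dist2 c z < k).
Proof. intros z Hz; apply continuous_lt; [apply dist2_continuous|exact Hz]. Qed.

Lemma subsequence_of_adherent (x : nat -> R) l :
  ValAdh x l ->
  exists phi : nat -> nat, forall k, (k <= phi k)%nat /\ Rabs (x (phi k) - l) < / (INR k + 1).
Proof.
intros H.
apply (functional_choice (fun k n => (k <= n)%nat /\ Rabs (x n - l) < / (INR k + 1))).
intros k.
assert (Hk : 0 < / (INR k + 1)) by (apply Rinv_0_lt_compat; pose proof (pos_INR k); lra).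
destruct (H (disc l (mkposreal _ Hk)) k) as [n [Hn1 Hn2]].
- exists (mkposreal _ Hk); intros y Hy; exact Hy.
- exists n; split; [exact Hn1|exact Hn2].
Qed.

Lemma small_inverse d : 0 < d -> exists N, forall n, (N <= n)%nat -> / (INR n + 1) < d.
Proof.
intros Hd; destruct (archimed_cor1 d Hd) as [N [HN HN']]; exists N; intros n Hn.
apply Rle_lt_trans with (2 := HN), Rinv_le_contravar.
- apply lt_0_INR; lia.
- apply le_INR in Hn; lra.
Qed.

(** Two successive extractions, one for each coordinate. *)
Lemma closed_disk_adherent c r (s : nat -> C) :
  0 <= r -> (forall n, dist2 c (s n) <= r ^ 2) ->
  exists m, dist2 c m <= r ^ 2 /\
    forall P : C -> Prop, locally m P -> forall N, exists n, (N <= n)%nat /\ P (s n).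
Proof.
intros Hr Hs.
assert (Hc : forall a, compact (fun x => a - r <= x <= a + r)) by (intros a; apply compact_P3).
destruct (Bolzano_Weierstrass (fun n => fst (s n)) _ (Hc (fst c))) as [l1 H1].
{ intros n; pose proof (Rabs_le_between' (fst (s n)) (fst c) r) as B.
  apply B, dist2_fst; auto. }
destruct (subsequence_of_adherent _ _ H1) as [phi Hphi].
destruct (Bolzano_Weierstrass (fun n => snd (s (phi n))) _ (Hc (snd c))) as [l2 H2].
{ intros n; pose proof (Rabs_le_between' (snd (s (phi n))) (snd c) r) as B.
  apply B, dist2_snd; auto. }
destruct (subsequence_of_adherent _ _ H2) as [psi Hpsi].
assert (A : forall P : C -> Prop, locally ((l1, l2) : C) P ->
  forall N, exists n, (N <= n)%nat /\ P (s n)).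
{ intros P HP N; apply locally_square in HP; destruct HP as [d HP].
  destruct (small_inverse d (cond_pos d)) as [M HM].
  exists (phi (psi (N + M)%nat)).
  destruct (Hpsi (N + M)%nat) as [p1 p2]; destruct (Hphi (psi (N + M)%nat)) as [q1 q2].
  split; [lia|].
  rewrite (surjective_pairing (s _)); apply HP; simpl.
  - apply Rlt_trans with (1 := q2), HM; lia.
  - apply Rlt_trans with (1 := p2), HM; lia. }
exists (l1, l2); split; [|exact A].
apply Rnot_lt_le; intros Hlt.
destruct (A _ (continuous_gt _ _ _ (dist2_continuous c (l1, l2)) Hlt) 0%nat) as [n [_ Hn]].
pose proof (Hs n); lra.
Qed.

(** A maximizing sequence, or one along which [u] is unbounded, has a limit point
    in the disk, where continuity decides. *)
Lemma closed_disk_max (u : C -> R) c r :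
  0 <= r -> (forall z, dist2 c z <= r ^ 2 -> continuous u z) ->
  exists m, dist2 c m <= r ^ 2 /\ forall z, dist2 c z <= r ^ 2 -> u z <= u m.
Proof.
intros Hr Hu.
assert (Hcc : dist2 c c <= r ^ 2) by (unfold dist2; nra).
destruct (classic (exists M, forall z, dist2 c z <= r ^ 2 -> u z <= M)) as [[M HM]|Hun].
- destruct (completeness (fun y => exists z, dist2 c z <= r ^ 2 /\ y = u z)) as [S [HS1 HS2]].
  + exists M; intros y [z [Hz ->]]; auto.
  + exists (u c), c; auto.
  + assert (Hseq : forall n : nat, exists z, dist2 c z <= r ^ 2 /\ S - / (INR n + 1) < u z).
    { intros n; apply NNPP; intros Hn.
      assert (0 < / (INR n + 1)) by (apply Rinv_0_lt_compat; pose proof (pos_INR n); lra).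
      assert (S <= S - / (INR n + 1)); [|lra].
      apply HS2; intros y [z [Hz ->]]; apply Rnot_lt_le; intros Hlt.
      apply Hn; exists z; auto. }
    apply functional_choice in Hseq; destruct Hseq as [s Hs].
    destruct (closed_disk_adherent c r s Hr (fun n => proj1 (Hs n))) as [m [Hm1 Hm2]].
    exists m; split; [exact Hm1|]; intros z Hz; apply Rle_trans with S.
    * apply HS1; exists z; auto.
    * apply Rnot_lt_le; intros Hlt.
      destruct (small_inverse ((S - u m) / 2) ltac:(lra)) as [N HN].
      destruct (Hm2 _ (continuous_lt u m ((S + u m) / 2) (Hu m Hm1) ltac:(lra)) N)
        as [n [Hn1 Hn2]].
      pose proof (HN n Hn1); pose proof (proj2 (Hs n)); lra.
- assert (Hseq : forall n : nat, exists z, dist2 c z <= r ^ 2 /\ INR n < u z).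
  { intros n; apply NNPP; intros Hn; apply Hun; exists (INR n); intros z Hz.
    apply Rnot_lt_le; intros Hlt; apply Hn; exists z; auto. }
  apply functional_choice in Hseq; destruct Hseq as [s Hs].
  destruct (closed_disk_adherent c r s Hr (fun n => proj1 (Hs n))) as [m [Hm1 Hm2]].
  exfalso.
  destruct (INR_unbounded (u m + 1)) as [N HN].
  destruct (Hm2 _ (continuous_lt u m (u m + 1) (Hu m Hm1) ltac:(lra)) N) as [n [Hn1 Hn2]].
  apply le_INR in Hn1; pose proof (proj2 (Hs n)); lra.
Qed.

Lemma derivative_sign (g : R -> R) x l :
  is_derive g x l -> 0 < l ->
  exists d, 0 < d /\ (forall t, x < t < x + d -> g x < g t) /\
                     (forall t, x - d < t < x -> g t < g x).
Proof.
intros H Hl; apply is_derive_Reals in H.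
destruct (H l Hl) as [d Hd]; exists d; split; [apply cond_pos|split; intros t Ht].
- assert (E : Rabs ((g (x + (t - x)) - g x) / (t - x) - l) < l).
  { apply Hd; [lra|rewrite Rabs_pos_eq; lra]. }
  replace (x + (t - x)) with t in E by ring; apply Rabs_def2 in E.
  assert (Hq : 0 < (g t - g x) / (t - x)) by lra.
  apply (Rmult_lt_compat_r (t - x)) in Hq; [|lra].
  unfold Rdiv in Hq; rewrite Rmult_assoc, Rinv_l in Hq; lra.
- assert (E : Rabs ((g (x + (t - x)) - g x) / (t - x) - l) < l).
  { apply Hd; [lra|rewrite Rabs_left; lra]. }
  replace (x + (t - x)) with t in E by ring; apply Rabs_def2 in E.
  assert (Hq : 0 < (g t - g x) / (t - x)) by lra.
  apply (Rmult_lt_compat_r (x - t)) in Hq; [|lra].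
  replace ((g t - g x) / (t - x) * (x - t)) with (- (g t - g x)) in Hq by (field; lra).
  lra.
Qed.

(** If the second derivative were positive, the first derivative would be
    strictly increasing at [x], and [g] would exceed [g x] on one of the two
    sides, according to the sign of [g1 x]. *)
Lemma second_derivative_at_max (g g1 : R -> R) x l :
  locally x (fun t => is_derive g t (g1 t)) -> is_derive g1 x l ->
  locally x (fun t => g t <= g x) -> l <= 0.
Proof.
intros [d1 H1] H2 [d2 H3]; apply Rnot_lt_le; intros Hl.
destruct (derivative_sign g1 x l H2 Hl) as [d3 (Hd3 & Hr & Hle)].
set (d := Rmin (Rmin d1 d2) d3).
assert (Hd : 0 < d) by (repeat apply Rmin_pos; try apply cond_pos; auto).
assert (Hdd : d <= d1 /\ d <= d2 /\ d <= d3).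
{ unfold d; pose proof (Rmin_l (Rmin d1 d2) d3); pose proof (Rmin_r (Rmin d1 d2) d3).
  pose proof (Rmin_l d1 d2); pose proof (Rmin_r d1 d2); lra. }
assert (B : forall (e : posreal) t, Rabs (t - x) < e -> ball x e t) by (intros e t Ht; exact Ht).
assert (D : forall t, Rabs (t - x) < d -> is_derive g t (g1 t)).
{ intros t Ht; apply H1, B; lra. }
destruct (Rle_lt_dec 0 (g1 x)) as [H0|H0].
- destruct (MVT_cor2 g g1 x (x + d / 2)) as [c [Hc1 Hc2]]; [lra| |].
  + intros t Ht; apply is_derive_Reals, D; rewrite Rabs_pos_eq; lra.
  + assert (g (x + d / 2) <= g x) by (apply H3, B; rewrite Rabs_pos_eq; lra).
    pose proof (Hr c ltac:(lra)); nra.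
- destruct (MVT_cor2 g g1 (x - d / 2) x) as [c [Hc1 Hc2]]; [lra| |].
  + intros t Ht; apply is_derive_Reals, D; rewrite Rabs_left1; lra.
  + assert (g (x - d / 2) <= g x) by (apply H3, B; rewrite Rabs_left; lra).
    pose proof (Hle c ltac:(lra)); nra.
Qed.

Lemma laplacian_at_max (X : C -> Prop) u z :
  open X -> Ck_on 2 X u -> X z -> locally z (fun w => u w <= u z) -> laplacian u z <= 0.
Proof.
intros HX Hu Hz Hm.
pose proof (C2_second_order X u HX Hu) as S.
pose proof (open_locally _ _ HX Hz) as L.
apply locally_square in L; destruct L as [d L].
apply locally_square in Hm; destruct Hm as [e Hm].
assert (E : forall x, Rabs (x - x) < d) by (intros x; rewrite Rminus_diag, Rabs_R0; apply cond_pos).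
assert (E' : forall x, Rabs (x - x) < e) by (intros x; rewrite Rminus_diag, Rabs_R0; apply cond_pos).
assert (H1 : partial_x (partial_x u) z <= 0).
{ apply (second_derivative_at_max (fun t => u (t, snd z)) (fun t => partial_x u (t, snd z)) (fst z)).
  - exists d; intros t Ht.
    apply (is_derive_row u (t, snd z) _ _ (proj1 (S _ (L t (snd z) Ht (E _))))).
  - apply (is_derive_row _ _ _ _ (proj1 (proj2 (S z Hz)))).
  - exists e; intros t Ht; destruct z as [x y]; apply (Hm t y Ht (E' _)). }
assert (H2 : partial_y (partial_y u) z <= 0).
{ apply (second_derivative_at_max (fun t => u (fst z, t)) (fun t => partial_y u (fst z, t)) (snd z)).
  - exists d; intros t Ht.
    apply (is_derive_column u (fst z, t) _ _ (proj1 (S _ (L (fst z) t (E _) Ht)))).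
  - apply (is_derive_column _ _ _ _ (proj2 (proj2 (S z Hz)))).
  - exists e; intros t Ht; destruct z as [x y]; apply (Hm x t (E' _) Ht). }
unfold laplacian; lra.
Qed.

(** * Complex derivatives *)

(** Complex differentiability, as the Cauchy-Riemann equations for the two
    components. *)
Definition holo_at (p : C -> C) (z d : C) : Prop :=
  has_grad (fun w => fst (p w)) z (fst d) (- snd d) /\
  has_grad (fun w => snd (p w)) z (snd d) (fst d).

Definition cderiv (p : C -> C) (z : C) : C :=
  (partial_x (fun w => fst (p w)) z, partial_x (fun w => snd (p w)) z).

Lemma C_ext (z w : C) : fst z = fst w -> snd z = snd w -> z = w.
Proof. destruct z, w; simpl; intros -> ->; reflexivity. Qed.

Lemma holo_at_cderiv p z d : holo_at p z d -> cderiv p z = d.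
Proof.
intros [H1 H2]; apply C_ext; simpl; [apply (has_grad_partial_x _ _ _ _ H1)|].
apply (has_grad_partial_x _ _ _ _ H2).
Qed.

Lemma holo_at_eq p z d d' : holo_at p z d -> d = d' -> holo_at p z d'.
Proof. intros H <-; exact H. Qed.

Lemma holo_at_ext_loc p q z d :
  locally z (fun w => p w = q w) -> holo_at p z d -> holo_at q z d.
Proof.
intros H [H1 H2]; split.
- apply has_grad_ext_loc with (2 := H1); apply filter_imp with (2 := H); intros w ->; reflexivity.
- apply has_grad_ext_loc with (2 := H2); apply filter_imp with (2 := H); intros w ->; reflexivity.
Qed.

Lemma continuous_C (p : C -> C) (z : C) :
  continuous (fun w => fst (p w)) z -> continuous (fun w => snd (p w)) z -> continuous p z.
Proof.
intros H1 H2 P [d HP].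
assert (A1 := H1 _ (locally_ball (fst (p z)) d)).
assert (A2 := H2 _ (locally_ball (snd (p z)) d)).
unfold filtermap in A1, A2; destruct A1 as [d1 A1], A2 as [d2 A2].
exists (mkposreal _ (Rmin_pos _ _ (cond_pos d1) (cond_pos d2))); intros w Hw.
apply HP; split.
- apply A1, ball_le with (2 := Hw), Rmin_l.
- apply A2, ball_le with (2 := Hw), Rmin_r.
Qed.

Lemma continuous_fst_C (p : C -> C) (z : C) : continuous p z -> continuous (fun w => fst (p w)) z.
Proof.
intros H; apply (continuous_comp p fst); [exact H|].
apply (has_grad_continuous _ _ _ _ (has_grad_Re (p z))).
Qed.

Lemma continuous_snd_C (p : C -> C) (z : C) : continuous p z -> continuous (fun w => snd (p w)) z.
Proof.
intros H; apply (continuous_comp p snd); [exact H|].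
apply (has_grad_continuous _ _ _ _ (has_grad_Im (p z))).
Qed.

Lemma holo_at_continuous p z d : holo_at p z d -> continuous p z.
Proof.
intros [H1 H2]; apply continuous_C.
- apply (has_grad_continuous _ _ _ _ H1).
- apply (has_grad_continuous _ _ _ _ H2).
Qed.

Lemma holo_at_of_bound p z d :
  (forall eps, 0 < eps -> locally z (fun w => Cmod (p w - p z - d * (w - z))%C <= eps * Cmod (w - z)%C)) ->
  holo_at p z d.
Proof.
intros H; assert (Hs : 0 < sqrt 2) by (apply sqrt_lt_R0; lra).
assert (B : forall eps : posreal, exists e : posreal, forall x y,
  Rabs (x - fst z) < e -> Rabs (y - snd z) < e ->
  Rmax (Rabs (fst (p (x, y) - p z - d * ((x, y) - z))%C)) (Rabs (snd (p (x, y) - p z - d * ((x, y) - z))%C))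
  <= eps * Rmax (Rabs (x - fst z)) (Rabs (y - snd z))).
{ intros eps; destruct (proj1 (locally_square _ _) (H (eps / sqrt 2)
    (Rdiv_lt_0_compat _ _ (cond_pos eps) Hs))) as [e He].
  exists e; intros x y Hx Hy; apply Rle_trans with (1 := Rmax_Cmod _), Rle_trans with (1 := He x y Hx Hy).
  unfold Rdiv; rewrite Rmult_assoc; apply Rmult_le_compat_l; [apply Rlt_le, cond_pos|].
  apply Rmult_le_reg_l with (sqrt 2); [exact Hs|].
  rewrite <- Rmult_assoc, Rinv_r, Rmult_1_l by lra; exact (Cmod_2Rmax ((x, y) - z)%C). }
split; intros eps; destruct (B eps) as [e He]; exists e; intros x y Hx Hy;
  apply Rle_trans with (2 := He x y Hx Hy).
- apply Rle_trans with (2 := Rmax_l _ _); right; f_equal; destruct z; simpl; ring.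
- apply Rle_trans with (2 := Rmax_r _ _); right; f_equal; destruct z; simpl; ring.
Qed.

Lemma Cmod_le_Rabs (z : C) : Cmod z <= Rabs (fst z) + Rabs (snd z).
Proof.
replace z with ((fst z, 0) + (0, snd z))%C at 1 by (apply C_ext; simpl; ring).
apply Rle_trans with (1 := Cmod_triangle _ _); right; f_equal.
- exact (Cmod_R (fst z)).
- unfold Cmod; simpl; rewrite <- sqrt_Rsqr_abs; f_equal; unfold Rsqr; ring.
Qed.

Lemma holo_at_bound p z d :
  holo_at p z d -> forall eps, 0 < eps ->
  locally z (fun w => Cmod (p w - p z - d * (w - z))%C <= eps * Cmod (w - z)%C).
Proof.
intros [H1 H2] eps He; assert (He2 : 0 < eps / 2) by lra.
destruct (H1 (mkposreal _ He2)) as [d1 B1], (H2 (mkposreal _ He2)) as [d2 B2].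
apply locally_square; simpl in B1, B2.
exists (mkposreal _ (Rmin_pos _ _ (cond_pos d1) (cond_pos d2))); simpl; intros x y Hx Hy.
assert (L1 := Rmin_l d1 d2); assert (L2 := Rmin_r d1 d2).
specialize (B1 x y ltac:(lra) ltac:(lra)); specialize (B2 x y ltac:(lra) ltac:(lra)).
pose proof (Rmax_Cmod ((x, y) - z)%C) as M; simpl in M.
unfold Rminus in B1, B2.
apply Rle_trans with (1 := Cmod_le_Rabs _).
replace (fst (p (x, y) - p z - d * ((x, y) - z))%C)
  with (fst (p (x, y)) + - fst (p (fst z, snd z)) + - (fst d * (x + - fst z) + - snd d * (y + - snd z)))
  by (destruct z; simpl; ring).
replace (snd (p (x, y) - p z - d * ((x, y) - z))%C)
  with (snd (p (x, y)) + - snd (p (fst z, snd z)) + - (snd d * (x + - fst z) + fst d * (y + - snd z)))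
  by (destruct z; simpl; ring).
unfold Rdiv in B1, B2; nra.
Qed.

Lemma holo_at_of_C_derive (p : C -> C) (z : C) :
  @ex_derive C_AbsRing C_NormedModule p z -> exists d, holo_at p z d.
Proof.
intros [d [_ H]]; exists d; apply holo_at_of_bound; intros eps He.
assert (Hz : is_filter_lim (@locally (AbsRing_UniformSpace C_AbsRing) z) z).
{ intros P HP; exact HP. }
specialize (H z Hz (mkposreal _ He)); destruct H as [e H]; simpl in H.
apply locally_square.
assert (He2 : 0 < e / 2) by (apply Rdiv_lt_0_compat; [apply cond_pos|lra]).
exists (mkposreal _ He2); simpl; intros x y Hx Hy.
replace (d * ((x, y) - z))%C with (((x, y) - z) * d)%C by (apply C_ext; simpl; ring).
apply (H (x, y)).
apply Rle_lt_trans with (1 := Cmod_le_Rabs _).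
destruct z; unfold minus, plus, opp; simpl in *; unfold Rminus in Hx, Hy; lra.
Qed.

Lemma holo_at_const c z : holo_at (fun _ => c) z 0.
Proof. split; eapply has_grad_eq; try apply has_grad_const; simpl; ring. Qed.

Lemma holo_at_id z : holo_at (fun w => w) z 1.
Proof.
split; eapply has_grad_eq; try apply has_grad_Re; try apply has_grad_Im; simpl; ring.
Qed.

Lemma holo_at_plus p q z d e :
  holo_at p z d -> holo_at q z e -> holo_at (fun w => p w + q w)%C z (d + e)%C.
Proof.
intros [H1 H2] [K1 K2]; split; simpl.
- eapply has_grad_eq; [apply has_grad_plus; eassumption| |]; ring.
- eapply has_grad_eq; [apply has_grad_plus; eassumption| |]; ring.
Qed.

Lemma holo_at_mult p q z d e :
  holo_at p z d -> holo_at q z e ->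
  holo_at (fun w => p w * q w)%C z (d * q z + p z * e)%C.
Proof.
intros [H1 H2] [K1 K2]; split; simpl.
- eapply has_grad_eq; [apply has_grad_minus; apply has_grad_mult; eassumption| |]; simpl; ring.
- eapply has_grad_eq; [apply has_grad_plus; apply has_grad_mult; eassumption| |]; simpl; ring.
Qed.

Lemma holo_at_scal c p z d : holo_at p z d -> holo_at (fun w => c * p w)%C z (c * d)%C.
Proof.
intros H; eapply holo_at_eq; [apply (holo_at_mult (fun _ => c)); [apply holo_at_const|exact H]|].
simpl; ring.
Qed.

Lemma holo_at_opp p z d : holo_at p z d -> holo_at (fun w => - p w)%C z (- d)%C.
Proof.
intros [H1 H2]; split; simpl; apply has_grad_opp; assumption.
Qed.

Lemma holo_at_minus p q z d e :
  holo_at p z d -> holo_at q z e -> holo_at (fun w => p w - q w)%C z (d - e)%C.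
Proof. intros H K; apply holo_at_plus; [exact H|apply holo_at_opp, K]. Qed.

Lemma C_norm2_pos (z : C) : z <> RtoC 0 -> 0 < fst z ^ 2 + snd z ^ 2.
Proof.
intros H; destruct (Req_dec (fst z) 0) as [H1|H1]; destruct (Req_dec (snd z) 0) as [H2|H2]; try nra.
exfalso; apply H, C_ext; assumption.
Qed.

Lemma holo_at_inv (p : C -> C) z d :
  p z <> RtoC 0 -> holo_at p z d -> holo_at (fun w => / p w)%C z (- d / (p z * p z))%C.
Proof.
intros H0 [H1 H2]; pose proof (C_norm2_pos _ H0) as N.
assert (HN := has_grad_inv (fun w => fst (p w) ^ 2 + snd (p w) ^ 2) z _ _ ltac:(lra)
  (has_grad_plus _ _ _ _ _ _ _ (has_grad_sqr _ _ _ _ H1) (has_grad_sqr _ _ _ _ H2))).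
assert (H4 : (fst (p z) * fst (p z) - snd (p z) * snd (p z)) ^ 2 +
   (fst (p z) * snd (p z) + snd (p z) * fst (p z)) ^ 2 <> 0).
{ replace (_ + _) with ((fst (p z) ^ 2 + snd (p z) ^ 2) ^ 2) by ring.
  apply pow_nonzero; lra. }
split; simpl fst; simpl snd.
- eapply has_grad_eq; [apply (has_grad_mult _ _ _ _ _ _ _ H1 HN)| |]; simpl in *; field; simpl; lra.
- eapply has_grad_eq; [apply (has_grad_mult _ _ _ _ _ _ _ (has_grad_opp _ _ _ _ H2) HN)| |];
    simpl in *; field; simpl; lra.
Qed.

Lemma holo_at_comp p q z d e :
  holo_at p (q z) d -> holo_at q z e -> holo_at (fun w => p (q w)) z (d * e)%C.
Proof.
intros [H1 H2] [K1 K2]; split; simpl.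
- apply has_grad_ext with (fun w => fst (p (fst (q w), snd (q w)))).
  { intros w; rewrite <- surjective_pairing; reflexivity. }
  rewrite (surjective_pairing (q z)) in H1.
  eapply has_grad_eq; [apply (has_grad_comp (fun w => fst (p w)) _ _ z _ _ _ _ _ _ H1 K1 K2)| |]; ring.
- apply has_grad_ext with (fun w => snd (p (fst (q w), snd (q w)))).
  { intros w; rewrite <- surjective_pairing; reflexivity. }
  rewrite (surjective_pairing (q z)) in H2.
  eapply has_grad_eq; [apply (has_grad_comp (fun w => snd (p w)) _ _ z _ _ _ _ _ _ H2 K1 K2)| |]; ring.
Qed.

(** * Goursat's lemma *)

Definition circulation (P Q : C -> R) (a b c d : R) : R :=
  RInt (fun x => P (x, c)) a b + RInt (fun y => Q (b, y)) c d
  - RInt (fun x => P (x, d)) a b - RInt (fun y => Q (a, y)) c d.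

(** Closedness of [P dx + Q dy], with no continuity of the derivatives: this is
    what complex differentiability gives. *)
Definition closed_at (P Q : C -> R) (z : C) : Prop :=
  exists p k q, has_grad P z p k /\ has_grad Q z k q.

Definition continuous_pair_on (P Q : C -> R) (a b c d : R) : Prop :=
  forall x y, a <= x <= b -> c <= y <= d -> continuous P (x, y) /\ continuous Q (x, y).

Lemma continuous_row (u : C -> R) x y : continuous u (x, y) -> continuous (fun t => u (t, y)) x.
Proof.
intros H; apply (continuous_comp_2 (fun t => t) (fun _ => y) (fun a b => u (a, b)) x).
- apply continuous_id.
- apply continuous_const.
- refine (filterlim_ext _ _ _ H); intros [a b]; reflexivity.
Qed.

Lemma continuous_column (u : C -> R) x y : continuous u (x, y) -> continuous (fun t => u (x, t)) y.
Proof.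
intros H; apply (continuous_comp_2 (fun _ => x) (fun t => t) (fun a b => u (a, b)) y).
- apply continuous_const.
- apply continuous_id.
- refine (filterlim_ext _ _ _ H); intros [a b]; reflexivity.
Qed.

Lemma ex_RInt_row (u : C -> R) a b y :
  (forall x, Rmin a b <= x <= Rmax a b -> continuous u (x, y)) ->
  ex_RInt (fun t => u (t, y)) a b.
Proof.
intros H; apply (ex_RInt_continuous (V := R_CompleteNormedModule)).
intros t Ht; apply continuous_row, H, Ht.
Qed.

Lemma ex_RInt_column (u : C -> R) x c d :
  (forall y, Rmin c d <= y <= Rmax c d -> continuous u (x, y)) ->
  ex_RInt (fun t => u (x, t)) c d.
Proof.
intros H; apply (ex_RInt_continuous (V := R_CompleteNormedModule)).
intros t Ht; apply continuous_column, H, Ht.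
Qed.

Lemma RInt_Chasles_R (f : R -> R) a b c :
  ex_RInt f a b -> ex_RInt f b c -> RInt f a c = RInt f a b + RInt f b c.
Proof. intros H1 H2; symmetry; apply (RInt_Chasles f a b c H1 H2). Qed.

Lemma circulation_split_x P Q a m b c d :
  a <= m <= b -> c <= d -> continuous_pair_on P Q a b c d ->
  circulation P Q a b c d = circulation P Q a m c d + circulation P Q m b c d.
Proof.
intros Hm Hcd H; unfold circulation.
rewrite (RInt_Chasles_R (fun x => P (x, c)) a m b), (RInt_Chasles_R (fun x => P (x, d)) a m b).
- ring.
- apply ex_RInt_row; rewrite Rmin_left, Rmax_right by lra; intros x Hx; apply H; lra.
- apply ex_RInt_row; rewrite Rmin_left, Rmax_right by lra; intros x Hx; apply H; lra.
- apply ex_RInt_row; rewrite Rmin_left, Rmax_right by lra; intros x Hx; apply H; lra.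
- apply ex_RInt_row; rewrite Rmin_left, Rmax_right by lra; intros x Hx; apply H; lra.
Qed.

Lemma circulation_split_y P Q a b c n d :
  a <= b -> c <= n <= d -> continuous_pair_on P Q a b c d ->
  circulation P Q a b c d = circulation P Q a b c n + circulation P Q a b n d.
Proof.
intros Hab Hn H; unfold circulation.
rewrite (RInt_Chasles_R (fun y => Q (a, y)) c n d), (RInt_Chasles_R (fun y => Q (b, y)) c n d).
- ring.
- apply ex_RInt_column; rewrite Rmin_left, Rmax_right by lra; intros x Hx; apply H; lra.
- apply ex_RInt_column; rewrite Rmin_left, Rmax_right by lra; intros x Hx; apply H; lra.
- apply ex_RInt_column; rewrite Rmin_left, Rmax_right by lra; intros x Hx; apply H; lra.
- apply ex_RInt_column; rewrite Rmin_left, Rmax_right by lra; intros x Hx; apply H; lra.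
Qed.

Lemma continuous_pair_sub P Q a b c d a' b' c' d' :
  continuous_pair_on P Q a b c d -> a <= a' -> b' <= b -> c <= c' -> d' <= d ->
  continuous_pair_on P Q a' b' c' d'.
Proof. intros H H1 H2 H3 H4 x y Hx Hy; apply H; lra. Qed.

Lemma RInt_near_const (f : R -> R) a b m e :
  a <= b -> ex_RInt f a b -> (forall t, a <= t <= b -> Rabs (f t - m) <= e) ->
  Rabs (RInt f a b - m * (b - a)) <= e * (b - a).
Proof.
intros Hab Hf H.
assert (E : RInt f a b - m * (b - a) = RInt (fun t => f t - m) a b).
{ rewrite (RInt_minus (V := R_CompleteNormedModule) f (fun _ => m)), RInt_const;
    [unfold minus, plus, opp, scal; simpl; unfold mult; simpl; ring|exact Hf|apply ex_RInt_const]. }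
rewrite E, (Rmult_comm e); apply abs_RInt_le_const; auto.
apply (ex_RInt_minus (V := R_CompleteNormedModule)); [exact Hf|apply ex_RInt_const].
Qed.

(** Near a point of differentiability the linear terms cancel around the
    rectangle, and the circulation is small compared with the square of the
    diameter. *)
Lemma circulation_small P Q z eps :
  closed_at P Q z -> 0 < eps ->
  exists delta : posreal, forall a c s t,
    a <= fst z <= a + s -> c <= snd z <= c + t -> s + t < delta ->
    continuous_pair_on P Q a (a + s) c (c + t) ->
    Rabs (circulation P Q a (a + s) c (c + t)) <= 2 * eps * (s + t) ^ 2.
Proof.
destruct z as [x0 y0]; intros (p & k & q & HP & HQ) He.
destruct (HP (mkposreal _ He)) as [d1 B1], (HQ (mkposreal _ He)) as [d2 B2]; simpl in B1, B2.
exists (mkposreal _ (Rmin_pos _ _ (cond_pos d1) (cond_pos d2))); simpl fst; simpl snd; simpl pos; intros a c s t Ha Hc Hd HC.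
assert (L1 := Rmin_l d1 d2); assert (L2 := Rmin_r d1 d2).
assert (A : forall x y, a <= x <= a + s -> c <= y <= c + t ->
  Rabs (x - x0) <= s + t /\ Rabs (y - y0) <= s + t).
{ intros x y Hx Hy; split; apply Rabs_le; lra. }
assert (M : forall x y, a <= x <= a + s -> c <= y <= c + t ->
  Rmax (Rabs (x - x0)) (Rabs (y - y0)) <= s + t).
{ intros x y Hx Hy; destruct (A x y Hx Hy); apply Rmax_lub; assumption. }
assert (B1' : forall x y, a <= x <= a + s -> c <= y <= c + t ->
  Rabs (P (x, y) - P (x0, y0) - (p * (x - x0) + k * (y - y0))) <= eps * (s + t)).
{ intros x y Hx Hy; destruct (A x y Hx Hy).
  eapply Rle_trans; [apply B1; lra|apply Rmult_le_compat_l; [lra|apply M; assumption]]. }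
assert (B2' : forall x y, a <= x <= a + s -> c <= y <= c + t ->
  Rabs (Q (x, y) - Q (x0, y0) - (k * (x - x0) + q * (y - y0))) <= eps * (s + t)).
{ intros x y Hx Hy; destruct (A x y Hx Hy).
  eapply Rle_trans; [apply B2; lra|apply Rmult_le_compat_l; [lra|apply M; assumption]]. }
assert (E1 : forall y, c <= y <= c + t -> ex_RInt (fun x => P (x, y)) a (a + s)).
{ intros y Hy; apply ex_RInt_row; rewrite Rmin_left, Rmax_right by lra; intros x Hx; apply HC; lra. }
assert (E2 : forall x, a <= x <= a + s -> ex_RInt (fun y => Q (x, y)) c (c + t)).
{ intros x Hx; apply ex_RInt_column; rewrite Rmin_left, Rmax_right by lra; intros y Hy; apply HC; lra. }
assert (I1 := RInt_near_const (fun x => P (x, c) - P (x, c + t)) a (a + s) (- (k * t)) (2 * (eps * (s + t)))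
  ltac:(lra) (ex_RInt_minus (V := R_CompleteNormedModule) _ _ _ _ (E1 c ltac:(lra)) (E1 (c + t) ltac:(lra)))).
assert (I2 := RInt_near_const (fun y => Q (a + s, y) - Q (a, y)) c (c + t) (k * s) (2 * (eps * (s + t)))
  ltac:(lra) (ex_RInt_minus (V := R_CompleteNormedModule) _ _ _ _ (E2 (a + s) ltac:(lra)) (E2 a ltac:(lra)))).
rewrite (RInt_minus (V := R_CompleteNormedModule) (fun x => P (x, c)) (fun x => P (x, c + t))) in I1
  by (apply E1; lra).
rewrite (RInt_minus (V := R_CompleteNormedModule) (fun y => Q (a + s, y)) (fun y => Q (a, y))) in I2
  by (apply E2; lra).
unfold minus, plus, opp in I1, I2; simpl in I1, I2.
assert (I1' := I1 ltac:(intros x Hx; pose proof (B1' x c ltac:(lra) ltac:(lra)) as U;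
  pose proof (B1' x (c + t) ltac:(lra) ltac:(lra)) as V;
  apply Rabs_le_between in U; apply Rabs_le_between in V; apply Rabs_le; lra)).
assert (I2' := I2 ltac:(intros y Hy; pose proof (B2' a y ltac:(lra) ltac:(lra)) as U;
  pose proof (B2' (a + s) y ltac:(lra) ltac:(lra)) as V;
  apply Rabs_le_between in U; apply Rabs_le_between in V; apply Rabs_le; lra)).
apply Rabs_le_between in I1'; apply Rabs_le_between in I2'.
unfold circulation; apply Rabs_le; nra.
Qed.

(** One of the four quarters carries at least a quarter of the circulation. *)
Lemma circulation_quarter P Q a c s t :
  0 <= s -> 0 <= t -> continuous_pair_on P Q a (a + s) c (c + t) ->
  exists a' c', a <= a' <= a + s / 2 /\ c <= c' <= c + t / 2 /\
    Rabs (circulation P Q a (a + s) c (c + t)) <=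
    4 * Rabs (circulation P Q a' (a' + s / 2) c' (c' + t / 2)).
Proof.
intros Hs Ht H.
set (K := fun a' c' => circulation P Q a' (a' + s / 2) c' (c' + t / 2)).
assert (E : circulation P Q a (a + s) c (c + t) =
  K a c + K (a + s / 2) c + K a (c + t / 2) + K (a + s / 2) (c + t / 2)).
{ rewrite (circulation_split_x P Q a (a + s / 2)) by (assumption || lra).
  rewrite (circulation_split_y P Q a (a + s / 2) c (c + t / 2)) by
    (lra || (apply continuous_pair_sub with (1 := H); lra)).
  rewrite (circulation_split_y P Q (a + s / 2) (a + s) c (c + t / 2)) by
    (lra || (apply continuous_pair_sub with (1 := H); lra)).
  unfold K.
  replace (a + s / 2 + s / 2) with (a + s) by field.
  replace (c + t / 2 + t / 2) with (c + t) by field; ring. }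
apply NNPP; intros Hn.
assert (N : forall a' c', a <= a' <= a + s / 2 -> c <= c' <= c + t / 2 ->
  4 * Rabs (K a' c') < Rabs (circulation P Q a (a + s) c (c + t))).
{ intros a' c' Ha Hc; apply Rnot_le_lt; intros Hle; apply Hn; exists a', c'; auto. }
pose proof (N a c ltac:(lra) ltac:(lra)); pose proof (N (a + s / 2) c ltac:(lra) ltac:(lra)).
pose proof (N a (c + t / 2) ltac:(lra) ltac:(lra)).
pose proof (N (a + s / 2) (c + t / 2) ltac:(lra) ltac:(lra)).
pose proof (Rabs_triang (K a c + K (a + s / 2) c + K a (c + t / 2)) (K (a + s / 2) (c + t / 2))).
pose proof (Rabs_triang (K a c + K (a + s / 2) c) (K a (c + t / 2))).
pose proof (Rabs_triang (K a c) (K (a + s / 2) c)).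
rewrite <- E in *; lra.
Qed.

Lemma nested_intervals (a s : nat -> R) :
  (forall n, 0 <= s n) -> (forall n, a n <= a (S n)) ->
  (forall n, a (S n) + s (S n) <= a n + s n) ->
  exists x, forall n, a n <= x <= a n + s n.
Proof.
intros Hs Ha Hb.
assert (M1 : forall n k, a n <= a (n + k)%nat).
{ intros n k; induction k as [|k IH]; [rewrite Nat.add_0_r; lra|].
  rewrite Nat.add_succ_r; pose proof (Ha (n + k)%nat); lra. }
assert (M2 : forall n k, a (n + k)%nat + s (n + k)%nat <= a n + s n).
{ intros n k; induction k as [|k IH]; [rewrite Nat.add_0_r; lra|].
  rewrite Nat.add_succ_r; pose proof (Hb (n + k)%nat); lra. }
assert (M3 : forall n m, a n <= a m + s m).
{ intros n m; pose proof (M1 n m); pose proof (M2 m n); pose proof (Hs (m + n)%nat).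
  rewrite Nat.add_comm in H; lra. }
destruct (completeness (fun y => exists n, y = a n)) as [x [H1 H2]].
- exists (a 0%nat + s 0%nat); intros y [n ->]; apply M3.
- exists (a 0%nat), 0%nat; reflexivity.
- exists x; intros n; split; [apply H1; exists n; reflexivity|].
  apply H2; intros y [m ->]; apply M3.
Qed.

Lemma small_power r d : 0 < d -> exists n, r / 2 ^ n < d.
Proof.
intros Hd; destruct (Rle_lt_dec r 0) as [Hr|Hr]; [exists 0%nat; simpl; lra|].
destruct (pow_lt_1_zero (/ 2) ltac:(rewrite Rabs_pos_eq; lra) (d / r)) as [N HN].
- apply Rdiv_lt_0_compat; lra.
- exists N; specialize (HN N (Nat.le_refl N)).
  rewrite Rabs_pos_eq in HN by (apply pow_le; lra).
  rewrite pow_inv in HN; apply (Rmult_lt_compat_r r) in HN; [|lra].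
  replace (d / r * r) with d in HN by (field; lra); unfold Rdiv; lra.
Qed.

(** Quartering repeatedly gives nested rectangles whose circulation decreases at
    most like [4^-n], hence like the square of their diameter. At their common
    point [circulation_small] makes it smaller than any multiple of that. *)
Lemma goursat P Q a b c d :
  a <= b -> c <= d ->
  (forall x y, a <= x <= b -> c <= y <= d -> closed_at P Q (x, y)) ->
  circulation P Q a b c d = 0.
Proof.
intros Hab Hcd HX.
assert (Hcont : continuous_pair_on P Q a b c d).
{ intros x y Hx Hy; destruct (HX x y Hx Hy) as (p & k & q & H1 & H2); split.
  - apply (has_grad_continuous _ _ _ _ H1).
  - apply (has_grad_continuous _ _ _ _ H2). }
set (s := b - a); set (t := d - c).
assert (Hs : 0 <= s) by (unfold s; lra); assert (Ht : 0 <= t) by (unfold t; lra).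
assert (S : forall v : R * R * nat, exists w : R * R,
  let a' := fst (fst v) in let c' := snd (fst v) in
  let s' := s / 2 ^ snd v in let t' := t / 2 ^ snd v in
  continuous_pair_on P Q a' (a' + s') c' (c' + t') ->
  a' <= fst w <= a' + s' / 2 /\ c' <= snd w <= c' + t' / 2 /\
  Rabs (circulation P Q a' (a' + s') c' (c' + t')) <=
  4 * Rabs (circulation P Q (fst w) (fst w + s' / 2) (snd w) (snd w + t' / 2))).
{ intros [[a' c'] n]; cbn zeta; simpl fst; simpl snd.
  destruct (classic (continuous_pair_on P Q a' (a' + s / 2 ^ n) c' (c' + t / 2 ^ n))) as [H|H].
  - assert (0 < 2 ^ n) by (apply pow_lt; lra).
    destruct (circulation_quarter P Q a' c' (s / 2 ^ n) (t / 2 ^ n)) as (a'' & c'' & Hq); auto.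
    + apply Rdiv_le_0_compat; assumption.
    + apply Rdiv_le_0_compat; assumption.
    + exists (a'', c''); intros _; exact Hq.
  - exists (0, 0); intros H'; contradiction. }
apply functional_choice in S; destruct S as [f Hf]; cbn zeta in Hf.
set (v := fix v n := match n with O => (a, c) | S n => f (v n, n) end).
set (A := fun n => fst (v n)); set (B := fun n => snd (v n)).
assert (Hpow : forall n, 0 < 2 ^ n) by (intros n; apply pow_lt; lra).
assert (Hhalf : forall r n, r / 2 ^ S n = r / 2 ^ n / 2).
{ intros r n; simpl; field; pose proof (Hpow n); lra. }
assert (I : forall n, a <= A n /\ A n + s / 2 ^ n <= b /\ c <= B n /\ B n + t / 2 ^ n <= d).
{ induction n as [|n IH]; [unfold A, B, s, t; simpl; lra|].
  destruct (Hf (v n, n)) as (H1 & H2 & _).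
  - simpl fst; simpl snd; fold (A n) (B n); apply continuous_pair_sub with (1 := Hcont); lra.
  - simpl fst in H1, H2; simpl snd in H1, H2; rewrite !Hhalf.
    change (A (S n)) with (fst (f (v n, n))); change (B (S n)) with (snd (f (v n, n))).
    fold (A n) in H1; fold (B n) in H2; lra. }
assert (IC : forall n, continuous_pair_on P Q (A n) (A n + s / 2 ^ n) (B n) (B n + t / 2 ^ n)).
{ intros n; destruct (I n) as (? & ? & ? & ?); apply continuous_pair_sub with (1 := Hcont); lra. }
assert (J : forall n, A n <= A (S n) <= A n + s / 2 ^ n / 2 /\ B n <= B (S n) <= B n + t / 2 ^ n / 2 /\
  Rabs (circulation P Q (A n) (A n + s / 2 ^ n) (B n) (B n + t / 2 ^ n)) <=
  4 * Rabs (circulation P Q (A (S n)) (A (S n) + s / 2 ^ S n) (B (S n)) (B (S n) + t / 2 ^ S n))).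
{ intros n; rewrite !Hhalf; apply (Hf (v n, n)), IC. }
assert (G : forall n, Rabs (circulation P Q a b c d) <=
  4 ^ n * Rabs (circulation P Q (A n) (A n + s / 2 ^ n) (B n) (B n + t / 2 ^ n))).
{ induction n as [|n IH].
  - unfold A, B, s, t; simpl. replace (a + (b - a) / 1) with b by field.
    replace (c + (d - c) / 1) with d by field; lra.
  - apply Rle_trans with (1 := IH); simpl (4 ^ S n).
    destruct (J n) as (_ & _ & H); assert (0 < 4 ^ n) by (apply pow_lt; lra); nra. }
assert (Hs' : forall n, 0 <= s / 2 ^ n) by (intros n; apply Rdiv_le_0_compat; auto).
assert (Ht' : forall n, 0 <= t / 2 ^ n) by (intros n; apply Rdiv_le_0_compat; auto).
destruct (nested_intervals A (fun n => s / 2 ^ n)) as [x Hx]; auto.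
{ intros n; apply J. }
{ intros n; destruct (J n) as (H & _); rewrite Hhalf; lra. }
destruct (nested_intervals B (fun n => t / 2 ^ n)) as [y Hy]; auto.
{ intros n; apply J. }
{ intros n; destruct (J n) as (_ & H & _); rewrite Hhalf; lra. }
assert (Hxy : closed_at P Q (x, y)).
{ destruct (I 0%nat) as (? & ? & ? & ?); pose proof (Hx 0%nat); pose proof (Hy 0%nat).
  apply HX; lra. }
assert (Z : forall eps, 0 < eps -> Rabs (circulation P Q a b c d) <= 2 * eps * (s + t) ^ 2).
{ intros eps He; destruct (circulation_small P Q (x, y) eps Hxy He) as [delta Hd].
  destruct (small_power (s + t) delta (cond_pos delta)) as [n Hn].
  apply Rle_trans with (1 := G n).
  assert (Hsum : s / 2 ^ n + t / 2 ^ n = (s + t) / 2 ^ n) by (unfold Rdiv; ring).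
  specialize (Hd (A n) (B n) (s / 2 ^ n) (t / 2 ^ n) (Hx n) (Hy n) ltac:(lra) (IC n)).
  apply Rle_trans with (4 ^ n * (2 * eps * ((s + t) / 2 ^ n) ^ 2)).
  - apply Rmult_le_compat_l; [apply pow_le; lra|]; rewrite <- Hsum; exact Hd.
  - right; replace 4 with (2 * 2) by ring; rewrite Rpow_mult_distr; field.
    pose proof (Hpow n); lra. }
assert (Habs := Rabs_pos (circulation P Q a b c d)).
destruct (Req_dec (circulation P Q a b c d) 0) as [H0|H0]; [exact H0|exfalso].
apply Rabs_pos_lt in H0.
set (W := (s + t) ^ 2) in Z; assert (HW : 0 <= W) by apply pow2_ge_0.
assert (HZ := Z (Rabs (circulation P Q a b c d) / (4 * (W + 1))) ltac:(apply Rdiv_lt_0_compat; lra)).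
replace (2 * (Rabs (circulation P Q a b c d) / (4 * (W + 1))) * W) with
  (Rabs (circulation P Q a b c d) * (W / (2 * (W + 1)))) in HZ by (field; lra).
assert (W / (2 * (W + 1)) < 1).
{ apply Rmult_lt_reg_r with (2 * (W + 1)); [lra|].
  unfold Rdiv; rewrite Rmult_assoc, Rinv_l by lra; lra. }
nra.
Qed.

Lemma circulation_degenerate_x P Q a c d : circulation P Q a a c d = 0.
Proof. unfold circulation; rewrite !RInt_point; unfold zero; simpl; ring. Qed.

Lemma circulation_degenerate_y P Q a b c : circulation P Q a b c c = 0.
Proof. unfold circulation; rewrite !RInt_point; unfold zero; simpl; ring. Qed.

Lemma circulation_bound P Q a b c d M :
  a <= b -> c <= d -> continuous_pair_on P Q a b c d ->
  (forall x y, a <= x <= b -> c <= y <= d -> Rabs (P (x, y)) <= M /\ Rabs (Q (x, y)) <= M) ->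
  Rabs (circulation P Q a b c d) <= 2 * M * (b - a + (d - c)).
Proof.
intros Hab Hcd HC HM.
assert (E1 : forall y, c <= y <= d -> Rabs (RInt (fun x => P (x, y)) a b) <= (b - a) * M).
{ intros y Hy; apply abs_RInt_le_const; [lra| |intros t Ht; apply HM; lra].
  apply ex_RInt_row; rewrite Rmin_left, Rmax_right by lra; intros x Hx; apply HC; lra. }
assert (E2 : forall x, a <= x <= b -> Rabs (RInt (fun y => Q (x, y)) c d) <= (d - c) * M).
{ intros x Hx; apply abs_RInt_le_const; [lra| |intros t Ht; apply HM; lra].
  apply ex_RInt_column; rewrite Rmin_left, Rmax_right by lra; intros y Hy; apply HC; lra. }
pose proof (E1 c ltac:(lra)) as U1; pose proof (E1 d ltac:(lra)) as U2.
pose proof (E2 a ltac:(lra)) as U3; pose proof (E2 b ltac:(lra)) as U4.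
apply Rabs_le_between in U1, U2, U3, U4.
unfold circulation; apply Rabs_le; lra.
Qed.

(** The rectangle is cut down to a small neighborhood of the exceptional point,
    where the circulation is bounded by the perimeter. *)
Lemma goursat_exceptional P Q e a b c d :
  a <= b -> c <= d -> continuous_pair_on P Q a b c d ->
  (forall x y, a <= x <= b -> c <= y <= d -> (x, y) <> e -> closed_at P Q (x, y)) ->
  circulation P Q a b c d = 0.
Proof.
intros Hab Hcd HC HX.
destruct (classic (a <= fst e <= b /\ c <= snd e <= d)) as [[He1 He2]|He].
2:{ apply goursat; auto; intros x y Hx Hy; apply HX; auto.
    intros Heq; apply He; rewrite <- Heq; simpl; auto. }
destruct e as [x0 y0]; simpl in He1, He2.
set (M := Rmax (Rabs (P (x0, y0)) + 1) (Rabs (Q (x0, y0)) + 1)).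
assert (HL : exists r : posreal, forall x y, Rabs (x - x0) < r -> Rabs (y - y0) < r ->
  Rabs (P (x, y) - P (x0, y0)) < 1 /\ Rabs (Q (x, y) - Q (x0, y0)) < 1).
{ destruct (HC x0 y0 He1 He2) as [H1 H2].
  apply continuous_to_2d in H1; apply continuous_to_2d in H2.
  destruct (H1 (mkposreal 1 Rlt_0_1)) as [r1 R1], (H2 (mkposreal 1 Rlt_0_1)) as [r2 R2]; simpl in R1, R2.
  exists (mkposreal _ (Rmin_pos _ _ (cond_pos r1) (cond_pos r2))); simpl; intros x y Hx Hy.
  pose proof (Rmin_l r1 r2); pose proof (Rmin_r r1 r2); split; [apply R1|apply R2]; lra. }
destruct HL as [r HL].
assert (HM : 0 < M).
{ unfold M; pose proof (Rmax_l (Rabs (P (x0, y0)) + 1) (Rabs (Q (x0, y0)) + 1)).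
  pose proof (Rabs_pos (P (x0, y0))); lra. }
assert (Z : forall h, 0 < h < r -> Rabs (circulation P Q a b c d) <= 8 * M * h).
{ intros h Hh.
  assert (Hsub : exists a' b', a <= a' <= x0 /\ x0 <= b' <= b /\ x0 - h <= a' /\ b' <= x0 + h /\
     circulation P Q a b c d = circulation P Q a' b' c d).
  { exists (Rmax a (x0 - h)), (Rmin b (x0 + h)).
    assert (A1 := Rmax_l a (x0 - h)); assert (A2 := Rmax_r a (x0 - h)).
    assert (A3 := Rmin_l b (x0 + h)); assert (A4 := Rmin_r b (x0 + h)).
    assert (A5 : Rmax a (x0 - h) <= x0) by (apply Rmax_lub; lra).
    assert (A6 : x0 <= Rmin b (x0 + h)) by (apply Rmin_glb; lra).
    repeat split; try lra.
    rewrite (circulation_split_x P Q a (Rmax a (x0 - h)) b) by (assumption || lra).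
    rewrite (circulation_split_x P Q (Rmax a (x0 - h)) (Rmin b (x0 + h)) b) by
      (lra || (apply continuous_pair_sub with (1 := HC); lra)).
    assert (Z1 : circulation P Q a (Rmax a (x0 - h)) c d = 0).
    { destruct (Rle_lt_dec (x0 - h) a) as [Hle|Hlt].
      - rewrite Rmax_left by lra; apply circulation_degenerate_x.
      - apply goursat; [lra|lra|]; intros x y Hx Hy; apply HX; [lra|lra|].
        rewrite Rmax_right in Hx by lra; intros Heq; injection Heq; lra. }
    assert (Z2 : circulation P Q (Rmin b (x0 + h)) b c d = 0).
    { destruct (Rle_lt_dec b (x0 + h)) as [Hle|Hlt].
      - rewrite Rmin_left by lra; apply circulation_degenerate_x.
      - apply goursat; [lra|lra|]; intros x y Hx Hy; apply HX; [lra|lra|].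
        rewrite Rmin_right in Hx by lra; intros Heq; injection Heq; lra. }
    lra. }
  destruct Hsub as (a' & b' & Ha' & Hb' & Hah & Hbh & ->).
  assert (Hsub : exists c' d', c <= c' <= y0 /\ y0 <= d' <= d /\ y0 - h <= c' /\ d' <= y0 + h /\
     circulation P Q a' b' c d = circulation P Q a' b' c' d').
  { exists (Rmax c (y0 - h)), (Rmin d (y0 + h)).
    assert (A1 := Rmax_l c (y0 - h)); assert (A2 := Rmax_r c (y0 - h)).
    assert (A3 := Rmin_l d (y0 + h)); assert (A4 := Rmin_r d (y0 + h)).
    assert (A5 : Rmax c (y0 - h) <= y0) by (apply Rmax_lub; lra).
    assert (A6 : y0 <= Rmin d (y0 + h)) by (apply Rmin_glb; lra).
    repeat split; try lra.
    rewrite (circulation_split_y P Q a' b' c (Rmax c (y0 - h)) d) by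
      (lra || (apply continuous_pair_sub with (1 := HC); lra)).
    rewrite (circulation_split_y P Q a' b' (Rmax c (y0 - h)) (Rmin d (y0 + h)) d) by
      (lra || (apply continuous_pair_sub with (1 := HC); lra)).
    assert (Z1 : circulation P Q a' b' c (Rmax c (y0 - h)) = 0).
    { destruct (Rle_lt_dec (y0 - h) c) as [Hle|Hlt].
      - rewrite Rmax_left by lra; apply circulation_degenerate_y.
      - apply goursat; [lra|lra|]; intros x y Hx Hy; apply HX; [lra|lra|].
        rewrite Rmax_right in Hy by lra; intros Heq; injection Heq; lra. }
    assert (Z2 : circulation P Q a' b' (Rmin d (y0 + h)) d = 0).
    { destruct (Rle_lt_dec d (y0 + h)) as [Hle|Hlt].
      - rewrite Rmin_left by lra; apply circulation_degenerate_y.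
      - apply goursat; [lra|lra|]; intros x y Hx Hy; apply HX; [lra|lra|].
        rewrite Rmin_right in Hy by lra; intros Heq; injection Heq; lra. }
    lra. }
  destruct Hsub as (c' & d' & Hc' & Hd' & Hch & Hdh & ->).
  apply Rle_trans with (2 * M * (b' - a' + (d' - c'))).
  - apply circulation_bound; [lra|lra|apply continuous_pair_sub with (1 := HC); lra|].
    intros x y Hx Hy.
    destruct (HL x y) as [H1 H2]; [apply Rabs_def1; lra|apply Rabs_def1; lra|].
    pose proof (Rabs_triang_inv (P (x, y)) (P (x0, y0))).
    pose proof (Rabs_triang_inv (Q (x, y)) (Q (x0, y0))).
    pose proof (Rmax_l (Rabs (P (x0, y0)) + 1) (Rabs (Q (x0, y0)) + 1)).
    pose proof (Rmax_r (Rabs (P (x0, y0)) + 1) (Rabs (Q (x0, y0)) + 1)).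
    unfold M; lra.
  - nra. }
destruct (Req_dec (circulation P Q a b c d) 0) as [H0|H0]; [exact H0|exfalso].
apply Rabs_pos_lt in H0; set (W := Rabs (circulation P Q a b c d)) in *.
assert (Hr := cond_pos r).
set (h := Rmin (r / 2) (W / (16 * M))).
assert (h <= r / 2) by apply Rmin_l.
assert (Hh : h <= W / (16 * M)) by apply Rmin_r.
assert (0 < h) by (apply Rmin_pos; [lra|apply Rdiv_lt_0_compat; lra]).
specialize (Z h ltac:(lra)).
apply (Rmult_le_compat_l (8 * M)) in Hh; [|lra].
replace (8 * M * (W / (16 * M))) with (W / 2) in Hh by (field; lra); lra.
Qed.


(** ** Potentials on disks *)

Definition disk (c : C) (r : R) (z : C) : Prop := dist2 c z < r ^ 2.

Lemma open_disk c r : open (disk c r).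
Proof. apply open_dist2. Qed.

Lemma between_sqr a x y : Rmin a x <= y <= Rmax a x -> (y - a) ^ 2 <= (x - a) ^ 2.
Proof.
intros H; destruct (Rle_lt_dec a x).
- rewrite Rmin_left, Rmax_right in H by lra; nra.
- rewrite Rmin_right, Rmax_left in H by lra; nra.
Qed.

Lemma disk_rectangle c r z x y :
  disk c r z -> Rmin (fst c) (fst z) <= x <= Rmax (fst c) (fst z) ->
  Rmin (snd c) (snd z) <= y <= Rmax (snd c) (snd z) -> disk c r (x, y).
Proof.
intros H Hx Hy; apply between_sqr in Hx; apply between_sqr in Hy.
unfold disk, dist2 in *; simpl; lra.
Qed.

Lemma RInt_swap_R (f : R -> R) a b : ex_RInt f a b -> RInt f b a = - RInt f a b.
Proof.
intros H; apply is_RInt_unique, (is_RInt_swap (V := R_NormedModule)), (RInt_correct f a b H).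
Qed.

Lemma circulation_unordered P Q e a b c d :
  (forall x y, Rmin a b <= x <= Rmax a b -> Rmin c d <= y <= Rmax c d ->
     continuous P (x, y) /\ continuous Q (x, y) /\ ((x, y) <> e -> closed_at P Q (x, y))) ->
  circulation P Q a b c d = 0.
Proof.
intros H.
assert (G : circulation P Q (Rmin a b) (Rmax a b) (Rmin c d) (Rmax c d) = 0).
{ apply (goursat_exceptional P Q e); try apply Rminmax.
  - intros x y Hx Hy; destruct (H x y Hx Hy) as (H1 & H2 & _); auto.
  - intros x y Hx Hy; apply H; auto. }
assert (E1 : forall y, Rmin c d <= y <= Rmax c d -> ex_RInt (fun x => P (x, y)) a b).
{ intros y Hy; apply ex_RInt_row; intros x Hx; apply H; auto. }
assert (E2 : forall x, Rmin a b <= x <= Rmax a b -> ex_RInt (fun y => Q (x, y)) c d).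
{ intros x Hx; apply ex_RInt_column; intros y Hy; apply H; auto. }
assert (Ma : Rmin a b <= a <= Rmax a b) by (split; [apply Rmin_l|apply Rmax_l]).
assert (Mb : Rmin a b <= b <= Rmax a b) by (split; [apply Rmin_r|apply Rmax_r]).
assert (Mc : Rmin c d <= c <= Rmax c d) by (split; [apply Rmin_l|apply Rmax_l]).
assert (Md : Rmin c d <= d <= Rmax c d) by (split; [apply Rmin_r|apply Rmax_r]).
pose proof (RInt_swap_R _ _ _ (E1 c Mc)) as W1; pose proof (RInt_swap_R _ _ _ (E1 d Md)) as W2.
pose proof (RInt_swap_R _ _ _ (E2 a Ma)) as W3; pose proof (RInt_swap_R _ _ _ (E2 b Mb)) as W4.
unfold circulation in *.
destruct (Rle_lt_dec a b); destruct (Rle_lt_dec c d);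
  rewrite ?(Rmin_left a b), ?(Rmax_right a b), ?(Rmin_right a b), ?(Rmax_left a b),
    ?(Rmin_left c d), ?(Rmax_right c d), ?(Rmin_right c d), ?(Rmax_left c d) in G by lra; lra.
Qed.

(** Integrating along the two L-shaped paths from the center gives the same
    function, and each path makes one partial derivative visible. *)
Lemma potential_on_disk (P Q : C -> R) c r e :
  (forall z, disk c r z -> continuous P z /\ continuous Q z) ->
  (forall z, disk c r z -> z <> e -> closed_at P Q z) ->
  exists Phi : C -> R, forall z, disk c r z -> has_grad Phi z (P z) (Q z).
Proof.
intros HC HX.
set (Phi := fun z : C => RInt (fun t => P (t, snd c)) (fst c) (fst z) +
                         RInt (fun t => Q (fst z, t)) (snd c) (snd z)).
assert (HR : forall z x y, disk c r z -> Rmin (fst c) (fst z) <= x <= Rmax (fst c) (fst z) ->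
  Rmin (snd c) (snd z) <= y <= Rmax (snd c) (snd z) ->
  continuous P (x, y) /\ continuous Q (x, y) /\ ((x, y) <> e -> closed_at P Q (x, y))).
{ intros z x y Hz Hx Hy; pose proof (disk_rectangle c r z x y Hz Hx Hy) as D.
  split; [apply HC, D|split; [apply HC, D|intros He; apply HX; auto]]. }
assert (Hmm : forall a b, Rmin a b <= a <= Rmax a b) by (intros; split; [apply Rmin_l|apply Rmax_l]).
assert (Hmm' : forall a b, Rmin a b <= b <= Rmax a b) by (intros; split; [apply Rmin_r|apply Rmax_r]).
assert (HPhi : forall z, disk c r z -> Phi z =
  RInt (fun t => Q (fst c, t)) (snd c) (snd z) + RInt (fun t => P (t, snd z)) (fst c) (fst z)).
{ intros z Hz.
  pose proof (circulation_unordered P Q e (fst c) (fst z) (snd c) (snd z)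
    (fun x y Hx Hy => HR z x y Hz Hx Hy)) as K.
  unfold circulation in K; unfold Phi; lra. }
assert (Dx : forall z, disk c r z -> is_derive (fun t => Phi (t, snd z)) (fst z) (P z)).
{ intros z Hz.
  pose proof (open_locally _ _ (open_disk c r) Hz) as L; apply locally_square in L.
  destruct L as [d L].
  assert (L' : forall t, Rabs (t - fst z) < d -> disk c r (t, snd z)).
  { intros t Ht; apply L; [exact Ht|rewrite Rminus_diag, Rabs_R0; apply cond_pos]. }
  apply is_derive_ext_loc with (fun t => RInt (fun s => Q (fst c, s)) (snd c) (snd z) +
    RInt (fun s => P (s, snd z)) (fst c) t).
  { exists d; intros t Ht; symmetry; apply (HPhi (t, snd z)), L', Ht. }
  rewrite <- (Rplus_0_l (P z)).
  apply (is_derive_plus (V := R_NormedModule) (fun _ => RInt (fun s => Q (fst c, s)) (snd c) (snd z))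
     (fun t => RInt (fun s => P (s, snd z)) (fst c) t)); [apply @is_derive_const|].
  destruct z as [x y]; simpl fst in *; simpl snd in *.
  apply (is_derive_RInt (V := R_NormedModule) (fun s => P (s, y)) _ (fst c) x).
  - exists d; intros t Ht; apply (RInt_correct (fun s => P (s, y))), ex_RInt_row.
    intros s Hs; apply (HR (t, y) s y (L' t Ht) Hs), Hmm'.
  - apply continuous_row, HC, Hz. }
assert (Dy : forall z, disk c r z -> is_derive (fun t => Phi (fst z, t)) (snd z) (Q z)).
{ intros z Hz.
  pose proof (open_locally _ _ (open_disk c r) Hz) as L; apply locally_square in L.
  destruct L as [d L].
  assert (L' : forall t, Rabs (t - snd z) < d -> disk c r (fst z, t)).
  { intros t Ht; apply L; [rewrite Rminus_diag, Rabs_R0; apply cond_pos|exact Ht]. }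
  rewrite <- (Rplus_0_l (Q z)); unfold Phi; simpl fst; simpl snd.
  apply (is_derive_plus (V := R_NormedModule) (fun _ => RInt (fun s => P (s, snd c)) (fst c) (fst z))
     (fun t => RInt (fun s => Q (fst z, s)) (snd c) t)); [apply @is_derive_const|].
  destruct z as [x y]; simpl fst in *; simpl snd in *.
  apply (is_derive_RInt (V := R_NormedModule) (fun s => Q (x, s)) _ (snd c) y).
  - exists d; intros t Ht; apply (RInt_correct (fun s => Q (x, s))), ex_RInt_column.
    intros s Hs; apply (HR (x, t) x s (L' t Ht)); [apply Hmm'|exact Hs].
  - apply continuous_column, HC, Hz. }
exists Phi; intros z Hz.
assert (EP : forall w, disk c r w -> P w = partial_x Phi w).
{ intros w Hw; symmetry; apply is_derive_unique, (Dx w Hw). }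
rewrite (EP z Hz); replace (Q z) with (partial_y Phi z) by (apply is_derive_unique, (Dy z Hz)).
apply (has_grad_of_partials (disk c r)); [apply open_disk|exact Hz| |].
- intros w Hw; split; [exists (P w); apply Dx, Hw|exists (Q w); apply Dy, Hw].
- apply (continuous_ext_on (disk c r) P); [apply open_disk|exact Hz|exact EP|apply HC, Hz].
Qed.

(** The real and imaginary parts of [p dz] are closed by the Cauchy-Riemann
    equations. *)
Lemma primitive_on_disk (p : C -> C) c r e :
  (forall z, disk c r z -> continuous p z) ->
  (forall z, disk c r z -> z <> e -> exists d, holo_at p z d) ->
  exists G : C -> C, forall z, disk c r z -> holo_at G z (p z).
Proof.
intros HC HX.
destruct (potential_on_disk (fun z => fst (p z)) (fun z => - snd (p z)) c r e) as [U HU].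
- intros z Hz; split; [apply continuous_fst_C|apply cont_opp, continuous_snd_C]; auto.
- intros z Hz He; destruct (HX z Hz He) as [d [H1 H2]].
  exists (fst d), (- snd d), (- fst d); split; [exact H1|apply has_grad_opp, H2].
- destruct (potential_on_disk (fun z => snd (p z)) (fun z => fst (p z)) c r e) as [V HV].
  + intros z Hz; split; [apply continuous_snd_C|apply continuous_fst_C]; auto.
  + intros z Hz He; destruct (HX z Hz He) as [d [H1 H2]].
    exists (snd d), (fst d), (- snd d); split; assumption.
  + exists (fun z => (U z, V z)); intros z Hz; split; [apply HU, Hz|apply HV, Hz].
Qed.

(** * Cauchy's formula and the derivatives of a holomorphic function *)

Definition expi (t : R) : C := (cos t, sin t).

Definition circle_int (phi : R -> C) : C :=
  (RInt (fun t => fst (phi t)) (- PI) PI, RInt (fun t => snd (phi t)) (- PI) PI).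

Definition ccont (phi : R -> C) : Prop :=
  forall t, continuous (fun t => fst (phi t)) t /\ continuous (fun t => snd (phi t)) t.

Lemma is_derive_continuous (f : R -> R) t l : is_derive f t l -> continuous f t.
Proof. intros H; apply (ex_derive_continuous f); exists l; exact H. Qed.

Lemma Rc_plus (f g : R -> R) t : continuous f t -> continuous g t -> continuous (fun t => f t + g t) t.
Proof. intros; apply (continuous_plus (V := R_NormedModule)); assumption. Qed.
Lemma Rc_minus (f g : R -> R) t : continuous f t -> continuous g t -> continuous (fun t => f t - g t) t.
Proof. intros; apply (continuous_minus (V := R_NormedModule)); assumption. Qed.
Lemma Rc_mult (f g : R -> R) t : continuous f t -> continuous g t -> continuous (fun t => f t * g t) t.
Proof. intros; apply (continuous_mult (K := R_AbsRing)); assumption. Qed.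
Lemma Rc_opp (f : R -> R) t : continuous f t -> continuous (fun t => - f t) t.
Proof. intros; apply (continuous_opp (V := R_NormedModule)); assumption. Qed.
Lemma Rc_inv (f : R -> R) t : f t <> 0 -> continuous f t -> continuous (fun t => / f t) t.
Proof.
intros H0 H; apply (continuous_comp f Rinv); [exact H|].
apply (is_derive_continuous Rinv _ (- / (f t) ^ 2)); auto_derive; [exact H0|field; exact H0].
Qed.
Lemma Rc_const (k t : R) : continuous (fun _ : R => k) t.
Proof. apply continuous_const. Qed.
Lemma Rc_cos (t : R) : continuous cos t.
Proof. apply (is_derive_continuous cos t (- sin t)), is_derive_Reals, derivable_pt_lim_cos. Qed.
Lemma Rc_sin (t : R) : continuous sin t.
Proof. apply (is_derive_continuous sin t (cos t)), is_derive_Reals, derivable_pt_lim_sin. Qed.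

Lemma ccont_const c : ccont (fun _ => c).
Proof. intros t; split; apply continuous_const. Qed.

Lemma ccont_expi : ccont expi.
Proof. intros t; split; [apply Rc_cos|apply Rc_sin]. Qed.

Lemma ccont_plus f g : ccont f -> ccont g -> ccont (fun t => f t + g t)%C.
Proof. intros F G t; destruct (F t), (G t); split; apply Rc_plus; assumption. Qed.

Lemma ccont_opp f : ccont f -> ccont (fun t => - f t)%C.
Proof. intros F t; destruct (F t); split; apply Rc_opp; assumption. Qed.

Lemma ccont_minus f g : ccont f -> ccont g -> ccont (fun t => f t - g t)%C.
Proof. intros F G; apply ccont_plus, ccont_opp; assumption. Qed.

Lemma ccont_mult f g : ccont f -> ccont g -> ccont (fun t => f t * g t)%C.
Proof.
intros F G t; destruct (F t), (G t); split; simpl.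
- apply Rc_minus; apply Rc_mult; assumption.
- apply Rc_plus; apply Rc_mult; assumption.
Qed.

Lemma ccont_inv f : (forall t, f t <> RtoC 0) -> ccont f -> ccont (fun t => / f t)%C.
Proof.
intros H F t; destruct (F t) as [F1 F2]; pose proof (C_norm2_pos _ (H t)) as N.
assert (HN : continuous (fun t => / (fst (f t) * fst (f t) + snd (f t) * snd (f t))) t).
{ apply Rc_inv; [nra|]; apply Rc_plus; apply Rc_mult; assumption. }
split.
- apply continuous_ext with (fun t => fst (f t) * / (fst (f t) * fst (f t) + snd (f t) * snd (f t))).
  { intros s; simpl; unfold Rdiv; rewrite !Rmult_1_r; reflexivity. }
  apply Rc_mult; assumption.
- apply continuous_ext with (fun t => - snd (f t) * / (fst (f t) * fst (f t) + snd (f t) * snd (f t))).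
  { intros s; simpl; unfold Rdiv; rewrite !Rmult_1_r; reflexivity. }
  apply Rc_mult; [apply Rc_opp|]; assumption.
Qed.

Ltac ccont := repeat match goal with
  | |- ccont (fun _ => (_ + _)%C) => apply ccont_plus
  | |- ccont (fun _ => (_ - _)%C) => apply ccont_minus
  | |- ccont (fun _ => (_ * _)%C) => apply ccont_mult
  | |- ccont (fun _ => expi _) => apply ccont_expi
  | |- ccont expi => apply ccont_expi
  | |- ccont (fun _ => ?c) => apply ccont_const
  | _ => assumption
  end.

Lemma ccont_ex f a b : ccont f ->
  ex_RInt (fun t => fst (f t)) a b /\ ex_RInt (fun t => snd (f t)) a b.
Proof.
intros H; split.
- apply (ex_RInt_continuous (V := R_CompleteNormedModule) (fun t => fst (f t))); intros t _; apply (H t).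
- apply (ex_RInt_continuous (V := R_CompleteNormedModule) (fun t => snd (f t))); intros t _; apply (H t).
Qed.

Lemma circle_int_minus f g : ccont f -> ccont g ->
  circle_int (fun t => f t - g t)%C = (circle_int f - circle_int g)%C.
Proof.
intros F G; destruct (ccont_ex f (- PI) PI F), (ccont_ex g (- PI) PI G).
apply C_ext; simpl; apply (RInt_minus (V := R_CompleteNormedModule)); assumption.
Qed.

Lemma circle_int_scal c f : ccont f ->
  circle_int (fun t => c * f t)%C = (c * circle_int f)%C.
Proof.
intros F; destruct (ccont_ex f (- PI) PI F) as [E1 E2].
assert (S : forall k (h : R -> R), ex_RInt h (- PI) PI ->
  RInt (fun t => k * h t) (- PI) PI = k * RInt h (- PI) PI).
{ intros k h Hh; apply (RInt_scal (V := R_CompleteNormedModule)), Hh. }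
assert (X : forall k (h : R -> R), ex_RInt h (- PI) PI -> ex_RInt (fun t => k * h t) (- PI) PI).
{ intros k h Hh; apply (ex_RInt_scal (V := R_CompleteNormedModule)), Hh. }
apply C_ext; simpl.
- rewrite <- S, <- (S (snd c)) by assumption.
  apply (RInt_minus (V := R_CompleteNormedModule)); apply X; assumption.
- rewrite <- S, <- (S (snd c)) by assumption.
  apply (RInt_plus (V := R_CompleteNormedModule)); apply X; assumption.
Qed.

Lemma Rabs_fst_Cmod z : Rabs (fst z) <= Cmod z.
Proof. apply Rle_trans with (2 := Rmax_Cmod z), Rmax_l. Qed.
Lemma Rabs_snd_Cmod z : Rabs (snd z) <= Cmod z.
Proof. apply Rle_trans with (2 := Rmax_Cmod z), Rmax_r. Qed.

Lemma circle_int_bound f M : ccont f -> (forall t, - PI <= t <= PI -> Cmod (f t) <= M) ->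
  Cmod (circle_int f) <= 4 * PI * M.
Proof.
intros F H; destruct (ccont_ex f (- PI) PI F) as [E1 E2]; assert (P := PI_RGT_0).
assert (B1 : Rabs (RInt (fun t => fst (f t)) (- PI) PI) <= (PI - - PI) * M).
{ apply abs_RInt_le_const; [lra|exact E1|].
  intros t Ht; apply Rle_trans with (1 := Rabs_fst_Cmod _), H, Ht. }
assert (B2 : Rabs (RInt (fun t => snd (f t)) (- PI) PI) <= (PI - - PI) * M).
{ apply abs_RInt_le_const; [lra|exact E2|].
  intros t Ht; apply Rle_trans with (1 := Rabs_snd_Cmod _), H, Ht. }
apply Rle_trans with (1 := Cmod_le_Rabs _); simpl; lra.
Qed.

Lemma continuous_bounded (f : R -> R) a b : a <= b -> (forall t, continuous f t) ->
  exists M, forall t, a <= t <= b -> f t <= M.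
Proof.
intros Hab H; destruct (continuity_ab_maj f a b Hab) as [m [Hm _]].
- intros c _; apply continuity_pt_filterlim, H.
- exists (f m); exact Hm.
Qed.

Lemma ccont_bounded f : ccont f -> exists M, 0 < M /\ forall t, - PI <= t <= PI -> Cmod (f t) <= M.
Proof.
intros F; assert (P := PI_RGT_0).
destruct (continuous_bounded (fun t => Rabs (fst (f t)) + Rabs (snd (f t))) (- PI) PI) as [M HM].
- lra.
- intros t; destruct (F t); apply Rc_plus;
    apply (continuous_comp _ Rabs); try assumption; apply continuous_Rabs.
- exists (Rabs M + 1); split; [pose proof (Rabs_pos M); lra|].
  intros t Ht; apply Rle_trans with (1 := Cmod_le_Rabs _).
  pose proof (HM t Ht); pose proof (Rle_abs M); simpl in *; lra.
Qed.

(** A quadratic bound on the remainder of the integrand, uniform on the circle,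
    replaces the continuity of its derivatives in two variables. *)
Lemma holo_at_circle_int (T : C -> R -> C) (T' : R -> C) z d M :
  0 < d -> (forall w, Cmod (w - z) < d -> ccont (T w)) -> ccont T' ->
  (forall w t, Cmod (w - z) < d -> - PI <= t <= PI ->
     Cmod (T w t - T z t - (w - z) * T' t) <= M * Cmod (w - z) ^ 2) ->
  holo_at (fun w => circle_int (T w)) z (circle_int T').
Proof.
intros Hd HT HT' HB; assert (P := PI_RGT_0).
assert (Hz : Cmod (z - z) < d) by (replace (z - z)%C with (RtoC 0) by ring; rewrite Cmod_0; exact Hd).
assert (HM : 0 <= Rabs M) by apply Rabs_pos.
apply holo_at_of_bound; intros eps He.
set (r := Rmin (d / 2) (eps / (2 * (4 * PI * (Rabs M + 1))))).
assert (Hr : 0 < r).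
{ apply Rmin_pos; [lra|apply Rdiv_lt_0_compat; nra]. }
assert (Hr1 : 2 * r <= d) by (unfold r; pose proof (Rmin_l (d / 2) (eps / (2 * (4 * PI * (Rabs M + 1))))); lra).
assert (Hr2 : r * (2 * (4 * PI * (Rabs M + 1))) <= eps).
{ apply Rle_trans with (eps / (2 * (4 * PI * (Rabs M + 1))) * (2 * (4 * PI * (Rabs M + 1)))).
  - apply Rmult_le_compat_r; [nra|apply Rmin_r].
  - right; field; split; nra. }
apply locally_square; exists (mkposreal _ Hr); simpl; intros x y Hx Hy.
set (w := (x, y) : C).
assert (Hw : Cmod (w - z) < 2 * r).
{ apply Rle_lt_trans with (1 := Cmod_le_Rabs _); simpl.
  change (Rabs (x - fst z) + Rabs (y - snd z) < 2 * r); lra. }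
replace (circle_int (T w) - circle_int (T z) - circle_int T' * (w - z))%C
  with (circle_int (fun t => T w t - T z t - (w - z) * T' t)%C).
2:{ rewrite circle_int_minus, circle_int_minus, circle_int_scal; try ring;
    ccont; apply HT; lra. }
apply Rle_trans with (4 * PI * (M * Cmod (w - z) ^ 2)).
- apply circle_int_bound.
  + ccont; apply HT; lra.
  + intros t Ht; apply HB; [lra|exact Ht].
- pose proof (Cmod_ge_0 (w - z)); pose proof (Rle_abs M).
  apply Rle_trans with (4 * PI * ((Rabs M + 1) * (Cmod (w - z) * (2 * r)))); [|nra].
  apply Rmult_le_compat_l; [lra|].
  apply Rle_trans with ((Rabs M + 1) * Cmod (w - z) ^ 2); [apply Rmult_le_compat_r; [apply pow2_ge_0|lra]|].
  apply Rmult_le_compat_l; [lra|]; simpl; rewrite Rmult_1_r; apply Rmult_le_compat_l; lra.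
Qed.

Lemma Cmod_expi t : Cmod (expi t) = 1.
Proof.
unfold Cmod, expi; simpl.
replace (_ + _) with 1; [apply sqrt_1|].
pose proof (sin2_cos2 t) as H; unfold Rsqr in H; lra.
Qed.

Lemma Cmod_expi_minus t z : 1 - Cmod z <= Cmod (expi t - z).
Proof.
pose proof (Cmod_triangle (expi t - z) z) as H.
replace (expi t - z + z)%C with (expi t) in H by ring; rewrite Cmod_expi in H; lra.
Qed.

Lemma expi_minus_neq_0 t z : Cmod z < 1 -> (expi t - z)%C <> 0.
Proof. intros H; apply Cmod_gt_0; pose proof (Cmod_expi_minus t z); lra. Qed.

Lemma ccont_kernel z : Cmod z < 1 -> ccont (fun t => / (expi t - z))%C.
Proof.
intros H; apply ccont_inv; [intros t; apply expi_minus_neq_0, H|].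
ccont.
Qed.

Lemma Cmod_kernel z w t : Cmod z < 1 -> Cmod (w - z) < (1 - Cmod z) / 2 ->
  Cmod w < 1 /\ Cmod (/ (expi t - w)) <= 2 / (1 - Cmod z).
Proof.
intros Hz Hw.
assert (E : Cmod w <= (1 + Cmod z) / 2).
{ replace w with ((w - z) + z)%C by ring; pose proof (Cmod_triangle (w - z) z); lra. }
split; [lra|]; rewrite Cmod_inv by (apply expi_minus_neq_0; lra).
pose proof (Cmod_expi_minus t w).
replace (2 / (1 - Cmod z)) with (/ ((1 - Cmod z) / 2)) by (field; lra).
apply Rinv_le_contravar; lra.
Qed.

Lemma kernel_difference z w t : Cmod z < 1 -> Cmod w < 1 ->
  (/ (expi t - w) - / (expi t - z) = (w - z) * / (expi t - z) * / (expi t - w))%C.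
Proof.
intros Hz Hw; field; split; apply expi_minus_neq_0; assumption.
Qed.

Lemma Cmod_minus_self z : Cmod (z - z) = 0.
Proof. replace (z - z)%C with (RtoC 0) by ring; apply Cmod_0. Qed.

(** With [A] and [B] the kernels at [z] and [w], [B - A = (w - z) A B], so that
    the remainder of the kernel is [(w - z)^2 A^2 B]. *)
Lemma holo_at_cauchy1 phi z : ccont phi -> Cmod z < 1 ->
  holo_at (fun w => circle_int (fun t => phi t * / (expi t - w))%C) z
    (circle_int (fun t => phi t * (/ (expi t - z) * / (expi t - z)))%C).
Proof.
intros Hphi Hz; destruct (ccont_bounded phi Hphi) as (M & HM & HB).
apply (holo_at_circle_int (fun w t => phi t * / (expi t - w))%C _ z ((1 - Cmod z) / 2)
   (M * (2 / (1 - Cmod z)) ^ 3)); [lra| | |].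
- intros w Hw; apply ccont_mult; [exact Hphi|apply ccont_kernel].
  apply (Cmod_kernel z w 0 Hz Hw).
- ccont; apply ccont_kernel, Hz.
- intros w t Hw Ht; destruct (Cmod_kernel z w t Hz Hw) as [Hw1 KB].
  destruct (Cmod_kernel z z t Hz) as [_ KA]; [rewrite Cmod_minus_self; lra|].
  pose proof (kernel_difference z w t Hz Hw1) as E.
  set (A := (/ (expi t - z))%C) in *; set (B := (/ (expi t - w))%C) in *.
  replace (phi t * B - phi t * A - (w - z) * (phi t * (A * A)))%C
    with ((w - z) * (w - z) * (phi t * (A * A * B)))%C.
  2:{ replace (phi t * B - phi t * A - (w - z) * (phi t * (A * A)))%C
        with (phi t * ((B - A) - (w - z) * (A * A)))%C by ring.
      rewrite E; replace ((w - z) * A * B - (w - z) * (A * A))%C with ((w - z) * A * (B - A))%C by ring.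
      rewrite E; ring. }
  rewrite !Cmod_mult, (Rmult_comm _ (Cmod (w - z) ^ 2)).
  replace (Cmod (w - z) * Cmod (w - z)) with (Cmod (w - z) ^ 2) by ring.
  apply Rmult_le_compat_l; [apply pow2_ge_0|].
  pose proof (HB t Ht); pose proof (Cmod_ge_0 A); pose proof (Cmod_ge_0 B); pose proof (Cmod_ge_0 (phi t)).
  set (L := 2 / (1 - Cmod z)) in *.
  apply Rmult_le_compat; [assumption|apply Rmult_le_pos; [apply Rmult_le_pos|]; assumption|assumption|].
  replace (L ^ 3) with (L * L * L) by ring.
  apply Rmult_le_compat; [apply Rmult_le_pos; assumption|assumption| |assumption].
  apply Rmult_le_compat; assumption.
Qed.

(** As before, with remainder [(w - z)^2 A^2 B (B + 2 A)] for the square of the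
    kernel. *)
Lemma holo_at_cauchy2 phi z : ccont phi -> Cmod z < 1 ->
  holo_at (fun w => circle_int (fun t => phi t * (/ (expi t - w) * / (expi t - w)))%C) z
    (circle_int (fun t => 2 * (phi t * (/ (expi t - z) * / (expi t - z) * / (expi t - z))))%C).
Proof.
intros Hphi Hz; destruct (ccont_bounded phi Hphi) as (M & HM & HB).
apply (holo_at_circle_int (fun w t => phi t * (/ (expi t - w) * / (expi t - w)))%C _ z ((1 - Cmod z) / 2)
   (M * (3 * (2 / (1 - Cmod z)) ^ 4))); [lra| | |].
- intros w Hw; ccont; apply ccont_kernel, (Cmod_kernel z w 0 Hz Hw).
- ccont; apply ccont_kernel, Hz.
- intros w t Hw Ht; destruct (Cmod_kernel z w t Hz Hw) as [Hw1 KB].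
  destruct (Cmod_kernel z z t Hz) as [_ KA]; [rewrite Cmod_minus_self; lra|].
  pose proof (kernel_difference z w t Hz Hw1) as E.
  set (A := (/ (expi t - z))%C) in *; set (B := (/ (expi t - w))%C) in *.
  replace (phi t * (B * B) - phi t * (A * A) - (w - z) * (2 * (phi t * (A * A * A))))%C
    with ((w - z) * (w - z) * (phi t * (A * A * B * (B + A + A))))%C.
  2:{ replace (phi t * (B * B) - phi t * (A * A) - (w - z) * (2 * (phi t * (A * A * A))))%C
        with (phi t * ((B - A) * (B + A) - (w - z) * A * (A * (1 + 1)) * A))%C by (simpl; ring).
      rewrite E.
      replace ((w - z) * A * B * (B + A) - (w - z) * A * (A * (1 + 1)) * A)%C
        with ((w - z) * A * ((B - A) * (B + A + A)))%C by ring.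
      rewrite E; ring. }
  rewrite !Cmod_mult, (Rmult_comm _ (Cmod (w - z) ^ 2)).
  replace (Cmod (w - z) * Cmod (w - z)) with (Cmod (w - z) ^ 2) by ring.
  apply Rmult_le_compat_l; [apply pow2_ge_0|].
  pose proof (HB t Ht); pose proof (Cmod_ge_0 A); pose proof (Cmod_ge_0 B); pose proof (Cmod_ge_0 (phi t)).
  set (L := 2 / (1 - Cmod z)) in *.
  assert (S : Cmod (B + A + A) <= 3 * L).
  { pose proof (Cmod_triangle (B + A) A); pose proof (Cmod_triangle B A); lra. }
  pose proof (Cmod_ge_0 (B + A + A)).
  assert (P1 : Cmod A * Cmod A <= L * L) by (apply Rmult_le_compat; assumption).
  assert (P2 : Cmod A * Cmod A * Cmod B <= L * L * L).
  { apply Rmult_le_compat; try assumption; apply Rmult_le_pos; assumption. }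
  apply Rmult_le_compat; [assumption| |assumption|].
  { repeat apply Rmult_le_pos; assumption. }
  replace (3 * L ^ 4) with (L * L * L * (3 * L)) by ring.
  apply Rmult_le_compat; [|assumption|assumption|assumption].
  repeat apply Rmult_le_pos; assumption.
Qed.

Lemma Cmod_sqr z : Cmod z ^ 2 = fst z ^ 2 + snd z ^ 2.
Proof. unfold Cmod; apply pow2_sqrt; pose proof (pow2_ge_0 (fst z)); pose proof (pow2_ge_0 (snd z)); lra. Qed.

Lemma dist2_Cmod c z : dist2 c z = Cmod (z - c) ^ 2.
Proof. rewrite Cmod_sqr; reflexivity. Qed.

Lemma disk_Cmod c r z : 0 < r -> disk c r z <-> Cmod (z - c) < r.
Proof.
intros Hr; unfold disk; rewrite dist2_Cmod; pose proof (Cmod_ge_0 (z - c)).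
split; intros H1; [|nra]; apply Rnot_le_lt; intros H2; nra.
Qed.

Lemma disk0_Cmod r z : 0 < r -> disk 0 r z <-> Cmod z < r.
Proof. intros Hr; rewrite disk_Cmod by exact Hr; replace (z - 0)%C with z by ring; reflexivity. Qed.

Lemma unit_disk_disk z : unit_disk z <-> disk 0 1 z.
Proof. rewrite disk0_Cmod by lra; reflexivity. Qed.

Lemma locally_disk z (P : C -> Prop) :
  locally z P <-> exists r, 0 < r /\ forall w, Cmod (w - z) < r -> P w.
Proof.
rewrite locally_square; split.
- intros [d H]; exists d; split; [apply cond_pos|]; intros w Hw.
  rewrite (surjective_pairing w); apply H.
  + apply Rle_lt_trans with (2 := Hw), (Rabs_fst_Cmod (w - z)%C).
  + apply Rle_lt_trans with (2 := Hw), (Rabs_snd_Cmod (w - z)%C).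
- intros [r [Hr H]]; assert (Hr2 : 0 < r / 2) by lra.
  exists (mkposreal _ Hr2); simpl; intros x y Hx Hy; apply H.
  apply Rle_lt_trans with (1 := Cmod_le_Rabs _); simpl.
  change (Rabs (x - fst z) + Rabs (y - snd z) < r); lra.
Qed.

Lemma holo_at_div (p q : C -> C) z d e :
  q z <> RtoC 0 -> holo_at p z d -> holo_at q z e ->
  holo_at (fun w => p w / q w)%C z ((d * q z - p z * e) / (q z * q z))%C.
Proof.
intros Hq Hp He; eapply holo_at_eq.
- apply (holo_at_mult p (fun w => / q w)%C); [exact Hp|apply holo_at_inv; eassumption].
- simpl; field; exact Hq.
Qed.

Lemma continuous_C_of_Cmod (p : C -> C) z :
  (forall eps, 0 < eps -> locally z (fun w => Cmod (p w - p z) < eps)) -> continuous p z.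
Proof.
intros H P HP; apply locally_disk in HP; destruct HP as [r [Hr HP]].
apply filter_imp with (2 := H r Hr); intros w Hw; apply HP, Hw.
Qed.

Lemma continuous_C_Cmod (p : C -> C) z : continuous p z ->
  forall eps, 0 < eps -> locally z (fun w => Cmod (p w - p z) < eps).
Proof.
intros H eps He; apply (H (fun w => Cmod (w - p z) < eps)), locally_disk; exists eps; auto.
Qed.

Definition slope (p : C -> C) (z d w : C) : C :=
  if Ceq_dec w z then d else ((p w - p z) / (w - z))%C.

Lemma Cminus_neq (w z : C) : w <> z -> (w - z)%C <> 0.
Proof. intros H E; apply H; replace w with ((w - z) + z)%C by ring; rewrite E; ring. Qed.

Lemma slope_neq p z d w : w <> z -> slope p z d w = ((p w - p z) / (w - z))%C.
Proof. intros H; unfold slope; destruct (Ceq_dec w z); [contradiction|reflexivity]. Qed.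

Lemma slope_holo p z d w e : w <> z -> holo_at p w e -> exists d', holo_at (slope p z d) w d'.
Proof.
intros Hw He; eexists; apply holo_at_ext_loc with (fun w => (p w - p z) / (w - z))%C.
- apply locally_disk; exists (Cmod (w - z)); split; [apply Cmod_gt_0, Cminus_neq, Hw|].
  intros v Hv; rewrite slope_neq; [reflexivity|]; intros ->.
  replace (z - w)%C with (- (w - z))%C in Hv by ring; rewrite Cmod_opp in Hv; lra.
- apply holo_at_div; [apply Cminus_neq, Hw| |].
  + apply holo_at_minus; [exact He|apply holo_at_const].
  + apply holo_at_minus; [apply holo_at_id|apply holo_at_const].
Qed.

Lemma slope_continuous p z d : holo_at p z d -> continuous (slope p z d) z.
Proof.
intros H; apply continuous_C_of_Cmod; intros eps He.
apply filter_imp with (2 := holo_at_bound p z d H (eps / 2) ltac:(lra)).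
intros w Hw; unfold slope; destruct (Ceq_dec z z) as [_|N]; [|contradiction N; reflexivity].
destruct (Ceq_dec w z) as [->|N]; [rewrite Cmod_minus_self; exact He|].
pose proof (Cminus_neq w z N) as N'; pose proof (proj1 (Cmod_gt_0 _) N') as Hpos.
replace ((p w - p z) / (w - z) - d)%C with ((p w - p z - d * (w - z)) / (w - z))%C by (field; exact N').
rewrite Cmod_div by exact N'.
apply Rmult_lt_reg_r with (Cmod (w - z)); [exact Hpos|].
unfold Rdiv; rewrite Rmult_assoc, Rinv_l by lra; nra.
Qed.

Lemma holo_at_circle G t g : holo_at G (expi t) g ->
  is_derive (fun s => fst (G (expi s))) t (fst (g * (Ci * expi t))%C) /\
  is_derive (fun s => snd (G (expi s))) t (snd (g * (Ci * expi t))%C).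
Proof.
intros [H1 H2].
assert (C1 : is_derive cos t (- sin t)) by (apply is_derive_Reals, derivable_pt_lim_cos).
assert (C2 : is_derive sin t (cos t)) by (apply is_derive_Reals, derivable_pt_lim_sin).
split.
- replace (fst (g * (Ci * expi t))%C) with (fst g * - sin t + - snd g * cos t) by (simpl; ring).
  apply (has_grad_curve (fun w => fst (G w)) cos sin); assumption.
- replace (snd (g * (Ci * expi t))%C) with (snd g * - sin t + fst g * cos t) by (simpl; ring).
  apply (has_grad_curve (fun w => snd (G w)) cos sin); assumption.
Qed.

Lemma expi_PI : expi (- PI) = expi PI.
Proof. unfold expi; rewrite cos_neg, sin_neg, sin_PI; f_equal; ring. Qed.

Lemma circle_int_derivative G g :
  (forall t, holo_at G (expi t) (g (expi t))) -> ccont (fun t => g (expi t)) ->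
  circle_int (fun t => g (expi t) * (Ci * expi t))%C = 0.
Proof.
intros HG Hg.
assert (K : ccont (fun t => g (expi t) * (Ci * expi t))%C).
{ ccont. }
assert (S : forall f df : R -> R, (forall t, is_derive f t (df t)) -> (forall t, continuous df t) ->
  f (- PI) = f PI -> RInt df (- PI) PI = 0).
{ intros f df H1 H2 H3; apply is_RInt_unique.
  replace 0 with (minus (f PI) (f (- PI))) by (rewrite H3; unfold minus, plus, opp; simpl; ring).
  apply (is_RInt_derive (V := R_CompleteNormedModule)); intros; auto. }
apply C_ext; simpl fst; simpl snd.
- apply (S (fun t => fst (G (expi t)))).
  + intros t; apply (holo_at_circle G t (g (expi t)) (HG t)).
  + intros t; apply (K t).
  + rewrite expi_PI; reflexivity.
- apply (S (fun t => snd (G (expi t)))).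
  + intros t; apply (holo_at_circle G t (g (expi t)) (HG t)).
  + intros t; apply (K t).
  + rewrite expi_PI; reflexivity.
Qed.

Lemma ccont_comp (p : C -> C) : (forall t, continuous p (expi t)) -> ccont (fun t => p (expi t)).
Proof.
intros H t.
assert (E : continuous expi t).
{ apply (continuous_comp_2 cos sin (fun a b => (a, b) : C)); [apply Rc_cos|apply Rc_sin|].
  apply continuous_ext with (fun w : C => w); [intros [a b]; reflexivity|apply continuous_id]. }
split.
- apply (continuous_comp expi (fun w => fst (p w))); [exact E|apply continuous_fst_C, H].
- apply (continuous_comp expi (fun w => snd (p w))); [exact E|apply continuous_snd_C, H].
Qed.

Lemma disk_expi rho t : 1 < rho -> disk 0 rho (expi t).
Proof. intros H; apply disk0_Cmod; [lra|rewrite Cmod_expi; exact H]. Qed.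

(** Cauchy's formula: the difference quotient has a primitive, since its only
    singularity is a point of continuity, so its integral over the circle
    vanishes. *)
Lemma cauchy_formula (p : C -> C) rho z :
  1 < rho -> (forall w, disk 0 rho w -> exists d, holo_at p w d) -> Cmod z < 1 ->
  circle_int (fun t => p (expi t) * (Ci * expi t) * / (expi t - z))%C =
  (p z * circle_int (fun t => Ci * expi t * / (expi t - z)))%C.
Proof.
intros Hrho Hp Hz.
assert (Hzd : disk 0 rho z) by (apply disk0_Cmod; lra).
destruct (Hp z Hzd) as [d Hd].
destruct (primitive_on_disk (slope p z d) 0 rho z) as [G HG].
- intros w Hw; destruct (Ceq_dec w z) as [->|N]; [apply slope_continuous, Hd|].
  destruct (Hp w Hw) as [e He]; destruct (slope_holo p z d w e N He) as [e' He'].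
  apply (holo_at_continuous _ _ _ He').
- intros w Hw N; destruct (Hp w Hw) as [e He]; apply (slope_holo p z d w e N He).
- assert (Cp : ccont (fun t => p (expi t))).
  { apply ccont_comp; intros t; destruct (Hp _ (disk_expi rho t Hrho)) as [e He].
    apply (holo_at_continuous _ _ _ He). }
  assert (N : forall t, expi t <> z).
  { intros t E; pose proof (Cmod_expi t) as U; rewrite E in U; lra. }
  assert (E : forall t, slope p z d (expi t) = ((p (expi t) - p z) * / (expi t - z))%C).
  { intros t; apply slope_neq, N. }
  assert (CS : ccont (fun t => slope p z d (expi t))).
  { intros t; destruct (ccont_mult _ _ (ccont_minus _ _ Cp (ccont_const (p z))) (ccont_kernel z Hz) t) as [K1 K2].
    split; [apply continuous_ext with (2 := K1)|apply continuous_ext with (2 := K2)];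
    intros s; rewrite E; reflexivity. }
  pose proof (circle_int_derivative G (slope p z d) (fun t => HG _ (disk_expi rho t Hrho)) CS) as I0.
  assert (CE : ccont (fun t => Ci * expi t)%C) by ccont.
  rewrite <- circle_int_scal by (apply ccont_mult; [exact CE|apply ccont_kernel, Hz]).
  assert (I1 : (circle_int (fun t => p (expi t) * (Ci * expi t) * / (expi t - z)) -
     circle_int (fun t => p z * (Ci * expi t * / (expi t - z))))%C = 0).
  { rewrite <- circle_int_minus.
    - rewrite <- I0; unfold circle_int; f_equal; apply RInt_ext; intros t _; f_equal; rewrite E; ring.
    - ccont; apply ccont_kernel, Hz.
    - ccont; apply ccont_kernel, Hz. }
  match goal with |- ?a = ?b => replace a with ((a - b) + b)%C by ring end.
  rewrite I1; ring.
Qed.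

Lemma circle_int_const c : circle_int (fun _ => c) = (2 * PI * c)%C.
Proof.
apply C_ext; simpl; rewrite RInt_const; unfold scal; simpl; unfold mult; simpl; ring.
Qed.

(** Cauchy's formula exhibits [p] near the center as the quotient of two Cauchy
    integrals. The denominator, the Cauchy integral of 1, is constant, but it is
    enough that it does not vanish at the center. *)
Lemma cderiv_holo_center (p : C -> C) rho :
  1 < rho -> (forall w, disk 0 rho w -> exists d, holo_at p w d) ->
  exists d, holo_at (cderiv p) 0 d.
Proof.
intros Hrho Hp.
assert (Cp : ccont (fun t => p (expi t))).
{ apply ccont_comp; intros t; destruct (Hp _ (disk_expi rho t Hrho)) as [e He].
  apply (holo_at_continuous _ _ _ He). }
assert (CE : ccont (fun t => Ci * expi t)%C) by ccont.
assert (CA : ccont (fun t => p (expi t) * (Ci * expi t))%C) by (apply ccont_mult; assumption).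
set (A := fun z => circle_int (fun t => p (expi t) * (Ci * expi t) * / (expi t - z))%C).
set (N := fun z => circle_int (fun t => Ci * expi t * / (expi t - z))%C).
set (A1 := fun z => circle_int (fun t => p (expi t) * (Ci * expi t) * (/ (expi t - z) * / (expi t - z)))%C).
set (N1 := fun z => circle_int (fun t => Ci * expi t * (/ (expi t - z) * / (expi t - z)))%C).
assert (HA : forall z, Cmod z < 1 -> holo_at A z (A1 z)) by (intros z Hz; apply (holo_at_cauchy1 _ z CA Hz)).
assert (HN : forall z, Cmod z < 1 -> holo_at N z (N1 z)) by (intros z Hz; apply (holo_at_cauchy1 _ z CE Hz)).
assert (H0 : Cmod 0 < 1) by (rewrite Cmod_0; lra).
assert (N0 : N 0 <> 0).
{ unfold N; replace (circle_int _) with (circle_int (fun _ => Ci)).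
  - rewrite circle_int_const; intros E; apply (f_equal snd) in E; simpl in E; pose proof PI_RGT_0; lra.
  - unfold circle_int; f_equal; apply RInt_ext; intros t _; f_equal; field;
    pose proof (expi_minus_neq_0 t 0 H0) as K; intros K'; apply K; rewrite K'; ring. }
assert (L : locally (RtoC 0) (fun w => N w <> 0)).
{ pose proof (proj1 (Cmod_gt_0 _) N0) as Hpos.
  apply filter_imp with (2 := continuous_C_Cmod N (RtoC 0) (holo_at_continuous _ _ _ (HN 0 H0)) _ Hpos).
  intros w Hw E; rewrite E in Hw; replace (0 - N 0)%C with (- N 0)%C in Hw by ring.
  rewrite Cmod_opp in Hw; lra. }
apply locally_disk in L; destruct L as [r [Hr L]].
assert (Hm := Rmin_pos r 1 Hr Rlt_0_1).
assert (Hin : forall w, Cmod w < Rmin r 1 -> N w <> 0 /\ Cmod w < 1).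
{ intros w Hw; pose proof (Rmin_l r 1); pose proof (Rmin_r r 1); split; [apply L|lra].
  replace (w - 0)%C with w by ring; lra. }
assert (Q : forall w, Cmod w < Rmin r 1 -> p w = (A w / N w)%C).
{ intros w Hw; destruct (Hin w Hw) as [Nw Hw1]; unfold A; rewrite (cauchy_formula p rho w Hrho Hp Hw1).
  fold (N w); field; exact Nw. }
assert (D : forall w, Cmod w < Rmin r 1 -> cderiv p w = ((A1 w * N w - A w * N1 w) / (N w * N w))%C).
{ intros w Hw; destruct (Hin w Hw) as [Nw Hw1]; apply holo_at_cderiv.
  apply holo_at_ext_loc with (fun w => A w / N w)%C.
  - apply locally_disk; exists (Rmin r 1 - Cmod w); split; [lra|]; intros v Hv.
    symmetry; apply Q; replace v with ((v - w) + w)%C by ring.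
    pose proof (Cmod_triangle (v - w) w); lra.
  - apply holo_at_div; auto. }
eexists; apply holo_at_ext_loc with (fun w => (A1 w * N w - A w * N1 w) / (N w * N w))%C.
- apply locally_disk; exists (Rmin r 1); split; [exact Hm|]; intros w Hw; symmetry; apply D.
  replace (w - 0)%C with w in Hw by ring; exact Hw.
- apply holo_at_div.
  + apply Cmult_neq_0; exact N0.
  + apply holo_at_minus; apply holo_at_mult.
    * apply (holo_at_cauchy2 _ 0 CA H0).
    * apply HN, H0.
    * apply HA, H0.
    * apply (holo_at_cauchy2 _ 0 CE H0).
  + apply holo_at_mult; apply HN, H0.
Qed.

Definition holo_on (X : C -> Prop) (p : C -> C) : Prop :=
  forall z, X z -> holo_at p z (cderiv p z).

Lemma holo_on_intro (X : C -> Prop) p : (forall z, X z -> exists d, holo_at p z d) -> holo_on X p.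
Proof. intros H z Hz; destruct (H z Hz) as [d Hd]; rewrite (holo_at_cderiv _ _ _ Hd); exact Hd. Qed.

Lemma holo_at_affine a b z : holo_at (fun w => a + b * w)%C z b.
Proof.
eapply holo_at_eq; [apply holo_at_plus; [apply holo_at_const|apply holo_at_scal, holo_at_id]|ring].
Qed.

(** The case of the unit disk, transported to a small disk around each point. *)
Theorem cderiv_holo (X : C -> Prop) p : open X -> holo_on X p -> holo_on X (cderiv p).
Proof.
intros HX Hp; apply holo_on_intro; intros z Hz.
pose proof (open_locally _ _ HX Hz) as L; apply locally_disk in L; destruct L as [r [Hr L]].
assert (Hr2 : RtoC (r / 2) <> 0) by (intros E; injection E; lra).
set (q := fun w => p (z + RtoC (r / 2) * w)%C).
assert (Hin : forall w, Cmod w < 2 -> X (z + RtoC (r / 2) * w)%C).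
{ intros w Hw; apply L; replace (z + RtoC (r / 2) * w - z)%C with (RtoC (r / 2) * w)%C by ring.
  rewrite Cmod_mult, Cmod_R, Rabs_pos_eq by lra; nra. }
assert (Hq : forall w, Cmod w < 2 -> holo_at q w (cderiv p (z + RtoC (r / 2) * w) * RtoC (r / 2))%C).
{ intros w Hw; apply (holo_at_comp p (fun w => z + RtoC (r / 2) * w)%C); [apply Hp, Hin, Hw|apply holo_at_affine]. }
destruct (cderiv_holo_center q 2) as [d Hd]; [lra| |].
- intros w Hw; apply disk0_Cmod in Hw; [|lra]; eexists; apply Hq, Hw.
- eexists; apply holo_at_ext_loc with (fun w => / RtoC (r / 2) * cderiv q (- (z / RtoC (r / 2)) + / RtoC (r / 2) * w))%C.
  + apply locally_disk; exists r; split; [exact Hr|]; intros w Hw.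
    set (v := (- (z / RtoC (r / 2)) + / RtoC (r / 2) * w)%C).
    assert (Ev : (z + RtoC (r / 2) * v)%C = w) by (unfold v; field; exact Hr2).
    assert (Hv : Cmod v < 2).
    { replace v with ((w - z) / RtoC (r / 2))%C by (unfold v; field; exact Hr2).
      rewrite Cmod_div, Cmod_R, Rabs_pos_eq by (assumption || lra).
      apply Rmult_lt_reg_r with (r / 2); [lra|].
      unfold Rdiv at 1; rewrite Rmult_assoc, Rinv_l by lra; lra. }
    rewrite (holo_at_cderiv _ _ _ (Hq v Hv)), Ev; field; exact Hr2.
  + apply holo_at_scal, (holo_at_comp (cderiv q) (fun w => - (z / RtoC (r / 2)) + / RtoC (r / 2) * w)%C).
    * replace (- (z / RtoC (r / 2)) + / RtoC (r / 2) * z)%C with (RtoC 0) by (field; exact Hr2); exact Hd.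
    * apply holo_at_affine.
Qed.

(** * Composition with holomorphic functions *)

(** In the Laplacian of the composite, the Cauchy-Riemann equations cancel the
    mixed second derivatives of [phi] and the terms containing the second
    derivative of [q]. *)
Lemma C2_comp_holo (X Y : C -> Prop) (phi : C -> R) (q : C -> C) :
  open X -> open Y -> holo_on X q -> (forall z, X z -> Y (q z)) -> Ck_on 2 Y phi ->
  Ck_on 2 X (fun z => phi (q z)) /\
  (forall z, X z ->
     partial_x (fun z => phi (q z)) z =
       partial_x phi (q z) * fst (cderiv q z) + partial_y phi (q z) * snd (cderiv q z) /\
     partial_y (fun z => phi (q z)) z =
       - partial_x phi (q z) * snd (cderiv q z) + partial_y phi (q z) * fst (cderiv q z)) /\
  (forall z, X z ->
     laplacian (fun z => phi (q z)) z = Cmod (cderiv q z) ^ 2 * laplacian phi (q z)).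
Proof.
intros HX HY Hq HXY Hphi.
pose proof (cderiv_holo X q HX Hq) as Hq'.
pose proof (C2_second_order Y phi HY Hphi) as S.
assert (Cc : forall u a b z, has_grad u (q z) a b -> X z ->
   has_grad (fun w => u (q w)) z (a * fst (cderiv q z) + b * snd (cderiv q z))
     (- a * snd (cderiv q z) + b * fst (cderiv q z))).
{ intros u a b z Hu Hz; destruct (Hq z Hz) as [H1 H2].
  apply has_grad_ext with (fun w => u (fst (q w), snd (q w))).
  { intros w; rewrite <- surjective_pairing; reflexivity. }
  rewrite (surjective_pairing (q z)) in Hu.
  eapply has_grad_eq; [apply (has_grad_comp u _ _ z _ _ _ _ _ _ Hu H1 H2)| |]; ring. }
assert (W : second_order X (fun z => phi (q z))
  (fun z => partial_x phi (q z) * fst (cderiv q z) + partial_y phi (q z) * snd (cderiv q z))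
  (fun z => partial_y phi (q z) * fst (cderiv q z) - partial_x phi (q z) * snd (cderiv q z))
  (fun z => let c := fst (cderiv q z) in let d := snd (cderiv q z) in
     partial_x (partial_x phi) (q z) * c ^ 2 + (partial_y (partial_x phi) (q z) + partial_x (partial_y phi) (q z)) * c * d
     + partial_y (partial_y phi) (q z) * d ^ 2
     + partial_x phi (q z) * fst (cderiv (cderiv q) z) + partial_y phi (q z) * snd (cderiv (cderiv q) z))
  (fun z => let c := fst (cderiv q z) in let d := snd (cderiv q z) in
     - partial_x (partial_x phi) (q z) * c * d + partial_y (partial_x phi) (q z) * c ^ 2
     - partial_x (partial_y phi) (q z) * d ^ 2 + partial_y (partial_y phi) (q z) * c * d
     - partial_x phi (q z) * snd (cderiv (cderiv q) z) + partial_y phi (q z) * fst (cderiv (cderiv q) z))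
  (fun z => let c := fst (cderiv q z) in let d := snd (cderiv q z) in
     - partial_x (partial_x phi) (q z) * c * d + partial_x (partial_y phi) (q z) * c ^ 2
     - partial_y (partial_x phi) (q z) * d ^ 2 + partial_y (partial_y phi) (q z) * c * d
     - partial_x phi (q z) * snd (cderiv (cderiv q) z) + partial_y phi (q z) * fst (cderiv (cderiv q) z))
  (fun z => let c := fst (cderiv q z) in let d := snd (cderiv q z) in
     partial_x (partial_x phi) (q z) * d ^ 2 - (partial_y (partial_x phi) (q z) + partial_x (partial_y phi) (q z)) * c * d
     + partial_y (partial_y phi) (q z) * c ^ 2
     - partial_x phi (q z) * fst (cderiv (cderiv q) z) - partial_y phi (q z) * snd (cderiv (cderiv q) z))).
{ intros z Hz; cbn zeta; destruct (S (q z) (HXY z Hz)) as (g & g1 & g2).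
  destruct (Hq' z Hz) as [d1 d2].
  split; [|split].
  - eapply has_grad_eq; [apply (Cc _ _ _ _ g Hz)|ring|ring].
  - eapply has_grad_eq; [apply has_grad_plus; apply has_grad_mult;
      [apply (Cc _ _ _ _ g1 Hz)|exact d1|apply (Cc _ _ _ _ g2 Hz)|exact d2]| |]; cbv beta; ring.
  - eapply has_grad_eq; [apply has_grad_minus; apply has_grad_mult;
      [apply (Cc _ _ _ _ g2 Hz)|exact d1|apply (Cc _ _ _ _ g1 Hz)|exact d2]| |]; cbv beta; ring. }
split; [|split].
- apply (second_order_C2 X _ _ _ _ _ _ _ HX W); intros z Hz.
  destruct (C2_continuous_second Y phi (q z) Hphi (HXY z Hz)) as (c1 & c2 & c3 & c4).
  destruct (S (q z) (HXY z Hz)) as (g & g1 & g2).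
  pose proof (has_grad_continuous _ _ _ _ g1) as c5; pose proof (has_grad_continuous _ _ _ _ g2) as c6.
  pose proof (holo_at_continuous _ _ _ (Hq z Hz)) as cq.
  pose proof (holo_at_continuous _ _ _ (Hq' z Hz)) as cq'.
  pose proof (holo_at_continuous _ _ _ (cderiv_holo X _ HX Hq' z Hz)) as cq''.
  assert (E : forall u : C -> R, continuous u (q z) -> continuous (fun w => u (q w)) z).
  { intros u Hu; apply (continuous_comp q u); assumption. }
  apply E in c1, c2, c3, c4, c5, c6.
  pose proof (continuous_fst_C _ _ cq'); pose proof (continuous_snd_C _ _ cq').
  pose proof (continuous_fst_C _ _ cq''); pose proof (continuous_snd_C _ _ cq'').
  refine (conj _ (conj _ (conj _ _))); cbv zeta; cont_R.
- intros z Hz; destruct (has_grad_partial _ _ _ _ (proj1 (W z Hz))) as [-> ->]; split; ring.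
- intros z Hz; rewrite (second_order_laplacian _ _ _ _ _ _ _ _ _ HX W Hz), Cmod_sqr; cbn zeta.
  unfold laplacian; ring.
Qed.

Lemma C2_sqr_norm (X : C -> Prop) c : open X ->
  Ck_on 2 X (dist2 c) /\ (forall z, X z -> laplacian (dist2 c) z = 4).
Proof.
intros HX.
assert (W : second_order X (dist2 c) (fun z => 2 * (fst z - fst c)) (fun z => 2 * (snd z - snd c))
  (fun _ => 2) (fun _ => 0) (fun _ => 0) (fun _ => 2)).
{ intros z _; split; [apply has_grad_dist2|split].
  - eapply has_grad_eq; [apply has_grad_scal, has_grad_minus; [apply has_grad_Re|apply has_grad_const]| |]; ring.
  - eapply has_grad_eq; [apply has_grad_scal, has_grad_minus; [apply has_grad_Im|apply has_grad_const]| |]; ring. }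
split.
- apply (second_order_C2 X _ _ _ _ _ _ _ HX W); intros z _; repeat split; apply cont_const.
- intros z Hz; rewrite (second_order_laplacian _ _ _ _ _ _ _ _ _ HX W Hz); ring.
Qed.

(** * Local theory of holomorphic functions *)

(** The function is the derivative of its primitive, and derivatives of
    holomorphic functions are holomorphic. *)
Lemma removable_singularity (s : C -> C) c r b :
  (forall z, disk c r z -> continuous s z) ->
  (forall z, disk c r z -> z <> b -> exists d, holo_at s z d) ->
  holo_on (disk c r) s.
Proof.
intros HC HX; destruct (primitive_on_disk s c r b HC HX) as [G HG].
assert (HG' : holo_on (disk c r) G) by (apply holo_on_intro; intros z Hz; eexists; apply HG, Hz).
apply holo_on_intro; intros z Hz; exists (cderiv (cderiv G) z).
apply holo_at_ext_loc with (cderiv G).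
- apply filter_imp with (2 := open_locally _ _ (open_disk c r) Hz).
  intros w Hw; apply holo_at_cderiv, HG, Hw.
- apply (cderiv_holo _ _ (open_disk c r) HG'), Hz.
Qed.

Lemma slope_holo_on p c r : holo_on (disk c r) p -> 0 < r -> holo_on (disk c r) (slope p c (cderiv p c)).
Proof.
intros Hp Hr; apply (removable_singularity _ c r c).
- intros z Hz; destruct (Ceq_dec z c) as [->|N]; [apply slope_continuous, Hp, Hz|].
  destruct (slope_holo p c (cderiv p c) z _ N (Hp z Hz)) as [d Hd]; apply (holo_at_continuous _ _ _ Hd).
- intros z Hz N; apply (slope_holo p c (cderiv p c) z _ N (Hp z Hz)).
Qed.

Lemma slope_factor p c d z : (p z = p c + (z - c) * slope p c d z)%C.
Proof.
unfold slope; destruct (Ceq_dec z c) as [->|N]; [ring|].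
field; apply Cminus_neq, N.
Qed.

(** [|g|^2 + eps |z - c|^2] is strictly subharmonic, hence has no interior
    maximum. *)
Lemma maximum_modulus g c r rho B :
  0 <= rho < r -> holo_on (disk c r) g ->
  (forall z, dist2 c z = rho ^ 2 -> dist2 0 (g z) <= B) ->
  forall z, dist2 c z <= rho ^ 2 -> dist2 0 (g z) <= B.
Proof.
intros Hrho Hg HB z Hz.
assert (HT : open (fun _ : C => True)) by (intros w _; apply filter_true).
assert (Sub : forall w, dist2 c w <= rho ^ 2 -> disk c r w) by (intros w Hw; unfold disk; nra).
destruct (C2_sqr_norm _ 0 HT) as [N1 N2].
destruct (C2_comp_holo (disk c r) (fun _ => True) (dist2 0) g (open_disk c r) HT Hg (fun _ _ => I) N1)
  as (U1 & _ & U2).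
destruct (C2_sqr_norm (disk c r) c (open_disk c r)) as [V1 V2].
assert (E : forall eps, 0 < eps -> dist2 0 (g z) <= B + eps * rho ^ 2).
{ intros eps He.
  destruct (C2_scal _ eps _ (open_disk c r) V1) as [W1 W2].
  destruct (C2_plus _ _ _ (open_disk c r) U1 W1) as [T1 T2].
  set (u := fun z => dist2 0 (g z) + eps * dist2 c z) in *.
  destruct (closed_disk_max u c rho) as (m & Hm1 & Hm2); [lra| |].
  { intros w Hw; apply (Ck_continuous 2 (disk c r)); auto. }
  assert (Hm : dist2 c m = rho ^ 2).
  { apply Rle_antisym; [exact Hm1|]; apply Rnot_lt_le; intros Hlt.
    assert (L : laplacian u m <= 0).
    { apply (laplacian_at_max (disk c r)); auto; [apply open_disk|].
      apply filter_imp with (2 := open_locally _ _ (open_dist2 c (rho ^ 2)) Hlt).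
      intros w Hw; apply Hm2; lra. }
    rewrite (T2 m), (U2 m), (W2 m), (V2 m), (N2 (g m)) in L by (trivial || apply Sub, Hm1).
    pose proof (pow2_ge_0 (Cmod (cderiv g m))); lra. }
  pose proof (Hm2 z Hz) as Q; pose proof (HB m Hm) as Q'; unfold u in Q; rewrite Hm in Q.
  pose proof (pow2_ge_0 (fst z - fst c)); pose proof (pow2_ge_0 (snd z - snd c)).
  assert (0 <= eps * dist2 c z) by (apply Rmult_le_pos; [lra|unfold dist2; lra]); lra. }
apply Rnot_lt_le; intros Hlt.
assert (H2 := pow2_ge_0 rho).
specialize (E ((dist2 0 (g z) - B) / (2 * (rho ^ 2 + 1)))).
assert (F : (dist2 0 (g z) - B) / (2 * (rho ^ 2 + 1)) * rho ^ 2 <= (dist2 0 (g z) - B) / 2).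
{ apply Rmult_le_reg_r with (2 * (rho ^ 2 + 1)); [lra|].
  replace ((dist2 0 (g z) - B) / (2 * (rho ^ 2 + 1)) * rho ^ 2 * (2 * (rho ^ 2 + 1)))
    with ((dist2 0 (g z) - B) * rho ^ 2) by (field; lra).
  nra. }
assert (0 < (dist2 0 (g z) - B) / (2 * (rho ^ 2 + 1))) by (apply Rdiv_lt_0_compat; lra).
specialize (E H); lra.
Qed.

Lemma dist2_0_Cmod z : dist2 0 z = Cmod z ^ 2.
Proof. rewrite dist2_Cmod; f_equal; f_equal; ring. Qed.

Lemma Cmod_bound_of_boundary g c r rho B :
  0 < rho < r -> 0 <= B -> holo_on (disk c r) g ->
  (forall z, Cmod (z - c) = rho -> Cmod (g z) <= B) ->
  forall z, Cmod (z - c) <= rho -> Cmod (g z) <= B.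
Proof.
intros Hrho HB Hg H z Hz.
assert (K : dist2 0 (g z) <= B ^ 2).
{ apply (maximum_modulus g c r rho); [lra|exact Hg| |].
  - intros w Hw; rewrite dist2_Cmod in Hw; rewrite dist2_0_Cmod.
    assert (Cmod (w - c) = rho).
    { pose proof (Cmod_ge_0 (w - c)); nra. }
    pose proof (H w H0); pose proof (Cmod_ge_0 (g w)); nra.
  - rewrite dist2_Cmod; pose proof (Cmod_ge_0 (z - c)); nra. }
rewrite dist2_0_Cmod in K; pose proof (Cmod_ge_0 (g z)); nra.
Qed.

(** Zeros of a function that does not vanish identically are isolated: if every
    quotient [g / (z - c)^n] extended to [c] vanished there, the maximum
    principle would give [|g| <= M (|z - c| / rho)^n] for all [n]. *)
Lemma isolated_zero g c r :
  0 < r -> holo_on (disk c r) g ->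
  (exists rho, 0 < rho < r /\ forall z, Cmod (z - c) < rho -> g z = 0) \/
  (exists rho, 0 < rho < r /\ forall z, 0 < Cmod (z - c) < rho -> g z <> 0).
Proof.
intros Hr Hg.
set (q := fix q n := match n with O => g | S n => slope (q n) c (cderiv (q n) c) end).
assert (Hq : forall n, holo_on (disk c r) (q n)).
{ induction n as [|n IH]; [exact Hg|apply slope_holo_on; assumption]. }
destruct (classic (exists n, q n c <> 0)) as [Hex|Hall].
- right.
  destruct (dec_inh_nat_subset_has_unique_least_element (fun n => q n c <> 0)
    (fun n => classic _) Hex) as (n & (Hn & Hmin) & _).
  assert (F : forall k, (k <= n)%nat -> forall z, g z = ((z - c) ^ k * q k z)%C).
  { induction k as [|k IH]; intros Hk z; [simpl; ring|].
    rewrite (IH ltac:(lia) z); rewrite (slope_factor (q k) c (cderiv (q k) c) z).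
    assert (Z : q k c = 0).
    { apply NNPP; intros N; specialize (Hmin k N); lia. }
    change (q (S k) z) with (slope (q k) c (cderiv (q k) c) z); rewrite Z; simpl; ring. }
  assert (Hc : disk c r c) by (unfold disk, dist2; nra).
  pose proof (proj1 (Cmod_gt_0 _) Hn) as Hpos.
  pose proof (continuous_C_Cmod (q n) c (holo_at_continuous _ _ _ (Hq n c Hc)) _ Hpos) as L.
  apply locally_disk in L; destruct L as (e & He & L).
  exists (Rmin e (r / 2)); split; [split; [apply Rmin_pos; lra|]|].
  { pose proof (Rmin_r e (r / 2)); lra. }
  intros z Hz; rewrite (F n (Nat.le_refl n) z); apply Cmult_neq_0.
  + apply Cpow_nz; apply Cmod_gt_0; lra.
  + intros E; pose proof (Rmin_l e (r / 2)); specialize (L z ltac:(lra)).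
    rewrite E in L; replace (0 - q n c)%C with (- q n c)%C in L by ring; rewrite Cmod_opp in L; lra.
- left.
  assert (Hz : forall n, q n c = 0) by (intros n; apply NNPP; intros N; apply Hall; exists n; exact N).
  assert (F : forall k z, g z = ((z - c) ^ k * q k z)%C).
  { induction k as [|k IH]; intros z; [simpl; ring|].
    rewrite (IH z), (slope_factor (q k) c (cderiv (q k) c) z), Hz.
    change (q (S k) z) with (slope (q k) c (cderiv (q k) c) z); simpl; ring. }
  set (rho := r / 2).
  assert (Hrho : 0 < rho < r) by (unfold rho; lra).
  destruct (closed_disk_max (fun z => dist2 0 (g z)) c rho) as (m & _ & Hm); [lra| |].
  { intros z Hzz; apply (continuous_comp g (dist2 0)); [|apply dist2_continuous].
    apply (holo_at_continuous _ _ _ (Hg z ltac:(unfold disk; nra))). }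
  set (M := sqrt (dist2 0 (g m))).
  assert (HM : forall z, Cmod (z - c) <= rho -> Cmod (g z) <= M).
  { intros z Hzz; unfold M; rewrite <- (sqrt_pow2 (Cmod (g z))) by apply Cmod_ge_0.
    apply sqrt_le_1_alt; rewrite <- dist2_0_Cmod; apply Hm; rewrite dist2_Cmod.
    pose proof (Cmod_ge_0 (z - c)); nra. }
  assert (HM0 : 0 <= M) by apply sqrt_pos.
  assert (Hpw : forall n, 0 < rho ^ n) by (intros n; apply pow_lt; lra).
  assert (Cp : forall z n, Cmod (z ^ n)%C = Cmod z ^ n).
  { intros z n; induction n as [|n IH]; simpl; [apply Cmod_1|rewrite Cmod_mult, IH; reflexivity]. }
  assert (Q : forall n z, Cmod (z - c) <= rho -> Cmod (q n z) <= M / rho ^ n).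
  { intros n; apply (Cmod_bound_of_boundary (q n) c r rho); auto.
    - apply Rdiv_le_0_compat; auto.
    - intros z Hzz; apply Rmult_le_reg_l with (rho ^ n); [apply Hpw|].
      replace (rho ^ n * (M / rho ^ n)) with M by (field; specialize (Hpw n); lra).
      rewrite <- Hzz at 1; rewrite <- Cp, <- Cmod_mult, <- F; apply HM; lra. }
  exists rho; split; [exact Hrho|]; intros z Hzz; apply Cmod_eq_0.
  apply Rle_antisym; [|apply Cmod_ge_0]; apply Rnot_lt_le; intros Hlt.
  set (t := Cmod (z - c) / rho).
  assert (Ht : 0 <= t < 1).
  { unfold t; pose proof (Cmod_ge_0 (z - c)); split; [apply Rdiv_le_0_compat; lra|].
    apply Rmult_lt_reg_r with rho; [lra|]; unfold Rdiv; rewrite Rmult_assoc, Rinv_l by lra; lra. }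
  assert (G : forall n, Cmod (g z) <= t ^ n * M).
  { intros n; rewrite (F n z), Cmod_mult, Cp.
    apply Rle_trans with (Cmod (z - c) ^ n * (M / rho ^ n)).
    - apply Rmult_le_compat_l; [apply pow_le, Cmod_ge_0|apply Q; lra].
    - right; unfold t, Rdiv; rewrite Rpow_mult_distr, pow_inv; ring. }
  destruct (pow_lt_1_zero t ltac:(rewrite Rabs_pos_eq; lra) (Cmod (g z) / (M + 1))) as [N HN].
  { apply Rdiv_lt_0_compat; lra. }
  specialize (HN N (Nat.le_refl N)); rewrite Rabs_pos_eq in HN by (apply pow_le; lra).
  pose proof (G N) as GN.
  apply (Rmult_lt_compat_r (M + 1)) in HN; [|lra].
  unfold Rdiv in HN; rewrite Rmult_assoc, Rinv_l, Rmult_1_r in HN by lra.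
  assert (0 <= t ^ N) by (apply pow_le; lra); nra.
Qed.

(* Caratheodory's form of differentiability. *)
Lemma holo_at_of_factor (f m : C -> C) w :
  continuous m w -> locally w (fun v => f v - f w = m v * (v - w))%C -> holo_at f w (m w).
Proof.
intros Hm L; apply holo_at_of_bound; intros eps He.
apply filter_imp with (2 := filter_and _ _ L (continuous_C_Cmod m w Hm eps He)).
intros v [E B]; rewrite E.
replace (m v * (v - w) - m w * (v - w))%C with ((m v - m w) * (v - w))%C by ring.
rewrite Cmod_mult; apply Rmult_le_compat_r; [apply Cmod_ge_0|lra].
Qed.

Lemma continuous_Cinv (f : C -> C) z : f z <> 0 -> continuous f z -> continuous (fun w => / f w)%C z.
Proof.
intros H0 Hf; apply (continuous_comp f Cinv); [exact Hf|].
eapply (holo_at_continuous Cinv), (holo_at_inv (fun w => w) (f z) 1 H0), holo_at_id.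
Qed.

Lemma holo_at_inverse (p s : C -> C) w d :
  holo_at p (s w) d -> d <> 0 -> continuous s w -> locally w (fun v => p (s v) = v) ->
  exists e, holo_at s w e.
Proof.
intros Hp Hd Hs L.
set (k := fun v => slope p (s w) d (s v)).
assert (Ek : k w = d) by (unfold k, slope; destruct (Ceq_dec (s w) (s w)); [reflexivity|contradiction]).
assert (Hk : continuous k w).
{ apply (continuous_comp s (slope p (s w) d)); [exact Hs|apply slope_continuous, Hp]. }
exists (/ k w)%C.
apply (holo_at_of_factor s (fun v => / k v)%C); [apply continuous_Cinv; [rewrite Ek; exact Hd|exact Hk]|].
assert (N : locally w (fun v => k v <> 0)).
{ pose proof (proj1 (Cmod_gt_0 _) Hd) as Hpos.
  apply filter_imp with (2 := continuous_C_Cmod k w Hk _ Hpos).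
  intros v Hv E; rewrite E, Ek in Hv; replace (0 - d)%C with (- d)%C in Hv by ring.
  rewrite Cmod_opp in Hv; lra. }
pose proof (locally_singleton _ _ L) as E0; simpl in E0.
apply filter_imp with (2 := filter_and _ _ L N); intros v [E1 Nv].
pose proof (slope_factor p (s w) d (s v)) as F; fold (k v) in F; rewrite E0, E1 in F.
assert (F' : (v - w = (s v - s w) * k v)%C) by (rewrite F at 1; ring).
rewrite F'; field; exact Nv.
Qed.

Lemma constant_of_zero_derivative (p : C -> C) c r z :
  (forall w, disk c r w -> holo_at p w 0) -> disk c r z -> p z = p c.
Proof.
intros H Hz.
assert (In : forall t, 0 <= t <= 1 -> disk c r (fst c + t * (fst z - fst c), snd c + t * (snd z - snd c))).
{ intros t Ht; unfold disk, dist2 in *; simpl in *.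
  replace ((fst c + t * (fst z - fst c) - fst c) * ((fst c + t * (fst z - fst c) - fst c) * 1) +
    (snd c + t * (snd z - snd c) - snd c) * ((snd c + t * (snd z - snd c) - snd c) * 1))
    with (t ^ 2 * ((fst z - fst c) ^ 2 + (snd z - snd c) ^ 2)) by ring.
  assert (t ^ 2 <= 1) by nra.
  pose proof (pow2_ge_0 (fst z - fst c)); pose proof (pow2_ge_0 (snd z - snd c)); nra. }
assert (Q : forall u : C -> R, (forall w, disk c r w -> has_grad u w 0 0) -> u z = u c).
{ intros u Hu.
  assert (D : forall t, 0 <= t <= 1 ->
    is_derive (fun t => u (fst c + t * (fst z - fst c), snd c + t * (snd z - snd c))) t 0).
  { intros t Ht; replace 0 with (0 * (fst z - fst c) + 0 * (snd z - snd c)) by ring.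
    apply (has_grad_curve u (fun t => fst c + t * (fst z - fst c)) (fun t => snd c + t * (snd z - snd c)));
      [apply Hu, In; lra| |]; auto_derive; trivial; ring. }
  destruct (MVT_gen (fun t => u (fst c + t * (fst z - fst c), snd c + t * (snd z - snd c))) 0 1 (fun _ => 0))
    as [x [_ Hx]].
  - rewrite Rmin_left, Rmax_right by lra; intros t Ht; apply D; lra.
  - rewrite Rmin_left, Rmax_right by lra; intros t Ht.
    apply continuity_pt_filterlim; exact (is_derive_continuous _ _ _ (D t Ht)).
  - rewrite !Rmult_0_l, !Rplus_0_r, !Rmult_1_l in Hx.
    replace (fst c + (fst z - fst c)) with (fst z) in Hx by ring.
    replace (snd c + (snd z - snd c)) with (snd z) in Hx by ring.
    rewrite <- !surjective_pairing in Hx; lra. }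
apply C_ext.
- apply (Q (fun w => fst (p w))); intros w Hw; destruct (H w Hw) as [H1 _].
  eapply has_grad_eq; [exact H1| |]; simpl; ring.
- apply (Q (fun w => snd (p w))); intros w Hw; destruct (H w Hw) as [_ H2].
  eapply has_grad_eq; [exact H2| |]; simpl; ring.
Qed.

(** Critical points are isolated, so the continuous local inverse [s] is
    holomorphic off the value at a critical point. The singularity is removable,
    and the chain rule gives [p' * s' = 1]. *)
Lemma derivative_neq_0 (p s : C -> C) (V U : C -> Prop) a :
  open V -> open U -> V a -> holo_on V p ->
  (forall z, V z -> U (p z) /\ s (p z) = z) ->
  (forall w, U w -> continuous s w /\ V (s w) /\ p (s w) = w) ->
  cderiv p a <> 0.
Proof.
intros HV HU Ha Hp HsV HsU E0.
set (b := p a).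
assert (Hb : U b) by (apply HsV, Ha).
assert (Hsb : s b = a) by (apply HsV, Ha).
pose proof (open_locally _ _ HV Ha) as L; apply locally_disk in L; destruct L as (r & Hr & L).
assert (Hp' : holo_on (disk a r) (cderiv p)).
{ apply (cderiv_holo _ _ (open_disk a r)); intros z Hz; apply Hp, L, (disk_Cmod a r z Hr), Hz. }
destruct (isolated_zero (cderiv p) a r Hr Hp') as [(rho & Hrho & Z)|(rho & Hrho & Z)].
- assert (Hz : p (fst a + rho / 2, snd a) = p a).
  { apply (constant_of_zero_derivative p a rho).
    - intros w Hw; apply disk_Cmod in Hw; [|lra]; rewrite <- (Z w Hw); apply Hp, L; lra.
    - unfold disk, dist2; simpl; nra. }
  assert (Vz : V (fst a + rho / 2, snd a)).
  { apply L; apply disk_Cmod; [exact Hr|]; unfold disk, dist2; simpl; nra. }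
  pose proof (proj2 (HsV _ Vz)) as E; rewrite Hz in E; fold b in E; rewrite Hsb in E.
  apply (f_equal fst) in E; simpl in E; lra.
- pose proof (open_locally _ _ HU Hb) as LU.
  pose proof (continuous_C_Cmod s b (proj1 (HsU b Hb)) rho (proj1 Hrho)) as LS.
  pose proof (filter_and _ _ LU LS) as LL; apply locally_disk in LL; destruct LL as (e & He & LL).
  assert (Hs : holo_on (disk b e) s).
  { apply (removable_singularity s b e b).
    - intros w Hw; apply disk_Cmod in Hw; [|exact He]; apply HsU, LL, Hw.
    - intros w Hw N; apply disk_Cmod in Hw; [|exact He]; destruct (LL w Hw) as [Uw Sw].
      destruct (HsU w Uw) as (c1 & c2 & c3).
      apply (holo_at_inverse p s w (cderiv p (s w))); auto.
      + apply Z; split; [|rewrite Hsb in Sw; exact Sw].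
        apply Cmod_gt_0, Cminus_neq; intros E; apply N; rewrite <- c3, E; reflexivity.
      + apply filter_imp with (2 := open_locally _ _ HU Uw); intros v Hv; apply HsU, Hv. }
  assert (Hbd : disk b e b) by (apply disk_Cmod; [exact He|rewrite Cmod_minus_self; exact He]).
  assert (Hpa : holo_at p (s b) (cderiv p a)) by (rewrite Hsb; apply Hp, Ha).
  pose proof (holo_at_comp p s b _ _ Hpa (Hs b Hbd)) as K.
  assert (K1 : holo_at (fun w => p (s w)) b 1).
  { apply holo_at_ext_loc with (fun w => w); [|apply holo_at_id].
    apply filter_imp with (2 := LU); intros w Hw; symmetry; apply HsU, Hw. }
  pose proof (holo_at_cderiv _ _ _ K) as E1; rewrite (holo_at_cderiv _ _ _ K1), E0 in E1.
  apply (f_equal fst) in E1; simpl in E1; lra.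
Qed.

(** * Circular means of a function with bounded Laplacian *)

Definition polar (w : C) : C := (fst w * cos (snd w), fst w * sin (snd w)).

Lemma cont_fst (w : C) : continuous (fun w : C => fst w) w.
Proof. apply (has_grad_continuous _ _ _ _ (has_grad_Re w)). Qed.

Lemma cont_snd (w : C) : continuous (fun w : C => snd w) w.
Proof. apply (has_grad_continuous _ _ _ _ (has_grad_Im w)). Qed.

Lemma cont_cos (w : C) : continuous (fun w : C => cos (snd w)) w.
Proof. apply (continuous_comp (fun w : C => snd w) cos); [apply cont_snd|apply Rc_cos]. Qed.

Lemma cont_sin (w : C) : continuous (fun w : C => sin (snd w)) w.
Proof. apply (continuous_comp (fun w : C => snd w) sin); [apply cont_snd|apply Rc_sin]. Qed.

Lemma polar_continuous w : continuous polar w.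
Proof.
pose proof (cont_fst w); pose proof (cont_cos w); pose proof (cont_sin w).
apply continuous_C; unfold polar; simpl; apply cont_mult; assumption.
Qed.

Lemma dist2_polar r t : dist2 0 (polar (r, t)) = r ^ 2.
Proof.
unfold dist2, polar; simpl; pose proof (sin2_cos2 t) as H; unfold Rsqr in H.
transitivity (r ^ 2 * (sin t * sin t + cos t * cos t)); [ring|rewrite H; ring].
Qed.

Lemma polar_unit r t : -1 < r < 1 -> disk 0 1 (polar (r, t)).
Proof. intros H; unfold disk; rewrite dist2_polar; nra. Qed.

Lemma circle_ex (F : C -> R) r :
  (forall t, continuous F (r, t)) -> ex_RInt (fun t => F (r, t)) (- PI) PI.
Proof. intros H; apply ex_RInt_column; intros t _; apply H. Qed.

Lemma is_derive_circle_param (F F' : C -> R) a b r0 :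
  a < r0 < b ->
  (forall r t, a < r < b -> is_derive (fun s => F (s, t)) r (F' (r, t))) ->
  (forall r t, a < r < b -> continuous F (r, t) /\ continuous F' (r, t)) ->
  is_derive (fun r => RInt (fun t => F (r, t)) (- PI) PI) r0 (RInt (fun t => F' (r0, t)) (- PI) PI).
Proof.
intros Hr HD HC.
assert (He : 0 < Rmin (r0 - a) (b - r0)) by (apply Rmin_pos; lra).
assert (Hin : forall r, Rabs (r - r0) < Rmin (r0 - a) (b - r0) -> a < r < b).
{ intros r H; pose proof (Rmin_l (r0 - a) (b - r0)); pose proof (Rmin_r (r0 - a) (b - r0)).
  apply Rabs_def2 in H; lra. }
replace (RInt (fun t => F' (r0, t)) (- PI) PI)
  with (RInt (fun t => Derive (fun s => F (s, t)) r0) (- PI) PI).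
2:{ apply RInt_ext; intros t _; apply is_derive_unique, HD, Hr. }
apply (is_derive_RInt_param (fun r t => F (r, t))).
- exists (mkposreal _ He); intros r H t _; exists (F' (r, t)); apply HD, Hin, H.
- intros t _; apply continuity_2d_pt_ext_loc with (fun u v => F' (u, v)).
  + exists (mkposreal _ He); intros u v Hu _; symmetry; apply is_derive_unique, HD, Hin, Hu.
  + apply (continuous_to_2d F' (r0, t)), HC, Hr.
- exists (mkposreal _ He); intros r H; apply circle_ex; intros t; apply HC, Hin, H.
Qed.

Lemma mean_value_bound (f f' : R -> R) a b M :
  a <= b -> (forall x, a <= x <= b -> is_derive f x (f' x)) ->
  (forall x, a < x < b -> Rabs (f' x) <= M) -> Rabs (f b - f a) <= M * (b - a).
Proof.
intros [Hab| ->] HD HM.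
- destruct (MVT_cor2 f f' a b Hab) as [c [Hc1 Hc2]].
  + intros x Hx; apply is_derive_Reals, HD, Hx.
  + rewrite Hc1, Rabs_mult, (Rabs_pos_eq (b - a)) by lra.
    apply Rmult_le_compat_r; [lra|apply HM, Hc2].
- rewrite !Rminus_diag, Rabs_R0; lra.
Qed.

Lemma RInt_periodic_derivative (f f' : R -> R) :
  (forall t, is_derive f t (f' t)) -> (forall t, continuous f' t) -> f (- PI) = f PI ->
  RInt f' (- PI) PI = 0.
Proof.
intros H1 H2 H3; apply is_RInt_unique.
replace 0 with (minus (f PI) (f (- PI))) by (rewrite H3; unfold minus, plus, opp; simpl; ring).
apply (is_RInt_derive (V := R_CompleteNormedModule)); intros; auto.
Qed.

Lemma RInt_scal_R k (f : R -> R) a b :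
  ex_RInt f a b -> RInt (fun t => k * f t) a b = k * RInt f a b.
Proof. intros H; apply (RInt_scal (V := R_CompleteNormedModule)), H. Qed.

Lemma RInt_plus_R (f g : R -> R) a b :
  ex_RInt f a b -> ex_RInt g a b -> RInt (fun t => f t + g t) a b = RInt f a b + RInt g a b.
Proof. intros; apply (RInt_plus (V := R_CompleteNormedModule)); assumption. Qed.

Lemma RInt_minus_R (f g : R -> R) a b :
  ex_RInt f a b -> ex_RInt g a b -> RInt (fun t => f t - g t) a b = RInt f a b - RInt g a b.
Proof. intros; apply (RInt_minus (V := R_CompleteNormedModule)); assumption. Qed.

Lemma ex_RInt_Rcont (f : R -> R) a b : (forall t, continuous f t) -> ex_RInt f a b.
Proof. intros H; apply (ex_RInt_continuous (V := R_CompleteNormedModule)); intros t _; apply H. Qed.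

Lemma Rc_of_C (F : C -> R) r t : continuous F (r, t) -> continuous (fun t => F (r, t)) t.
Proof. apply continuous_column. Qed.

Section CircularMeans.

Variable U : C -> R.
Hypothesis HU : Ck_on 2 (disk 0 1) U.

Let Ux := partial_x U.
Let Uy := partial_y U.
Let Uxx := partial_x (partial_x U).
Let Uxy := partial_y (partial_x U).
Let Uyx := partial_x (partial_y U).
Let Uyy := partial_y (partial_y U).

Let V w := U (polar w).
Let Vr w := Ux (polar w) * cos (snd w) + Uy (polar w) * sin (snd w).
Let Vrr w := Uxx (polar w) * cos (snd w) ^ 2 + (Uxy (polar w) + Uyx (polar w)) * (cos (snd w) * sin (snd w))
             + Uyy (polar w) * sin (snd w) ^ 2.
Let Vt w := fst w * (Uy (polar w) * cos (snd w) - Ux (polar w) * sin (snd w)).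
Let Vtt w := fst w ^ 2 * (Uxx (polar w) * sin (snd w) ^ 2 - (Uxy (polar w) + Uyx (polar w)) * (cos (snd w) * sin (snd w))
             + Uyy (polar w) * cos (snd w) ^ 2) - fst w * Vr w.

Lemma polar_laplacian w :
  fst w ^ 2 * Vrr w + fst w * Vr w + Vtt w = fst w ^ 2 * laplacian U (polar w).
Proof.
unfold Vrr, Vtt, Vr, laplacian; fold Uxx Uyy.
pose proof (sin2_cos2 (snd w)) as H; unfold Rsqr in H.
transitivity (fst w ^ 2 * ((Uxx (polar w) + Uyy (polar w)) *
  (sin (snd w) * sin (snd w) + cos (snd w) * cos (snd w)))); [ring|rewrite H; ring].
Qed.

Lemma polar_grad (u : C -> R) (a b r t : R) :
  has_grad u (polar (r, t)) a b ->
  is_derive (fun s => u (polar (s, t))) r (a * cos t + b * sin t) /\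
  is_derive (fun s => u (polar (r, s))) t (r * (b * cos t - a * sin t)).
Proof.
intros H; split.
- apply (has_grad_curve u (fun s => s * cos t) (fun s => s * sin t)); [exact H| |];
    auto_derive; trivial; ring.
- replace (r * (b * cos t - a * sin t)) with (a * (r * - sin t) + b * (r * cos t)) by ring.
  apply (has_grad_curve u (fun s => r * cos s) (fun s => r * sin s)); [exact H| |];
    auto_derive; trivial; ring.
Qed.

Lemma polar_second_order (r t : R) : -1 < r < 1 ->
  has_grad U (polar (r, t)) (Ux (polar (r, t))) (Uy (polar (r, t))) /\
  has_grad Ux (polar (r, t)) (Uxx (polar (r, t))) (Uxy (polar (r, t))) /\
  has_grad Uy (polar (r, t)) (Uyx (polar (r, t))) (Uyy (polar (r, t))).
Proof.
intros Hr; apply (C2_second_order (disk 0 1) U (open_disk 0 1) HU), polar_unit, Hr.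
Qed.

Lemma V_r (r t : R) : -1 < r < 1 -> is_derive (fun s => V (s, t)) r (Vr (r, t)).
Proof. intros Hr; apply (polar_grad U); apply (polar_second_order r t Hr). Qed.

Lemma V_t (r t : R) : -1 < r < 1 -> is_derive (fun s => V (r, s)) t (Vt (r, t)).
Proof. intros Hr; apply (polar_grad U); apply (polar_second_order r t Hr). Qed.

Lemma Vr_r (r t : R) : -1 < r < 1 -> is_derive (fun s => Vr (s, t)) r (Vrr (r, t)).
Proof.
intros Hr; destruct (polar_second_order r t Hr) as (_ & g1 & g2).
destruct (polar_grad Ux _ _ r t g1) as [d1 _], (polar_grad Uy _ _ r t g2) as [d2 _].
unfold Vr; simpl snd.
replace (Vrr (r, t)) with
  ((Uxx (polar (r, t)) * cos t + Uxy (polar (r, t)) * sin t) * cos t +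
   (Uyx (polar (r, t)) * cos t + Uyy (polar (r, t)) * sin t) * sin t) by (unfold Vrr; simpl snd; ring).
apply (is_derive_plus (V := R_NormedModule)).
- apply is_derive_ext with (fun s => cos t * Ux (polar (s, t))); [intros; apply Rmult_comm|].
  rewrite (Rmult_comm _ (cos t)); apply (is_derive_scal (fun s => Ux (polar (s, t)))), d1.
- apply is_derive_ext with (fun s => sin t * Uy (polar (s, t))); [intros; apply Rmult_comm|].
  rewrite (Rmult_comm _ (sin t)); apply (is_derive_scal (fun s => Uy (polar (s, t)))), d2.
Qed.

Lemma Rderiv_mult (f g : R -> R) (x l m : R) :
  is_derive f x l -> is_derive g x m -> is_derive (fun s => f s * g s) x (l * g x + f x * m).
Proof. intros Hf Hg; apply (is_derive_mult (K := R_AbsRing) f g x l m Hf Hg), Rmult_comm. Qed.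

Lemma Rderiv_eq (f : R -> R) (x l l' : R) : is_derive f x l -> l = l' -> is_derive f x l'.
Proof. intros H <-; exact H. Qed.

Lemma Rderiv_plus (f g : R -> R) (x l m : R) :
  is_derive f x l -> is_derive g x m -> is_derive (fun s => f s + g s) x (l + m).
Proof. intros; apply (is_derive_plus (V := R_NormedModule)); assumption. Qed.

Lemma Rderiv_minus (f g : R -> R) (x l m : R) :
  is_derive f x l -> is_derive g x m -> is_derive (fun s => f s - g s) x (l - m).
Proof. intros; apply (is_derive_minus (V := R_NormedModule)); assumption. Qed.

Lemma Rderiv_cos (t : R) : is_derive cos t (- sin t).
Proof. apply is_derive_Reals, derivable_pt_lim_cos. Qed.

Lemma Rderiv_sin (t : R) : is_derive sin t (cos t).
Proof. apply is_derive_Reals, derivable_pt_lim_sin. Qed.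

Lemma Rderiv_id (x : R) : is_derive (fun s : R => s) x 1.
Proof. apply @is_derive_id. Qed.

Lemma Rderiv_const (k x : R) : is_derive (fun _ : R => k) x 0.
Proof. apply @is_derive_const. Qed.

Lemma Vt_t (r t : R) : -1 < r < 1 -> is_derive (fun s => Vt (r, s)) t (Vtt (r, t)).
Proof.
intros Hr; destruct (polar_second_order r t Hr) as (_ & g1 & g2).
destruct (polar_grad Ux _ _ r t g1) as [_ d1], (polar_grad Uy _ _ r t g2) as [_ d2].
unfold Vt; simpl fst; simpl snd.
eapply Rderiv_eq.
- apply (Rderiv_mult (fun _ => r)); [apply Rderiv_const|].
  apply Rderiv_minus; apply Rderiv_mult;
    [exact d2|apply Rderiv_cos|exact d1|apply Rderiv_sin].
- unfold Vtt, Vr; simpl fst; simpl snd; change (AbsRing.sort R_AbsRing) with R; cbv beta; ring.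
Qed.

Lemma polar_comp_continuous (u : C -> R) (r t : R) :
  continuous u (polar (r, t)) -> continuous (fun w => u (polar w)) (r, t).
Proof. intros H; apply (continuous_comp polar u); [apply polar_continuous|exact H]. Qed.

Lemma V_continuous (r t : R) : -1 < r < 1 ->
  continuous V (r, t) /\ continuous Vr (r, t) /\ continuous Vrr (r, t) /\
  continuous Vt (r, t) /\ continuous Vtt (r, t).
Proof.
intros Hr; destruct (polar_second_order r t Hr) as (g & g1 & g2).
destruct (C2_continuous_second (disk 0 1) U _ HU (polar_unit r t Hr)) as (c1 & c2 & c3 & c4).
pose proof (polar_comp_continuous _ r t (has_grad_continuous _ _ _ _ g)) as k0.
pose proof (polar_comp_continuous _ r t (has_grad_continuous _ _ _ _ g1)) as k1.
pose proof (polar_comp_continuous _ r t (has_grad_continuous _ _ _ _ g2)) as k2.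
apply polar_comp_continuous in c1, c2, c3, c4; fold Uxx in c1; fold Uxy in c2; fold Uyx in c3; fold Uyy in c4.
pose proof (cont_fst (r, t)); pose proof (cont_cos (r, t)); pose proof (cont_sin (r, t)).
assert (kr : continuous Vr (r, t)) by (unfold Vr; cont_R).
refine (conj k0 (conj kr (conj _ (conj _ _)))); [unfold Vrr|unfold Vt|unfold Vtt]; cont_R.
Qed.

Variable K : R.
Hypothesis HK : forall z, disk 0 1 z -> Rabs (laplacian U z) <= K.

Lemma laplacian_circle_bound r (psi : R -> R) :
  -1 < r < 1 -> (forall t, continuous psi t) -> (forall t, Rabs (psi t) <= 1) ->
  Rabs (RInt (fun t => laplacian U (polar (r, t)) * psi t) (- PI) PI) <= 2 * PI * K.
Proof.
intros Hr Hc Hp; pose proof PI_RGT_0 as P.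
replace (2 * PI * K) with ((PI - - PI) * K) by ring.
apply abs_RInt_le_const; [lra| |].
- apply ex_RInt_Rcont; intros t; apply Rc_mult; [|apply Hc].
  apply (Rc_of_C (fun w => laplacian U (polar w)) r t).
  destruct (C2_continuous_second (disk 0 1) U _ HU (polar_unit r t Hr)) as (c1 & _ & _ & c4).
  apply polar_comp_continuous in c1, c4.
  unfold laplacian; apply cont_plus; assumption.
- intros t _; rewrite Rabs_mult; pose proof (HK _ (polar_unit r t Hr)).
  pose proof (Rabs_pos (laplacian U (polar (r, t)))); pose proof (Rabs_pos (psi t)); pose proof (Hp t); nra.
Qed.

Lemma polar_center t : polar (0, t) = RtoC 0.
Proof. unfold polar, RtoC; simpl; f_equal; ring. Qed.

Lemma polar_PI r : polar (r, - PI) = polar (r, PI).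
Proof. unfold polar; simpl; rewrite cos_neg, sin_neg, sin_PI; f_equal; ring. Qed.

(** Integrated over a circle, the polar form of the Laplacian loses its angular
    term: the integral [I0] satisfies [(r I0')' = r * J], where [J] is the
    integral of the Laplacian over the same circle. *)
Lemma circle_mean r : 0 < r < 1 ->
  Rabs (RInt (fun t => U (polar (r, t))) (- PI) PI - 2 * PI * U 0) <= 2 * PI * K * r ^ 2.
Proof.
intros Hr; pose proof PI_RGT_0 as P.
set (I0 := (fun s => RInt (fun t => V (s, t)) (- PI) PI) : R -> R).
set (I1 := (fun s => RInt (fun t => Vr (s, t)) (- PI) PI) : R -> R).
set (X := (fun s => RInt (fun t => s * Vr (s, t)) (- PI) PI) : R -> R).
assert (D0 : forall s, -1 < s < 1 -> is_derive I0 s (I1 s)).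
{ intros s Hs; apply (is_derive_circle_param V Vr (-1) 1); auto.
  - intros; apply V_r; assumption.
  - intros x t Hx; destruct (V_continuous x t Hx) as (? & ? & _); auto. }
assert (DX : forall s, -1 < s < 1 -> is_derive X s (RInt (fun t => Vr (s, t) + s * Vrr (s, t)) (- PI) PI)).
{ intros s Hs.
  apply (is_derive_circle_param (fun w => fst w * Vr w) (fun w => Vr w + fst w * Vrr w) (-1) 1); auto.
  - intros x t Hx; simpl fst; eapply Rderiv_eq; [apply Rderiv_mult; [apply Rderiv_id|apply Vr_r, Hx]|simpl; ring].
  - intros x t Hx; destruct (V_continuous x t Hx) as (? & ? & ? & _); pose proof (cont_fst (x, t)).
    split; cont_R. }
assert (EX : forall s, -1 < s < 1 -> X s = s * I1 s).
{ intros s Hs; apply RInt_scal_R, circle_ex; intros t; apply (V_continuous s t Hs). }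
assert (BX' : forall s, 0 < s < 1 -> Rabs (RInt (fun t => Vr (s, t) + s * Vrr (s, t)) (- PI) PI) <= 2 * PI * K * s).
{ intros s Hs; assert (Hs1 : -1 < s < 1) by lra.
  assert (Zt : RInt (fun t => Vtt (s, t)) (- PI) PI = 0).
  { apply (RInt_periodic_derivative (fun t => Vt (s, t))).
    - intros t; apply Vt_t, Hs1.
    - intros t; apply (Rc_of_C Vtt), (V_continuous s t Hs1).
    - unfold Vt; simpl fst; simpl snd; rewrite polar_PI, cos_neg, sin_neg, sin_PI; ring. }
  pose proof (laplacian_circle_bound s (fun _ => 1) Hs1 (fun t => Rc_const 1 t)
    (fun t => Req_le _ _ Rabs_R1)) as LB.
  replace (RInt (fun t => Vr (s, t) + s * Vrr (s, t)) (- PI) PI)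
    with (s * RInt (fun t => laplacian U (polar (s, t)) * 1) (- PI) PI).
  - rewrite Rabs_mult, Rabs_pos_eq by lra; nra.
  - assert (CL : forall t, continuous (fun t => laplacian U (polar (s, t)) * 1) t).
    { intros t; apply Rc_mult; [|apply Rc_const].
      apply (Rc_of_C (fun w => laplacian U (polar w)) s t).
      destruct (C2_continuous_second (disk 0 1) U _ HU (polar_unit s t Hs1)) as (c1 & _ & _ & c4).
      apply polar_comp_continuous in c1, c4.
      unfold laplacian; apply cont_plus; assumption. }
    rewrite <- RInt_scal_R by (apply ex_RInt_Rcont; exact CL).
    rewrite <- (Rplus_0_r (RInt (fun t => Vr (s, t) + s * Vrr (s, t)) (- PI) PI)).
    replace 0 with (/ s * RInt (fun t => Vtt (s, t)) (- PI) PI) by (rewrite Zt; ring).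
    rewrite <- RInt_scal_R by (apply circle_ex; intros t; apply (V_continuous s t Hs1)).
    rewrite <- RInt_plus_R.
    + apply RInt_ext; intros t _; pose proof (polar_laplacian (s, t)) as E; simpl fst in E.
      apply Rmult_eq_reg_l with s; [|lra].
      replace (s * (s * (laplacian U (polar (s, t)) * 1))) with (s ^ 2 * laplacian U (polar (s, t))) by ring.
      rewrite <- E; field; lra.
    + apply (circle_ex (fun w => Vr w + fst w * Vrr w) s); intros t.
      destruct (V_continuous s t Hs1) as (? & ? & ? & _); pose proof (cont_fst (s, t)); cont_R.
    + apply (circle_ex (fun w => / s * Vtt w) s); intros t.
      destruct (V_continuous s t Hs1) as (? & ? & ? & ? & ?); pose proof (cont_const (/ s) (s, t)); cont_R. }
assert (X0 : X 0 = 0) by (rewrite EX by lra; ring).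
assert (HK0 : 0 <= K).
{ apply Rle_trans with (2 := HK 0 ltac:(unfold disk, dist2; simpl; lra)), Rabs_pos. }
assert (BX : forall s, 0 < s < 1 -> Rabs (X s) <= 2 * PI * K * s * s).
{ intros s Hs.
  pose proof (mean_value_bound X (fun s => RInt (fun t => Vr (s, t) + s * Vrr (s, t)) (- PI) PI) 0 s
    (2 * PI * K * s) ltac:(lra)) as B.
  rewrite X0, !Rminus_0_r in B; apply B.
  - intros x Hx; apply DX; lra.
  - intros x Hx; apply Rle_trans with (1 := BX' x ltac:(lra)).
    apply Rmult_le_compat_l; [apply Rmult_le_pos; lra|lra]. }
pose proof (mean_value_bound I0 I1 0 r (2 * PI * K * r) ltac:(lra)) as B.
assert (EI : I0 0 = 2 * PI * U 0).
{ unfold I0, V; rewrite (RInt_ext _ (fun _ => U 0)).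
  - rewrite RInt_const; unfold scal; simpl; unfold mult; simpl; ring.
  - intros t _; rewrite polar_center; reflexivity. }
rewrite EI, Rminus_0_r in B; replace (2 * PI * K * r ^ 2) with (2 * PI * K * r * r) by ring.
apply B.
- intros x Hx; apply D0; lra.
- intros x Hx; pose proof (BX x ltac:(lra)) as BB; rewrite EX, Rabs_mult, Rabs_pos_eq in BB by lra.
  assert (Rabs (I1 x) <= 2 * PI * K * x).
  { apply Rmult_le_reg_l with x; lra. }
  apply Rle_trans with (1 := H); apply Rmult_le_compat_l; [apply Rmult_le_pos; lra|lra].
Qed.

Lemma RInt_cos2 : RInt (fun t => cos t * cos t) (- PI) PI = PI.
Proof.
assert (H : is_RInt (fun t => cos t * cos t) (- PI) PI
  (minus ((fun t => (t + sin t * cos t) / 2) PI) ((fun t => (t + sin t * cos t) / 2) (- PI)))).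
{ apply (is_RInt_derive (V := R_CompleteNormedModule) (fun t => (t + sin t * cos t) / 2)).
  - intros t _; auto_derive; trivial; pose proof (sin2_cos2 t) as H; unfold Rsqr in H; lra.
  - intros t _; apply Rc_mult; apply Rc_cos. }
rewrite (is_RInt_unique _ _ _ _ H); unfold minus, plus, opp; simpl; rewrite sin_neg, sin_PI; lra.
Qed.

Lemma RInt_sin_cos : RInt (fun t => sin t * cos t) (- PI) PI = 0.
Proof.
apply (RInt_periodic_derivative (fun t => sin t ^ 2 / 2)).
- intros t; auto_derive; trivial; field.
- intros t; apply Rc_mult; [apply Rc_sin|apply Rc_cos].
- rewrite sin_neg, sin_PI; lra.
Qed.

(** Against [cos], an eigenfunction of the second angular derivative, the polar
    Laplacian becomes an Euler operator, and [I0 / r] is constant up to the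
    contribution of the Laplacian. Its limit at 0 is [PI * U_x(0)]. *)
Lemma circle_first_mode r : 0 < r < 1 ->
  Rabs (RInt (fun t => U (polar (r, t)) * cos t) (- PI) PI - PI * r * partial_x U 0) <= 2 * PI * K * r ^ 2.
Proof.
intros Hr; pose proof PI_RGT_0 as P.
set (I0 := (fun s => RInt (fun t => V (s, t) * cos t) (- PI) PI) : R -> R).
set (I1 := (fun s => RInt (fun t => Vr (s, t) * cos t) (- PI) PI) : R -> R).
set (X := (fun s => RInt (fun t => (s ^ 2 * Vr (s, t) - s * V (s, t)) * cos t) (- PI) PI) : R -> R).
set (X' := (fun s => RInt (fun t => (s * Vr (s, t) + s ^ 2 * Vrr (s, t) - V (s, t)) * cos t) (- PI) PI) : R -> R).
assert (CC : forall s t, -1 < s < 1 ->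
  continuous (fun w => fst w ^ 2) (s, t) /\ continuous (fun w : C => cos (snd w)) (s, t)).
{ intros s t _; split; [apply cont_pow, cont_fst|apply cont_cos]. }
assert (D0 : forall s, -1 < s < 1 -> is_derive I0 s (I1 s)).
{ intros s Hs; apply (is_derive_circle_param (fun w => V w * cos (snd w)) (fun w => Vr w * cos (snd w)) (-1) 1); auto.
  - intros x t Hx; simpl snd; eapply Rderiv_eq;
      [apply (Rderiv_mult (fun s => V (s, t)) (fun _ => cos t)); [apply V_r, Hx|apply Rderiv_const]|simpl; ring].
  - intros x t Hx; destruct (V_continuous x t Hx) as (? & ? & _), (CC x t Hx); split; cont_R. }
assert (DX : forall s, -1 < s < 1 -> is_derive X s (X' s)).
{ intros s Hs.
  apply (is_derive_circle_param (fun w => (fst w ^ 2 * Vr w - fst w * V w) * cos (snd w))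
    (fun w => (fst w * Vr w + fst w ^ 2 * Vrr w - V w) * cos (snd w)) (-1) 1); auto.
  - intros x t Hx; simpl fst; simpl snd; eapply Rderiv_eq.
    + apply (Rderiv_mult (fun s => s ^ 2 * Vr (s, t) - s * V (s, t)) (fun _ => cos t)); [|apply Rderiv_const].
      apply (Rderiv_minus (fun s => s ^ 2 * Vr (s, t)) (fun s => s * V (s, t))).
      1:apply (Rderiv_mult (fun s => s ^ 2) (fun s => Vr (s, t))).
      3:apply (Rderiv_mult (fun s => s) (fun s => V (s, t))).
      * apply (is_derive_pow (fun s => s) 2), Rderiv_id.
      * apply Vr_r, Hx.
      * apply Rderiv_id.
      * apply V_r, Hx.
    + simpl; ring.
  - intros x t Hx; destruct (V_continuous x t Hx) as (? & ? & ? & _), (CC x t Hx).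
    pose proof (cont_fst (x, t)); split; cont_R. }
assert (E1 : forall s, -1 < s < 1 -> ex_RInt (fun t => Vr (s, t) * cos t) (- PI) PI).
{ intros s Hs; apply (circle_ex (fun w => Vr w * cos (snd w)) s); intros t.
  destruct (V_continuous s t Hs) as (? & ? & _), (CC s t Hs); cont_R. }
assert (E0 : forall s, -1 < s < 1 -> ex_RInt (fun t => V (s, t) * cos t) (- PI) PI).
{ intros s Hs; apply (circle_ex (fun w => V w * cos (snd w)) s); intros t.
  destruct (V_continuous s t Hs) as (? & ? & _), (CC s t Hs); cont_R. }
assert (EX : forall s, -1 < s < 1 -> X s = s ^ 2 * I1 s - s * I0 s).
{ intros s Hs; unfold I1, I0; rewrite <- RInt_scal_R, <- (RInt_scal_R s) by auto.
  rewrite <- RInt_minus_R.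
  - apply RInt_ext; intros t _; simpl; ring.
  - apply (ex_RInt_scal (V := R_NormedModule)), E1, Hs.
  - apply (ex_RInt_scal (V := R_NormedModule)), E0, Hs. }
assert (HK0 : 0 <= K).
{ apply Rle_trans with (2 := HK 0 ltac:(unfold disk, dist2; simpl; lra)), Rabs_pos. }
assert (BX' : forall s, 0 < s < 1 -> Rabs (X' s) <= 2 * PI * K * s ^ 2).
{ intros s Hs; assert (Hs1 : -1 < s < 1) by lra.
  assert (Zc : forall t, continuous (fun t => (Vtt (s, t) + V (s, t)) * cos t) t).
  { intros t; apply (Rc_of_C (fun w => (Vtt w + V w) * cos (snd w))).
    destruct (V_continuous s t Hs1) as (? & ? & ? & ? & ?), (CC s t Hs1); cont_R. }
  assert (Zt : RInt (fun t => (Vtt (s, t) + V (s, t)) * cos t) (- PI) PI = 0).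
  { apply (RInt_periodic_derivative (fun t => Vt (s, t) * cos t + V (s, t) * sin t)).
    - intros t; eapply Rderiv_eq.
      + apply Rderiv_plus; apply Rderiv_mult;
          [apply Vt_t, Hs1|apply Rderiv_cos|apply V_t, Hs1|apply Rderiv_sin].
      + simpl; ring.
    - exact Zc.
    - unfold Vt, V; simpl fst; simpl snd; rewrite polar_PI, cos_neg, sin_neg, sin_PI; ring. }
  assert (CL : forall t, continuous (fun t => laplacian U (polar (s, t)) * cos t) t).
  { intros t; apply Rc_mult; [|apply Rc_cos].
    apply (Rc_of_C (fun w => laplacian U (polar w)) s t).
    destruct (C2_continuous_second (disk 0 1) U _ HU (polar_unit s t Hs1)) as (c1 & _ & _ & c4).
    apply polar_comp_continuous in c1, c4.
    unfold laplacian; apply cont_plus; assumption. }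
  assert (HC : forall t, Rabs (cos t) <= 1) by (intros t; apply Rabs_le, COS_bound).
  pose proof (laplacian_circle_bound s cos Hs1 (fun t => Rc_cos t) HC) as LB.
  replace (X' s) with (s ^ 2 * RInt (fun t => laplacian U (polar (s, t)) * cos t) (- PI) PI).
  - rewrite Rabs_mult, Rabs_pos_eq by nra; rewrite (Rmult_comm (2 * PI * K)).
    apply Rmult_le_compat_l; [nra|exact LB].
  - rewrite <- RInt_scal_R by (apply ex_RInt_Rcont; exact CL).
    rewrite <- (Rplus_0_r (X' s)), <- Zt; unfold X'; rewrite <- RInt_plus_R.
    + apply RInt_ext; intros t _; pose proof (polar_laplacian (s, t)) as E; simpl fst in E.
      rewrite <- Rmult_assoc, <- E; match goal with |- ?a = ?b => change (@eq R a b) end; ring.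
    + apply (circle_ex (fun w => (fst w * Vr w + fst w ^ 2 * Vrr w - V w) * cos (snd w)) s); intros t.
      destruct (V_continuous s t Hs1) as (? & ? & ? & _), (CC s t Hs1); pose proof (cont_fst (s, t)); cont_R.
    + apply ex_RInt_Rcont; exact Zc. }
assert (X0 : X 0 = 0) by (rewrite EX by lra; ring).
assert (BX : forall s, 0 < s < 1 -> Rabs (X s) <= 2 * PI * K * s ^ 3).
{ intros s Hs.
  pose proof (mean_value_bound X X' 0 s (2 * PI * K * s ^ 2) ltac:(lra)) as B.
  rewrite X0, !Rminus_0_r in B; replace (2 * PI * K * s ^ 3) with (2 * PI * K * s ^ 2 * s) by ring; apply B.
  - intros x Hx; apply DX; lra.
  - intros x Hx; apply Rle_trans with (1 := BX' x ltac:(lra)).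
    apply Rmult_le_compat_l; [apply Rmult_le_pos; lra|nra]. }
assert (BZ : forall e, 0 < e < r -> Rabs (I0 r / r - I0 e / e) <= 2 * PI * K * r).
{ intros e He.
  apply Rle_trans with (2 * PI * K * (r - e)).
  2:{ apply Rmult_le_compat_l; [apply Rmult_le_pos; lra|lra]. }
  apply (mean_value_bound (fun s => I0 s / s) (fun s => X s / s ^ 3)); [lra| |].
  - intros x Hx; rewrite EX by lra; unfold Rdiv; eapply Rderiv_eq.
    + apply Rderiv_mult; [apply D0; lra|].
      apply (is_derive_inv (fun s => s) x 1); [apply Rderiv_id|lra].
    + simpl; field; lra.
  - intros x Hx; unfold Rdiv; rewrite Rabs_mult, (Rabs_pos_eq (/ x ^ 3)).
    + pose proof (BX x ltac:(lra)); assert (0 < x ^ 3) by (apply pow_lt; lra).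
      apply Rmult_le_reg_r with (x ^ 3); [assumption|].
      rewrite Rmult_assoc, Rinv_l by lra; lra.
    + apply Rlt_le, Rinv_0_lt_compat, pow_lt; lra. }
assert (EI1 : I1 0 = PI * partial_x U 0).
{ unfold I1, Vr; simpl snd.
  rewrite (RInt_ext _ (fun t => partial_x U 0 * (cos t * cos t) + partial_y U 0 * (sin t * cos t))).
  2:{ intros t _; rewrite polar_center; unfold Ux, Uy; simpl; ring. }
  assert (ex_RInt (fun t => cos t * cos t) (- PI) PI).
  { apply ex_RInt_Rcont; intros t; apply Rc_mult; apply Rc_cos. }
  assert (ex_RInt (fun t => sin t * cos t) (- PI) PI).
  { apply ex_RInt_Rcont; intros t; apply Rc_mult; [apply Rc_sin|apply Rc_cos]. }
  rewrite RInt_plus_R, !RInt_scal_R, RInt_cos2, RInt_sin_cos; auto; try ring;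
    apply (ex_RInt_scal (V := R_NormedModule)); assumption. }
assert (EI0 : I0 0 = 0).
{ unfold I0, V; rewrite (RInt_ext _ (fun t => U 0 * cos t)).
  2:{ intros t _; rewrite polar_center; reflexivity. }
  apply (RInt_periodic_derivative (fun t => U 0 * sin t)).
  - intros t; auto_derive; trivial; ring.
  - intros t; apply Rc_mult; [apply Rc_const|apply Rc_cos].
  - rewrite sin_neg, sin_PI; ring. }
assert (Lim : Rabs (I0 r / r - PI * partial_x U 0) <= 2 * PI * K * r).
{ apply le_epsilon; intros eps He.
  pose proof (D0 0 ltac:(lra)) as D; apply is_derive_Reals in D; destruct (D eps He) as [d Hd].
  set (e := Rmin (d / 2) (r / 2)).
  assert (Hd0 := cond_pos d).
  assert (He0 : 0 < e) by (apply Rmin_pos; lra).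
  assert (He1 : e <= d / 2) by apply Rmin_l.
  assert (He2 : e <= r / 2) by apply Rmin_r.
  specialize (Hd e ltac:(lra) ltac:(rewrite Rabs_pos_eq; lra)).
  rewrite Rplus_0_l, EI0, Rminus_0_r, EI1 in Hd.
  pose proof (BZ e ltac:(lra)) as B.
  replace (I0 r / r - PI * partial_x U 0) with ((I0 r / r - I0 e / e) + (I0 e / e - PI * partial_x U 0)) by ring.
  apply Rle_trans with (1 := Rabs_triang _ _); lra. }
change (RInt (fun t => U (polar (r, t)) * cos t) (- PI) PI) with (I0 r).
replace (I0 r - PI * r * partial_x U 0) with (r * (I0 r / r - PI * partial_x U 0)) by (field; lra).
rewrite Rabs_mult, (Rabs_pos_eq r) by lra.
replace (2 * PI * K * r ^ 2) with (r * (2 * PI * K * r)) by ring.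
apply Rmult_le_compat_l; lra.
Qed.

End CircularMeans.

(** * Solutions of Liouville's equation on the unit disk *)

Notation D := (disk 0 1).

(** The logarithm of the hyperbolic density of the disk of radius [r], up to an
    additive constant. *)
Lemma poincare_C2 r : 0 < r ->
  Ck_on 2 (disk 0 r) (fun z => - ln (r ^ 2 - dist2 0 z)) /\
  (forall z, disk 0 r z ->
     laplacian (fun z => - ln (r ^ 2 - dist2 0 z)) z = 4 * r ^ 2 / (r ^ 2 - dist2 0 z) ^ 2).
Proof.
intros Hr; destruct (C2_sqr_norm (disk 0 r) 0 (open_disk 0 r)) as [H1 H2].
destruct (C2_fun (disk 0 r) (fun x => - ln (r ^ 2 - x)) (fun x => / (r ^ 2 - x))
  (fun x => / (r ^ 2 - x) ^ 2) (dist2 0) (open_disk 0 r) H1) as (C1 & _ & C2).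
- intros z Hz; unfold disk in Hz; split; [|split].
  + auto_derive; [lra|field; lra].
  + auto_derive; [lra|field; lra].
  + apply (is_derive_continuous (fun x => / (r ^ 2 - x) ^ 2) _ (2 / (r ^ 2 - dist2 0 z) ^ 3)).
    auto_derive; [apply Rgt_not_eq, Rmult_lt_0_compat; lra|field; lra].
- split; [exact C1|]; intros z Hz; rewrite (C2 z Hz), (H2 z Hz).
  unfold grad_norm_sqr; destruct (has_grad_partial _ _ _ _ (has_grad_dist2 0 z)) as [-> ->].
  unfold disk in Hz; replace ((2 * (fst z - fst (RtoC 0))) ^ 2 + (2 * (snd z - snd (RtoC 0))) ^ 2) with (4 * dist2 0 z)
    by (unfold dist2; ring).
  field; lra.
Qed.

(** [exp l] is a conformal density of curvature -4. *)
Definition liouville (l : C -> R) : Prop :=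
  Ck_on 2 D l /\ forall z, D z -> laplacian l z = 4 * exp (2 * l z).

(** The Ahlfors-Schwarz lemma: compare with the hyperbolic density of a smaller
    disk, which is infinite on the boundary. *)
Lemma ahlfors_disk l r z : liouville l -> 0 < r < 1 -> disk 0 r z ->
  (r ^ 2 - dist2 0 z) * exp (l z) <= r.
Proof.
intros [Hl1 Hl2] Hr Hz.
assert (Sub : forall w, dist2 0 w <= r ^ 2 -> D w) by (intros w Hw; unfold disk; nra).
assert (Cl : forall w, dist2 0 w <= r ^ 2 -> continuous (fun w => (r ^ 2 - dist2 0 w) * exp (l w)) w).
{ intros w Hw; apply cont_mult.
  - apply cont_minus; [apply cont_const|apply dist2_continuous].
  - apply (continuous_comp l exp); [apply (Ck_continuous 2 D); auto|].
    apply (is_derive_continuous exp _ (exp (l w))), is_derive_Reals, derivable_pt_lim_exp. }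
destruct (closed_disk_max (fun w => (r ^ 2 - dist2 0 w) * exp (l w)) 0 r) as (m & Hm1 & Hm2);
  [lra|exact Cl|].
unfold disk in Hz; assert (Hzm := Hm2 z ltac:(lra)).
assert (0 < (r ^ 2 - dist2 0 z) * exp (l z)) by (apply Rmult_lt_0_compat; [lra|apply exp_pos]).
assert (Hm : disk 0 r m).
{ unfold disk; destruct (Req_dec (dist2 0 m) (r ^ 2)) as [E|N]; [rewrite E in Hzm; lra|lra]. }
destruct (poincare_C2 r ltac:(lra)) as [P1 P2].
assert (Hl1' : Ck_on 2 (disk 0 r) l).
{ apply (Ck_on_subset 2 (disk 0 r) D); auto; intros w Hw; apply Sub, Rlt_le, Hw. }
destruct (C2_scal _ (-1) _ (open_disk 0 r) P1) as [Q1 Q2].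
destruct (C2_plus _ _ _ (open_disk 0 r) Hl1' Q1) as [T1 T2].
assert (L : laplacian (fun w => l w + -1 * - ln (r ^ 2 - dist2 0 w)) m <= 0).
{ apply (laplacian_at_max (disk 0 r)); auto; [apply open_disk|].
  apply filter_imp with (2 := open_locally _ _ (open_disk 0 r) Hm).
  intros w Hw; unfold disk in Hw, Hm; pose proof (Hm2 w ltac:(lra)) as B.
  rewrite <- (ln_exp (l w)), <- (ln_exp (l m)).
  replace (-1 * - ln (r ^ 2 - dist2 0 w)) with (ln (r ^ 2 - dist2 0 w)) by ring.
  replace (-1 * - ln (r ^ 2 - dist2 0 m)) with (ln (r ^ 2 - dist2 0 m)) by ring.
  rewrite <- !ln_mult by (try apply exp_pos; lra).
  apply ln_le; [apply Rmult_lt_0_compat; [apply exp_pos|lra]|lra]. }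
rewrite (T2 m Hm), (Q2 m Hm), (P2 m Hm), (Hl2 m (Sub m Hm1)) in L.
apply Rle_trans with (1 := Hzm).
assert (Hp : 0 < r ^ 2 - dist2 0 m) by (unfold disk in Hm; lra).
replace (2 * l m) with (l m + l m) in L by ring; rewrite exp_plus in L.
set (e := exp (l m)) in *; assert (0 < e) by apply exp_pos.
set (q := r ^ 2 - dist2 0 m) in *.
assert (L' : (q * e) ^ 2 <= r ^ 2).
{ assert (E : 4 * r ^ 2 / q ^ 2 * q ^ 2 = 4 * r ^ 2) by (field; lra).
  assert (0 < q ^ 2) by (apply pow_lt; exact Hp).
  assert (4 * (e * e) * q ^ 2 <= 4 * r ^ 2 / q ^ 2 * q ^ 2) by (apply Rmult_le_compat_r; lra).
  nra. }
assert (0 < q * e) by (apply Rmult_lt_0_compat; assumption).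
nra.
Qed.

(* The radius of the comparison disk tends to 1. *)
Lemma ahlfors l z : liouville l -> D z -> (1 - dist2 0 z) * exp (l z) <= 1.
Proof.
intros Hl Hz; apply Rnot_lt_le; intros Hlt.
set (e := exp (l z)) in *; assert (He : 0 < e) by apply exp_pos.
set (d := dist2 0 z) in *; unfold disk in Hz; fold d in Hz.
assert (Hd : 0 <= d).
{ unfold d, dist2; pose proof (pow2_ge_0 (fst z - fst (RtoC 0))); pose proof (pow2_ge_0 (snd z - snd (RtoC 0))); lra. }
(* for [s] close to 1, [(s - d) e > 1 >= sqrt s] *)
set (s := Rmax ((1 + d) / 2) (1 - ((1 - d) * e - 1) / (2 * e))).
assert (Hq : 0 < ((1 - d) * e - 1) / (2 * e)) by (apply Rdiv_lt_0_compat; lra).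
assert (Hs1 : (1 + d) / 2 <= s) by apply Rmax_l.
assert (Hs2 : 1 - ((1 - d) * e - 1) / (2 * e) <= s) by apply Rmax_r.
assert (Hs3 : s < 1) by (apply Rmax_lub_lt; lra).
assert (Hsq : sqrt s ^ 2 = s) by (apply pow2_sqrt; lra).
assert (Hs4 : 0 < sqrt s) by (apply sqrt_lt_R0; lra).
assert (Hs5 : sqrt s < 1) by nra.
assert (K := ahlfors_disk l (sqrt s) z Hl ltac:(lra)).
rewrite Hsq in K; fold d e in K; unfold disk in K; rewrite Hsq in K; fold d in K.
specialize (K ltac:(lra)).
assert (E : ((1 - d) * e - 1) / (2 * e) * e = ((1 - d) * e - 1) / 2) by (field; lra).
nra.
Qed.

(** The logarithm of the ratio of the hyperbolic density of the disk to [exp l]. *)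
Definition defect (l : C -> R) (z : C) : R := - ln (1 ^ 2 - dist2 0 z) + -1 * l z.

Lemma defect_exp l z : D z -> exp (l z) = exp (- defect l z) / (1 - dist2 0 z).
Proof.
intros Hz; unfold disk in Hz; unfold defect.
replace (- (- ln (1 ^ 2 - dist2 0 z) + -1 * l z)) with (ln (1 ^ 2 - dist2 0 z) + l z) by ring.
rewrite exp_plus, exp_ln by lra; rewrite pow1; field; lra.
Qed.

Lemma defect_C2 l : liouville l ->
  Ck_on 2 D (defect l) /\
  (forall z, D z -> laplacian (defect l) z = 4 * / (1 - dist2 0 z) ^ 2 * (1 - exp (- 2 * defect l z))).
Proof.
intros [Hl1 Hl2]; destruct (poincare_C2 1 Rlt_0_1) as [P1 P2].
destruct (C2_scal _ (-1) _ (open_disk 0 1) Hl1) as [Q1 Q2].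
destruct (C2_plus _ _ _ (open_disk 0 1) P1 Q1) as [T1 T2].
split; [exact T1|]; intros z Hz; unfold defect at 1; rewrite (T2 z Hz), (P2 z Hz), (Q2 z Hz), (Hl2 z Hz).
replace (-2 * defect l z) with (- defect l z + - defect l z) by ring.
replace (2 * l z) with (l z + l z) by ring; rewrite !exp_plus, (defect_exp l z Hz).
unfold disk in Hz; rewrite pow1 in *; field; lra.
Qed.

Lemma defect_nonneg l z : liouville l -> D z -> 0 <= defect l z.
Proof.
intros Hl Hz; pose proof (ahlfors l z Hl Hz) as H; unfold disk in Hz; rewrite pow1 in Hz.
rewrite (defect_exp l z) in H by (unfold disk; rewrite pow1; exact Hz).
replace ((1 - dist2 0 z) * (exp (- defect l z) / (1 - dist2 0 z))) with (exp (- defect l z)) in H by (field; lra).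
apply Rnot_lt_le; intros Hn; rewrite <- exp_0 in H.
assert (exp 0 < exp (- defect l z)) by (apply exp_increasing; lra); lra.
Qed.

Lemma Cmod_triangle_disk (z w : C) h : Cmod (w - z) <= h -> Cmod z - h <= Cmod w <= Cmod z + h.
Proof.
intros H; pose proof (Cmod_triangle (w - z) z) as T1; replace (w - z + z)%C with w in T1 by ring.
pose proof (Cmod_triangle (z - w) w) as T2; replace (z - w + w)%C with z in T2 by ring.
replace (z - w)%C with (- (w - z))%C in T2 by ring; rewrite Cmod_opp in T2; lra.
Qed.

(* The distance to the boundary of the disk controls the hyperbolic density. *)
Lemma density_bounds z : D z ->
  1 - Cmod z <= 1 - dist2 0 z <= 2 * (1 - Cmod z) /\ 0 < 1 - Cmod z.
Proof.
intros Hz; apply disk0_Cmod in Hz; [|lra]; rewrite dist2_0_Cmod; pose proof (Cmod_ge_0 z).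
split; nra.
Qed.

Lemma laplacian_nonneg_bound l z : liouville l -> D z ->
  0 <= laplacian (defect l) z <= 4 * / (1 - Cmod z) ^ 2.
Proof.
intros Hl Hz; rewrite (proj2 (defect_C2 l Hl) z Hz); pose proof (defect_nonneg l z Hl Hz) as H0.
destruct (density_bounds z Hz) as [B1 B2].
assert (E : 0 < exp (-2 * defect l z) <= 1).
{ split; [apply exp_pos|]; rewrite <- exp_0.
  destruct (Req_dec (defect l z) 0) as [->|]; [right; f_equal; ring|].
  left; apply exp_increasing; lra. }
assert (0 < / (1 - dist2 0 z) ^ 2) by (apply Rinv_0_lt_compat, pow_lt; lra).
assert (/ (1 - dist2 0 z) ^ 2 <= / (1 - Cmod z) ^ 2).
{ apply Rinv_le_contravar; [apply pow_lt; lra|apply pow_incr; lra]. }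
split; nra.
Qed.

(** The first Fourier mode of a nonnegative function on a circle is at most its
    integral. When the Laplacian is bounded, the former gives the derivative at
    the center and the latter the value at the center, up to bounded errors. *)
Lemma defect_gradient l z c : liouville l -> D z -> Cmod c = 1 ->
  partial_x (defect l) z * fst c + partial_y (defect l) z * snd c
  <= 16 / (1 - Cmod z) * (defect l z + 1).
Proof.
intros Hl Hz Hc; destruct (density_bounds z Hz) as [_ B].
set (h := (1 - Cmod z) / 2); assert (Hh : 0 < h) by (unfold h; lra).
set (q := fun w : C => (z + RtoC h * c * w)%C).
assert (Hq' : forall w, holo_at q w (RtoC h * c)%C) by (intros w; apply holo_at_affine).
assert (Eq' : forall w, cderiv q w = (RtoC h * c)%C) by (intros w; apply holo_at_cderiv, Hq').
assert (Hq : holo_on D q) by (intros w _; rewrite Eq'; apply Hq').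
assert (Nq : forall w, D w -> Cmod (q w - z) <= h).
{ intros w Hw; apply disk0_Cmod in Hw; [|lra]; unfold q.
  replace (z + RtoC h * c * w - z)%C with (RtoC h * c * w)%C by ring.
  rewrite !Cmod_mult, Cmod_R, Rabs_pos_eq, Hc by lra; nra. }
assert (Dq : forall w, D w -> D (q w)).
{ intros w Hw; apply disk0_Cmod; [lra|].
  pose proof (Cmod_triangle_disk z (q w) h (Nq w Hw)); unfold h in *; lra. }
destruct (C2_comp_holo D D (defect l) q (open_disk 0 1) (open_disk 0 1) Hq Dq (proj1 (defect_C2 l Hl)))
  as (U1 & U2 & U3).
set (U := fun w => defect l (q w)) in *.
assert (HK : forall w, D w -> Rabs (laplacian U w) <= 4).
{ intros w Hw; rewrite (U3 w Hw), Eq', Cmod_mult, Cmod_R, Hc, Rmult_1_r, (Rabs_pos_eq h) by lra.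
  destruct (laplacian_nonneg_bound l (q w) Hl (Dq w Hw)) as [L1 L2].
  pose proof (Cmod_triangle_disk z (q w) h (Nq w Hw)) as T.
  assert (Hd : h <= 1 - Cmod (q w)) by (unfold h in *; lra).
  assert (Hi : / (1 - Cmod (q w)) ^ 2 <= / h ^ 2).
  { apply Rinv_le_contravar; [apply pow_lt; lra|apply pow_incr; lra]. }
  assert (Hh2 : 0 < h ^ 2) by (apply pow_lt; lra).
  rewrite Rabs_pos_eq by nra.
  apply Rle_trans with (h ^ 2 * (4 * / h ^ 2)); [nra|right; field; lra]. }
assert (P := PI_RGT_0).
pose proof (circle_mean U U1 4 HK (1 / 2) ltac:(lra)) as M0.
pose proof (circle_first_mode U U1 4 HK (1 / 2) ltac:(lra)) as M1.
assert (D0 : D 0) by (unfold disk, dist2; simpl; lra).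
assert (Eq0 : q 0 = z) by (unfold q; ring).
assert (Cm : forall t, continuous (fun t => U (polar (1 / 2, t))) t).
{ intros t; apply (Rc_of_C (fun w => U (polar w))), polar_comp_continuous.
  apply (Ck_continuous 2 D); [exact U1|apply polar_unit; lra]. }
assert (Cmp : RInt (fun t => U (polar (1 / 2, t)) * cos t) (- PI) PI <= RInt (fun t => U (polar (1 / 2, t))) (- PI) PI).
{ apply RInt_le; [lra| | |].
  - apply ex_RInt_Rcont; intros t; apply Rc_mult; [apply Cm|apply Rc_cos].
  - apply ex_RInt_Rcont; exact Cm.
  - intros t _; pose proof (COS_bound t).
    pose proof (defect_nonneg l _ Hl (Dq _ (polar_unit (1 / 2) t ltac:(lra)))) as N; fold (U (polar (1 / 2, t))) in N.
    nra. }
apply Rabs_le_between in M0; apply Rabs_le_between in M1.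
rewrite (proj1 (U2 0 D0)), Eq', Eq0 in M1.
assert (E0 : U 0 = defect l z) by (unfold U; rewrite Eq0; reflexivity).
rewrite E0 in M0.
set (g := partial_x (defect l) z * fst c + partial_y (defect l) z * snd c).
replace (partial_x (defect l) z * fst (RtoC h * c)%C + partial_y (defect l) z * snd (RtoC h * c)%C)
  with (h * g) in M1 by (unfold g; simpl; ring).
assert (G : h * g <= 8 * (defect l z + 1)).
{ pose proof (defect_nonneg l z Hl Hz).
  apply Rmult_le_reg_l with PI; [exact P|]; nra. }
apply Rmult_le_reg_l with h; [exact Hh|].
replace (h * (16 / (1 - Cmod z) * (defect l z + 1))) with (8 * (defect l z + 1)); [exact G|].
unfold h; field; lra.
Qed.

Definition seg (z w : C) (t : R) : C := (fst z + t * (fst w - fst z), snd z + t * (snd w - snd z)).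

Lemma Cmod_seg z w t : Cmod (seg z w t - z) = Rabs t * Cmod (w - z).
Proof.
replace (seg z w t - z)%C with (RtoC t * (w - z))%C by (apply C_ext; simpl; ring).
rewrite Cmod_mult, Cmod_R; reflexivity.
Qed.

Lemma seg_0 z w : seg z w 0 = z.
Proof. apply C_ext; simpl; ring. Qed.

Lemma seg_1 z w : seg z w 1 = w.
Proof. apply C_ext; simpl; ring. Qed.

Lemma seg_derive z w (t : R) :
  is_derive (fun s => fst (seg z w s)) t (fst w - fst z) /\
  is_derive (fun s => snd (seg z w s)) t (snd w - snd z).
Proof. split; simpl; auto_derive; trivial; ring. Qed.

(** On a disk around [z] of radius comparable to its distance to the boundary,
    the defect cannot have an interior maximum, even after subtracting a small
    multiple of the squared distance to [z]: as long as the defect is not small,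
    its Laplacian is comparable to the squared hyperbolic density. *)
Lemma defect_growth l m0 : liouville l -> 0 < m0 ->
  exists k, 0 < k /\ forall z, D z -> m0 <= defect l z ->
    exists z', Cmod (z' - z) = (1 - Cmod z) / 2 /\ defect l z + k <= defect l z'.
Proof.
intros Hl Hm0.
assert (E0 : exp (-2 * m0) < 1) by (rewrite <- exp_0; apply exp_increasing; lra).
exists ((1 - exp (-2 * m0)) / 72); split; [lra|]; intros z Hz Hm.
set (k := (1 - exp (-2 * m0)) / 72).
assert (Hk : 0 < k) by (unfold k; lra).
destruct (density_bounds z Hz) as [_ B].
set (h := (1 - Cmod z) / 2); assert (Hh : 0 < h) by (unfold h; lra).
assert (Hh2 : 0 < h ^ 2) by (apply pow_lt; exact Hh).
assert (Sub : forall w, dist2 z w <= h ^ 2 -> D w /\ h <= 1 - Cmod w <= 3 * h).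
{ intros w Hw; rewrite dist2_Cmod in Hw.
  assert (Cmod (w - z) <= h) by (pose proof (Cmod_ge_0 (w - z)); nra).
  pose proof (Cmod_triangle_disk z w h H).
  split; [apply disk0_Cmod; [lra|]|]; unfold h in *; lra. }
destruct (defect_C2 l Hl) as [W1 W2].
destruct (C2_sqr_norm D z (open_disk 0 1)) as [V1 V2].
destruct (C2_scal D (- (k / h ^ 2)) _ (open_disk 0 1) V1) as [S1 S2].
destruct (C2_plus D _ _ (open_disk 0 1) W1 S1) as [T1 T2].
set (u := fun w => defect l w + - (k / h ^ 2) * dist2 z w) in *.
destruct (closed_disk_max u z h) as (m & Hm1 & Hm2); [lra| |].
{ intros w Hw; apply (Ck_continuous 2 D); [exact T1|apply Sub, Hw]. }
assert (Uz : u z = defect l z) by (unfold u, dist2; ring).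
assert (Um := Hm2 z ltac:(unfold dist2; nra)); rewrite Uz in Um.
assert (Hkh : 0 < k / h ^ 2) by (apply Rdiv_lt_0_compat; assumption).
assert (Dm : defect l z <= defect l m).
{ unfold u in Um; assert (0 <= dist2 z m).
  { rewrite dist2_Cmod; apply pow2_ge_0. }
  nra. }
destruct (Sub m Hm1) as [Dmm Bm].
assert (Em : dist2 z m = h ^ 2).
{ apply Rle_antisym; [exact Hm1|]; apply Rnot_lt_le; intros Hlt.
  assert (L : laplacian u m <= 0).
  { apply (laplacian_at_max D); auto; [apply open_disk|].
    apply filter_imp with (2 := open_locally _ _ (open_dist2 z (h ^ 2)) Hlt).
    intros w Hw; apply Hm2; lra. }
  rewrite (T2 m Dmm), (S2 m Dmm), (V2 m Dmm), (W2 m Dmm) in L.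
  assert (Ee : exp (-2 * defect l m) <= exp (-2 * m0)).
  { destruct (Req_dec (defect l m) m0) as [->|]; [lra|left; apply exp_increasing; lra]. }
  destruct (density_bounds m Dmm) as [B1 _].
  assert (Hi : / (36 * h ^ 2) <= / (1 - dist2 0 m) ^ 2).
  { apply Rinv_le_contravar; [apply pow_lt; lra|].
    replace (36 * h ^ 2) with ((6 * h) ^ 2) by ring; apply pow_incr; lra. }
  assert (K1 : / (36 * h ^ 2) * (72 * k) <= / (1 - dist2 0 m) ^ 2 * (1 - exp (-2 * defect l m))).
  { apply Rmult_le_compat; [left; apply Rinv_0_lt_compat; lra|lra|exact Hi|unfold k; lra]. }
  replace (/ (36 * h ^ 2) * (72 * k)) with (2 * (k / h ^ 2)) in K1 by (field; lra).
  lra. }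
exists m; split.
- rewrite dist2_Cmod in Em; pose proof (Cmod_ge_0 (m - z)); fold h; nra.
- unfold u in Um; rewrite Em in Um.
  replace (- (k / h ^ 2) * h ^ 2) with (- k) in Um by (field; lra); lra.
Qed.

(** Along a segment whose length is comparable to the distance to the boundary,
    the gradient estimate keeps [w + 1] from dropping by more than a constant
    factor. *)
Lemma defect_segment l z z' t : liouville l -> D z -> Cmod (z' - z) = (1 - Cmod z) / 2 ->
  0 <= t <= 1 ->
  D (seg z z' t) /\ exp (- 16) * (defect l z + 1) <= defect l (seg z z' t) + 1.
Proof.
intros Hl Hz Hd Ht; destruct (density_bounds z Hz) as [_ B].
set (h := (1 - Cmod z) / 2) in *; assert (Hh : 0 < h) by (unfold h; lra).
assert (In : forall s, 0 <= s <= 1 -> D (seg z z' s) /\ h <= 1 - Cmod (seg z z' s)).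
{ intros s Hs.
  assert (N : Cmod (seg z z' s - z) <= h) by (rewrite Cmod_seg, Hd, Rabs_pos_eq by lra; nra).
  pose proof (Cmod_triangle_disk z _ h N).
  split; [apply disk0_Cmod; [lra|]|]; unfold h in *; lra. }
split; [apply In, Ht|].
set (c := (- ((z' - z) / RtoC h))%C).
assert (Hhc : RtoC h <> 0) by (intros E; injection E; lra).
assert (Hc : Cmod c = 1).
{ unfold c; rewrite Cmod_opp, Cmod_div, Cmod_R, Hd, Rabs_pos_eq by (assumption || lra); field; lra. }
assert (Ec : fst z' - fst z = - h * fst c /\ snd z' - snd z = - h * snd c).
{ assert (E : (z' - z = RtoC (- h) * c)%C).
  { unfold c; apply C_ext; simpl; field; lra. }
  split; [apply (f_equal fst) in E|apply (f_equal snd) in E]; simpl in E |- *; lra. }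
destruct (defect_C2 l Hl) as [W1 W2].
set (g' := fun s => partial_x (defect l) (seg z z' s) * (fst z' - fst z) +
                    partial_y (defect l) (seg z z' s) * (snd z' - snd z)).
assert (Dg : forall s, 0 <= s <= 1 -> is_derive (fun s => defect l (seg z z' s)) s (g' s)).
{ intros s Hs; destruct (seg_derive z z' s) as [S1 S2].
  apply (has_grad_curve (defect l) (fun s => fst (seg z z' s)) (fun s => snd (seg z z' s))); auto.
  apply (Ck_on_grad 1 D); [apply open_disk|exact W1|apply In, Hs]. }
assert (Bg : forall s, 0 <= s <= 1 -> - 16 * (defect l (seg z z' s) + 1) <= g' s).
{ intros s Hs; destruct (In s Hs) as [Ds Bs].
  pose proof (defect_gradient l _ c Hl Ds Hc) as G.
  destruct Ec as [E1 E2]; unfold g'; rewrite E1, E2.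
  set (p := partial_x (defect l) (seg z z' s) * fst c + partial_y (defect l) (seg z z' s) * snd c) in *.
  replace (partial_x (defect l) (seg z z' s) * (- h * fst c) + partial_y (defect l) (seg z z' s) * (- h * snd c))
    with (- (h * p)) by (unfold p; ring).
  pose proof (defect_nonneg l _ Hl Ds) as N.
  assert (h * p <= 16 * (defect l (seg z z' s) + 1)); [|lra].
  apply Rle_trans with (h * (16 / (1 - Cmod (seg z z' s)) * (defect l (seg z z' s) + 1))).
  - apply Rmult_le_compat_l; lra.
  - assert (h / (1 - Cmod (seg z z' s)) <= 1).
    { apply Rmult_le_reg_r with (1 - Cmod (seg z z' s)); [lra|].
      unfold Rdiv; rewrite Rmult_assoc, Rinv_l by lra; lra. }
    replace (h * (16 / (1 - Cmod (seg z z' s)) * (defect l (seg z z' s) + 1)))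
      with (16 * (defect l (seg z z' s) + 1) * (h / (1 - Cmod (seg z z' s)))) by (field; lra).
    nra. }
assert (Mono : (defect l z + 1) * exp (16 * 0) <= (defect l (seg z z' t) + 1) * exp (16 * t)).
{ destruct Ht as [[Ht0|Ht0] Ht1].
  2:{ rewrite <- Ht0, seg_0; lra. }
  rewrite <- (seg_0 z z') at 1.
  destruct (MVT_cor2 (fun s => (defect l (seg z z' s) + 1) * exp (16 * s))
    (fun s => (g' s + 16 * (defect l (seg z z' s) + 1)) * exp (16 * s)) 0 t Ht0) as [x [Hx1 Hx2]].
  - intros s Hs; apply is_derive_Reals.
    eapply Rderiv_eq; [apply Rderiv_mult; [apply Rderiv_plus; [apply Dg; lra|apply Rderiv_const]|]|].
    + assert (He : is_derive (fun s => exp (16 * s)) s (16 * exp (16 * s))) by (auto_derive; trivial; ring).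
      exact He.
    + cbv beta; ring.
  - pose proof (Bg x ltac:(lra)); pose proof (exp_pos (16 * x)).
    assert (0 <= (g' x + 16 * (defect l (seg z z' x) + 1)) * exp (16 * x) * (t - 0)).
    { apply Rmult_le_pos; [apply Rmult_le_pos|]; lra. }
    lra. }
rewrite Rmult_0_r, exp_0, Rmult_1_r in Mono.
pose proof (defect_nonneg l _ Hl (proj1 (In t Ht))) as N.
assert (He : exp (16 * t) <= exp 16).
{ destruct (Req_dec t 1) as [->|]; [right; f_equal; ring|left; apply exp_increasing; lra]. }
apply Rmult_le_reg_l with (exp 16); [apply exp_pos|].
rewrite <- Rmult_assoc, <- exp_plus; replace (16 + -16) with 0 by ring; rewrite exp_0.
apply Rle_trans with (1 * (defect l z + 1)); [lra|].
rewrite Rmult_1_l; apply Rle_trans with (1 := Mono); rewrite Rmult_comm.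
apply Rmult_le_compat_r; lra.
Qed.

(** Iterating [defect_growth] makes the defect grow linearly with [n], and the
    density [exp l] is the hyperbolic density of the disk times [exp (- defect)].
    The segments have bounded hyperbolic length, so their lengths for [exp l] are
    dominated by a geometric series. *)
Lemma defect_escape l z0 : liouville l -> D z0 -> 0 < defect l z0 ->
  exists (s : nat -> C) (A q k : R), s 0%nat = z0 /\ 0 < A /\ 0 < q < 1 /\ 0 < k /\
    forall n, D (s n) /\ defect l z0 + INR n * k <= defect l (s n) /\
      forall t, 0 <= t <= 1 -> D (seg (s n) (s (S n)) t) /\
        exp (l (seg (s n) (s (S n)) t)) * Cmod (s (S n) - s n) <= A * q ^ n.
Proof.
intros Hl Hz0 Hp; destruct (defect_growth l _ Hl Hp) as (k & Hk & HG).
set (m0 := defect l z0) in *.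
assert (Ch : forall z, exists z', D z -> m0 <= defect l z ->
  Cmod (z' - z) = (1 - Cmod z) / 2 /\ defect l z + k <= defect l z').
{ intros z; destruct (classic (D z /\ m0 <= defect l z)) as [[H1 H2]|H].
  - destruct (HG z H1 H2) as [z' Hz']; exists z'; auto.
  - exists z; tauto. }
apply functional_choice in Ch; destruct Ch as [f Hf].
set (s := fix s n := match n with O => z0 | S n => f (s n) end).
assert (I : forall n, D (s n) /\ m0 + INR n * k <= defect l (s n)).
{ induction n as [|n [I1 I2]]; [split; [exact Hz0|simpl; fold m0; lra]|].
  assert (m0 <= defect l (s n)) by (pose proof (pos_INR n); nra).
  destruct (Hf (s n) I1 H) as [E1 E2]; rewrite S_INR; change (s (S n)) with (f (s n)); split; [|lra].
  rewrite <- (seg_1 (s n) (f (s n))); apply (defect_segment l (s n) (f (s n)) 1 Hl I1 E1); lra. }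
set (c := exp (- 16)); assert (Hc : 0 < c) by apply exp_pos.
exists s, (exp 1), (exp (- (c * k))), k; split; [reflexivity|split; [apply exp_pos|split; [split; [apply exp_pos|]|split; [exact Hk|]]]].
{ rewrite <- exp_0; apply exp_increasing; nra. }
intros n; destruct (I n) as [I1 I2]; split; [exact I1|split; [exact I2|]]; intros t Ht.
assert (H : m0 <= defect l (s n)) by (pose proof (pos_INR n); nra).
destruct (Hf (s n) I1 H) as [E1 _]; change (s (S n)) with (f (s n)).
destruct (defect_segment l (s n) (f (s n)) t Hl I1 E1 Ht) as [S1 S2]; split; [exact S1|].
destruct (density_bounds (s n) I1) as [_ B].
set (h := (1 - Cmod (s n)) / 2) in *; assert (Hh : 0 < h) by (unfold h; lra).
assert (N : Cmod (seg (s n) (f (s n)) t - s n) <= h) by (rewrite Cmod_seg, E1, Rabs_pos_eq by lra; nra).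
pose proof (Cmod_triangle_disk _ _ h N) as T.
destruct (density_bounds _ S1) as [B1 _].
rewrite (defect_exp l _ S1), E1.
assert (Q : h / (1 - dist2 0 (seg (s n) (f (s n)) t)) <= 1).
{ assert (h <= 1 - dist2 0 (seg (s n) (f (s n)) t)) by (unfold h in *; lra).
  apply Rmult_le_reg_r with (1 - dist2 0 (seg (s n) (f (s n)) t)); [lra|].
  unfold Rdiv; rewrite Rmult_assoc, Rinv_l by lra; lra. }
replace (exp (- defect l (seg (s n) (f (s n)) t)) / (1 - dist2 0 (seg (s n) (f (s n)) t)) * h)
  with (exp (- defect l (seg (s n) (f (s n)) t)) * (h / (1 - dist2 0 (seg (s n) (f (s n)) t))))
  by (field; unfold h in *; lra).
apply Rle_trans with (exp (- defect l (seg (s n) (f (s n)) t))).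
{ rewrite <- (Rmult_1_r (exp _)) at 2; apply Rmult_le_compat_l; [left; apply exp_pos|exact Q]. }
assert (Pw : forall x j, exp x ^ j = exp (x * INR j)).
{ intros x j; induction j as [|j IH]; [simpl; rewrite Rmult_0_r, exp_0; reflexivity|].
  rewrite S_INR; simpl; rewrite IH, <- exp_plus; f_equal; ring. }
rewrite Pw, <- exp_plus; fold c in S2.
assert (- defect l (seg (s n) (f (s n)) t) <= 1 + - (c * k) * INR n).
{ assert (0 < m0) by exact Hp; assert (c * (INR n * k) <= c * (defect l (s n) + 1)) by (apply Rmult_le_compat_l; lra).
  lra. }
destruct H0 as [H0|H0]; [left; apply exp_increasing, H0|right; f_equal; exact H0].
Qed.

(** * Lengths of curves *)

(** Arcs are only regular on [0, 1]; composing with the retraction onto this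
    interval makes their speed continuous on the line. *)
Definition clamp (t : R) : R := Rmax 0 (Rmin 1 t).

Lemma clamp_range t : 0 <= clamp t <= 1.
Proof. unfold clamp, Rmax, Rmin; destruct (Rle_dec 1 t); destruct (Rle_dec 0 _); lra. Qed.

Lemma clamp_id t : 0 <= t <= 1 -> clamp t = t.
Proof. intros H; unfold clamp, Rmax, Rmin; destruct (Rle_dec 1 t); destruct (Rle_dec 0 _); lra. Qed.

Lemma clamp_lipschitz s t : Rabs (clamp s - clamp t) <= Rabs (s - t).
Proof.
unfold clamp, Rmax, Rmin, Rabs; destruct (Rle_dec 1 t); destruct (Rle_dec 1 s);
  repeat destruct (Rle_dec 0 _); repeat destruct (Rcase_abs _); lra.
Qed.

Lemma clamp_continuous (t : R) : continuous clamp t.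
Proof.
intros P [e He]; exists e; intros s Hs; apply He.
apply Rle_lt_trans with (2 := Hs), clamp_lipschitz.
Qed.

Lemma continuous_R2 (f g : R -> R) (t : R) :
  continuous f t -> continuous g t -> continuous (fun s => (f s, g s) : C) t.
Proof.
intros Hf Hg; apply (continuous_comp_2 f g (fun a b => (a, b) : C)); auto.
apply continuous_ext with (fun w : C => w); [intros [a b]; reflexivity|apply continuous_id].
Qed.

Lemma continuous_Cmod_R (f g : R -> R) t :
  continuous f t -> continuous g t -> continuous (fun s => Cmod (f s, g s)) t.
Proof.
intros Hf Hg; unfold Cmod; simpl.
apply (continuous_comp (fun s => f s * (f s * 1) + g s * (g s * 1)) sqrt); [|apply continuous_sqrt].
apply Rc_plus; repeat apply Rc_mult; auto; apply Rc_const.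
Qed.

Definition nonneg_continuous_on (X : C -> Prop) (lam : C -> R) : Prop :=
  forall z, X z -> 0 <= lam z /\ continuous lam z.

Definition speed (lam : C -> R) (g : R -> C) (t : R) : R :=
  lam (g t) * Cmod (Derive (fun s => Re (g s)) t, Derive (fun s => Im (g s)) t).

Lemma speed_nonneg X lam g t : nonneg_continuous_on X lam -> X (g t) -> 0 <= speed lam g t.
Proof. intros H Hx; apply Rmult_le_pos; [apply H, Hx|apply Cmod_ge_0]. Qed.

Lemma speed_continuous X lam g t :
  nonneg_continuous_on X lam -> C1_arc X g -> 0 <= t <= 1 -> continuous (speed lam g) t.
Proof.
intros Hlam Hg Ht; destruct (Hg t Ht) as (Hx & [a Ha] & [b Hb] & H3 & H4); unfold speed.
apply Rc_mult; [|apply continuous_Cmod_R; assumption].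
apply (continuous_comp g lam); [|apply (Hlam _ Hx)].
apply continuous_ext with (fun s => (Re (g s), Im (g s)) : C).
{ intros s; symmetry; apply surjective_pairing. }
apply continuous_R2; [apply (is_derive_continuous _ _ _ Ha)|apply (is_derive_continuous _ _ _ Hb)].
Qed.

Lemma speed_ex_RInt X lam g : nonneg_continuous_on X lam -> C1_arc X g -> ex_RInt (speed lam g) 0 1.
Proof.
intros Hlam Hg; apply (ex_RInt_continuous (V := R_CompleteNormedModule)).
rewrite Rmin_left, Rmax_right by lra; intros t Ht; apply (speed_continuous X); assumption.
Qed.

Lemma arc_length_nonneg X lam g :
  nonneg_continuous_on X lam -> C1_arc X g -> 0 <= arc_length lam g.
Proof.
intros Hlam Hg; apply (RInt_ge_0 (speed lam g)); [lra|apply (speed_ex_RInt X); assumption|].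
intros t Ht; apply (speed_nonneg X lam g t Hlam), Hg; lra.
Qed.

Lemma path_length_nonneg X lam z w l :
  nonneg_continuous_on X lam -> path_of_length X lam z w l -> 0 <= l.
Proof.
intros Hlam H; induction H as [|g w l Hg _ IH]; [lra|].
pose proof (arc_length_nonneg X lam g Hlam Hg); lra.
Qed.

Definition gradient_bound (X : C -> Prop) (lam : C -> R) (K : R) (b : C -> R) : Prop :=
  forall z, X z -> exists b1 b2, has_grad b z b1 b2 /\ b1 ^ 2 + b2 ^ 2 <= (K * lam z) ^ 2.

Lemma cauchy_schwarz_R2 a b x y M :
  0 <= M -> a ^ 2 + b ^ 2 <= M ^ 2 -> Rabs (a * x + b * y) <= M * Cmod (x, y).
Proof.
intros HM H; apply sqr_le_Rabs; [apply Rmult_le_pos; [exact HM|apply Cmod_ge_0]|].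
rewrite Rpow_mult_distr, Cmod_sqr; simpl fst; simpl snd.
apply Rle_trans with ((a ^ 2 + b ^ 2) * (x ^ 2 + y ^ 2)).
- pose proof (pow2_ge_0 (a * y - b * x)); lra.
- apply Rmult_le_compat_r; [pose proof (pow2_ge_0 x); pose proof (pow2_ge_0 y); lra|exact H].
Qed.

(** The functions [K * length - b] and [K * length + b] are monotone along the
    arc. *)
Lemma gradient_bound_arc X lam K b g :
  nonneg_continuous_on X lam -> 0 <= K -> gradient_bound X lam K b -> C1_arc X g ->
  Rabs (b (g 1) - b (g 0)) <= K * arc_length lam g.
Proof.
intros Hlam HK Hb Hg.
set (s := fun t => speed lam g (clamp t)).
assert (Hs : forall t, continuous s t).
{ intros t; apply (continuous_comp clamp (speed lam g)); [apply clamp_continuous|].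
  apply (speed_continuous X); auto; apply clamp_range. }
set (L := fun t => RInt s 0 t).
assert (DL : forall t, is_derive L t (s t)).
{ intros t; apply (is_derive_RInt (V := R_NormedModule) s L 0 t); [|apply Hs].
  apply filter_forall; intros u; apply (RInt_correct s), ex_RInt_Rcont, Hs. }
assert (L0 : L 0 = 0) by (unfold L; rewrite RInt_point; reflexivity).
assert (L1 : L 1 = arc_length lam g).
{ apply RInt_ext; rewrite Rmin_left, Rmax_right by lra; intros t Ht; unfold s.
  rewrite clamp_id by lra; reflexivity. }
assert (Q : forall sg, sg = 1 \/ sg = -1 -> sg * (b (g 1) - b (g 0)) <= K * arc_length lam g).
{ intros sg Hsg.
  assert (DB : forall t, 0 <= t <= 1 -> exists d, is_derive (fun t => b (g t)) t d /\ Rabs d <= K * s t).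
  { intros t Ht; destruct (Hg t Ht) as (Hx & [x' Hx'] & [y' Hy'] & _).
    destruct (Hb _ Hx) as (b1 & b2 & Gb & Bb).
    exists (b1 * x' + b2 * y'); split.
    - apply is_derive_ext with (fun t => b (Re (g t), Im (g t))).
      { intros u; f_equal; symmetry; apply surjective_pairing. }
      apply (has_grad_curve b (fun t => Re (g t)) (fun t => Im (g t))); [|exact Hx'|exact Hy'].
      unfold Re, Im; rewrite <- surjective_pairing; exact Gb.
    - unfold s, speed; rewrite clamp_id by exact Ht.
      replace (Derive (fun s => Re (g s)) t) with x' by (symmetry; apply is_derive_unique, Hx').
      replace (Derive (fun s => Im (g s)) t) with y' by (symmetry; apply is_derive_unique, Hy').
      rewrite <- Rmult_assoc.
      apply cauchy_schwarz_R2; [apply Rmult_le_pos; [exact HK|apply Hlam, Hx]|exact Bb]. }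
  assert (Ch : exists d : R -> R, forall t, 0 <= t <= 1 -> is_derive (fun t => b (g t)) t (d t) /\ Rabs (d t) <= K * s t).
  { apply (functional_choice (fun t d => 0 <= t <= 1 -> is_derive (fun t => b (g t)) t d /\ Rabs d <= K * s t)).
    intros t; destruct (classic (0 <= t <= 1)) as [Ht|Ht]; [destruct (DB t Ht) as [d Hd]; exists d; auto|exists 0; tauto]. }
  destruct Ch as [d Hd].
  destruct (MVT_cor2 (fun t => K * L t - sg * b (g t)) (fun t => K * s t - sg * d t) 0 1 Rlt_0_1) as [c [Hc1 Hc2]].
  - intros t Ht; apply is_derive_Reals, Rderiv_minus;
      [apply (is_derive_scal L t K), DL|apply (is_derive_scal (fun t => b (g t)) t sg), (Hd t Ht)].
  - destruct (Hd c ltac:(lra)) as [_ B]; apply Rabs_le_between in B.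
    rewrite L0, L1 in Hc1; destruct Hsg as [-> | ->]; lra. }
pose proof (Q 1 ltac:(auto)); pose proof (Q (-1) ltac:(auto)); apply Rabs_le; lra.
Qed.

Lemma gradient_bound_path X lam K b z w l :
  nonneg_continuous_on X lam -> 0 <= K -> gradient_bound X lam K b ->
  path_of_length X lam z w l -> Rabs (b w - b z) <= K * l.
Proof.
intros Hlam HK Hb H; induction H as [z Hz|g w l Hg _ IH].
- rewrite Rminus_diag, Rabs_R0; lra.
- pose proof (gradient_bound_arc X lam K b g Hlam HK Hb Hg).
  replace (b w - b (g 0)) with ((b w - b (g 1)) + (b (g 1) - b (g 0))) by ring.
  apply Rle_trans with (1 := Rabs_triang _ _); lra.
Qed.

Lemma path_length_glb X lam z w :
  nonneg_continuous_on X lam -> (exists l, path_of_length X lam z w l) ->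
  is_glb_Rbar (path_of_length X lam z w) (metric_dist X lam z w).
Proof.
intros Hlam [l Hl]; unfold metric_dist.
pose proof (Glb_Rbar_correct (path_of_length X lam z w)) as [G1 G2].
pose proof (G1 l Hl) as G3.
assert (G4 : Rbar_le 0 (Glb_Rbar (path_of_length X lam z w))).
{ apply G2; intros x Hx; apply (path_length_nonneg X lam z w x Hlam Hx). }
destruct (Glb_Rbar (path_of_length X lam z w)) as [r| |]; simpl in *; [split; auto|contradiction|contradiction].
Qed.

Lemma metric_dist_le X lam z w l :
  nonneg_continuous_on X lam -> path_of_length X lam z w l -> metric_dist X lam z w <= l.
Proof.
intros Hlam Hl; apply (proj1 (path_length_glb X lam z w Hlam (ex_intro _ l Hl)) l Hl).
Qed.

Lemma metric_dist_ge X lam z w c :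
  nonneg_continuous_on X lam -> (exists l, path_of_length X lam z w l) ->
  (forall l, path_of_length X lam z w l -> c <= l) -> c <= metric_dist X lam z w.
Proof.
intros Hlam He H; apply (proj2 (path_length_glb X lam z w Hlam He) c); intros l Hl; apply H, Hl.
Qed.

Lemma metric_dist_approx X lam z w c :
  nonneg_continuous_on X lam -> (exists l, path_of_length X lam z w l) ->
  metric_dist X lam z w < c -> exists l, path_of_length X lam z w l /\ l < c.
Proof.
intros Hlam He Hc; apply NNPP; intros N.
assert (c <= metric_dist X lam z w); [|lra].
apply metric_dist_ge; auto; intros l Hl; apply Rnot_lt_le; intros Hlt; apply N; exists l; auto.
Qed.

(** ** Images of segments *)

Lemma seg_continuous z w (t : R) : continuous (seg z w) t.
Proof.
apply continuous_R2; [apply (is_derive_continuous _ _ (fst w - fst z))|apply (is_derive_continuous _ _ (snd w - snd z))];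
  apply seg_derive.
Qed.

Lemma seg_locally (X : C -> Prop) z w (t : R) :
  open X -> X (seg z w t) -> locally t (fun s => X (seg z w s)).
Proof. intros HX Hx; apply (seg_continuous z w t X), HX, Hx. Qed.

Lemma holo_seg p z w (t : R) d : holo_at p (seg z w t) d ->
  is_derive (fun s => fst (p (seg z w s))) t (fst (d * (w - z))%C) /\
  is_derive (fun s => snd (p (seg z w s))) t (snd (d * (w - z))%C).
Proof.
intros [H1 H2]; destruct (seg_derive z w t) as [S1 S2]; split.
- replace (fst (d * (w - z))%C) with (fst d * (fst w - fst z) + - snd d * (snd w - snd z)) by (simpl; ring).
  apply (has_grad_curve (fun w => fst (p w)) (fun s => fst (seg z w s)) (fun s => snd (seg z w s))); auto.
- replace (snd (d * (w - z))%C) with (snd d * (fst w - fst z) + fst d * (snd w - snd z)) by (simpl; ring).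
  apply (has_grad_curve (fun w => snd (p w)) (fun s => fst (seg z w s)) (fun s => snd (seg z w s))); auto.
Qed.

Lemma holo_segment_arc (X Y : C -> Prop) (lam : C -> R) (p : C -> C) z w M :
  open X -> holo_on X p -> (forall v, X v -> Y (p v)) -> nonneg_continuous_on Y lam ->
  (forall t, 0 <= t <= 1 -> X (seg z w t) /\
     lam (p (seg z w t)) * Cmod (cderiv p (seg z w t)) * Cmod (w - z) <= M) ->
  C1_arc Y (fun t => p (seg z w t)) /\ arc_length lam (fun t => p (seg z w t)) <= M.
Proof.
intros HX Hp HXY Hlam HM.
pose proof (cderiv_holo X p HX Hp) as Hp'.
assert (Dd : forall t, X (seg z w t) ->
  is_derive (fun s => Re (p (seg z w s))) t (fst (cderiv p (seg z w t) * (w - z))%C) /\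
  is_derive (fun s => Im (p (seg z w s))) t (snd (cderiv p (seg z w t) * (w - z))%C)).
{ intros t Ht; apply holo_seg, Hp, Ht. }
assert (Cd : forall t, X (seg z w t) ->
  continuous (fun s => fst (cderiv p (seg z w s) * (w - z))%C) t /\
  continuous (fun s => snd (cderiv p (seg z w s) * (w - z))%C) t).
{ intros t Ht; destruct (holo_seg (cderiv p) z w t _ (Hp' _ Ht)) as [H1 H2].
  pose proof (is_derive_continuous _ _ _ H1) as K1; pose proof (is_derive_continuous _ _ _ H2) as K2.
  split; simpl; [apply Rc_minus|apply Rc_plus]; apply Rc_mult; auto; apply Rc_const. }
assert (Arc : C1_arc Y (fun t => p (seg z w t))).
{ intros t Ht; destruct (HM t Ht) as [Hx _]; destruct (Dd t Hx) as [D1 D2]; destruct (Cd t Hx) as [C1 C2].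
  split; [apply HXY, Hx|split; [eexists; exact D1|split; [eexists; exact D2|split]]].
  - apply continuous_ext_loc with (2 := C1).
    apply filter_imp with (2 := seg_locally X z w t HX Hx); intros s Hs.
    symmetry; apply is_derive_unique, Dd, Hs.
  - apply continuous_ext_loc with (2 := C2).
    apply filter_imp with (2 := seg_locally X z w t HX Hx); intros s Hs.
    symmetry; apply is_derive_unique, Dd, Hs. }
split; [exact Arc|].
apply Rle_trans with (1 := Rle_abs _).
replace M with ((1 - 0) * M) by ring.
apply (abs_RInt_le_const (speed lam (fun t => p (seg z w t)))); [lra|apply (speed_ex_RInt Y); assumption|].
intros t Ht; destruct (HM t Ht) as [Hx B]; destruct (Dd t Hx) as [D1 D2].
rewrite Rabs_pos_eq by (apply (speed_nonneg Y); auto).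
unfold speed.
replace (Derive (fun s => Re (p (seg z w s))) t) with (fst (cderiv p (seg z w t) * (w - z))%C)
  by (symmetry; apply is_derive_unique, D1).
replace (Derive (fun s => Im (p (seg z w s))) t) with (snd (cderiv p (seg z w t) * (w - z))%C)
  by (symmetry; apply is_derive_unique, D2).
rewrite <- surjective_pairing, Cmod_mult, <- Rmult_assoc; exact B.
Qed.

Lemma holo_on_id X : holo_on X (fun w => w).
Proof. apply holo_on_intro; intros z _; exists (RtoC 1); apply holo_at_id. Qed.

Lemma cderiv_id z : cderiv (fun w => w) z = 1.
Proof. apply holo_at_cderiv, holo_at_id. Qed.

Lemma segment_arc (Y : C -> Prop) (lam : C -> R) z w M :
  open Y -> nonneg_continuous_on Y lam ->
  (forall t, 0 <= t <= 1 -> Y (seg z w t) /\ lam (seg z w t) * Cmod (w - z) <= M) ->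
  C1_arc Y (seg z w) /\ arc_length lam (seg z w) <= M.
Proof.
intros HY Hlam HM.
apply (holo_segment_arc Y Y lam (fun v => v) z w M HY (holo_on_id Y)); auto.
intros t Ht; destruct (HM t Ht) as [H1 H2]; split; [exact H1|].
rewrite cderiv_id, Cmod_1, Rmult_1_r; exact H2.
Qed.

Lemma segment_is_arc (Y : C -> Prop) z w :
  open Y -> (forall t, 0 <= t <= 1 -> Y (seg z w t)) -> C1_arc Y (seg z w).
Proof.
intros HY H; apply (segment_arc Y (fun _ => 0) z w 0 HY).
- intros v _; split; [lra|apply cont_const].
- intros t Ht; split; [apply H, Ht|lra].
Qed.

(** The points that can be joined to [w] form an open set, and so do those that
    cannot: small disks contain segments. *)
Lemma path_exists (Y : C -> Prop) lam z w :
  plane_domain Y -> Y z -> Y w -> exists l, path_of_length Y lam z w l.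
Proof.
intros (HY & HC & _) Hz Hw.
set (U := fun v => Y v /\ exists l, path_of_length Y lam v w l).
set (V := fun v => Y v /\ ~ exists l, path_of_length Y lam v w l).
assert (Near : forall v, Y v -> locally v (fun v' => Y v' /\
  ((exists l, path_of_length Y lam v w l) <-> exists l, path_of_length Y lam v' w l))).
{ intros v Hv; pose proof (open_locally _ _ HY Hv) as L; apply locally_disk in L; destruct L as (r & Hr & L).
  apply locally_disk; exists r; split; [exact Hr|]; intros v' Hv'; split; [apply L, Hv'|].
  assert (N : Cmod (v - v') = Cmod (v' - v)).
  { replace (v - v')%C with (- (v' - v))%C by ring; apply Cmod_opp. }
  assert (A1 : C1_arc Y (seg v v')).
  { apply segment_is_arc; [exact HY|]; intros t Ht; apply L; rewrite Cmod_seg, Rabs_pos_eq by lra.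
    pose proof (Cmod_ge_0 (v' - v)); nra. }
  assert (A2 : C1_arc Y (seg v' v)).
  { apply segment_is_arc; [exact HY|]; intros t Ht; apply L.
    replace (seg v' v t - v)%C with (RtoC (1 - t) * (v' - v))%C by (apply C_ext; simpl; ring).
    rewrite Cmod_mult, Cmod_R, Rabs_pos_eq by lra; pose proof (Cmod_ge_0 (v' - v)); nra. }
  split; intros [l Hl].
  - exists (arc_length lam (seg v' v) + l); rewrite <- (seg_0 v' v) at 1.
    apply path_cons; [exact A2|rewrite seg_1; exact Hl].
  - exists (arc_length lam (seg v v') + l); rewrite <- (seg_0 v v') at 1.
    apply path_cons; [exact A1|rewrite seg_1; exact Hl]. }
apply NNPP; intros N; apply (HC U V).
- intros v [Hv Hl]; apply filter_imp with (2 := Near v Hv); intros v' [Yv' E]; split; [exact Yv'|apply E, Hl].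
- intros v [Hv Hl]; apply filter_imp with (2 := Near v Hv); intros v' [Yv' E]; split; [exact Yv'|].
  intros H; apply Hl, E, H.
- intros v Hv; destruct (classic (exists l, path_of_length Y lam v w l)); [left|right]; split; assumption.
- intros v _ [_ H1] [_ H2]; exact (H2 H1).
- exists w; split; [exact Hw|split; [exact Hw|exists 0; apply path_nil, Hw]].
- exists z; split; [exact Hz|split; [exact Hz|exact N]].
Qed.

(** * Complete metrics of curvature -4 *)

Lemma Rmax_sqr_derive x : is_derive (fun x => Rmax 0 x ^ 2) x (2 * Rmax 0 x).
Proof.
apply is_derive_Reals; intros eps He; exists (mkposreal _ He); simpl; intros h Hh Hb.
assert (Q : forall a, Rabs a <= h ^ 2 -> Rabs (a / h) < eps).
{ intros a Ha; unfold Rdiv; rewrite Rabs_mult, Rabs_inv.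
  assert (0 < Rabs h) by (apply Rabs_pos_lt, Hh).
  apply Rmult_lt_reg_r with (Rabs h); [assumption|].
  rewrite Rmult_assoc, Rinv_l by lra.
  assert (h ^ 2 = Rabs h * Rabs h) by (rewrite <- Rabs_mult, Rabs_pos_eq; nra); nra. }
match goal with |- Rabs (?a / h - ?b) < _ => replace (a / h - b) with ((a - b * h) / h) by (field; exact Hh) end.
apply Q, Rabs_le; unfold Rmax; destruct (Rle_dec 0 (x + h)); destruct (Rle_dec 0 x); nra.
Qed.

(** A cutoff function supported in a small disk around [c] is Lipschitz for the
    metric, so it stays positive along a short curve that ends at [c]; this
    replaces the consideration of exit times. *)
Lemma short_path_close Y lam c d :
  open Y -> nonneg_continuous_on Y lam -> Y c -> 0 < lam c -> 0 < d ->
  exists eps, 0 < eps /\ forall y l, path_of_length Y lam y c l -> l < eps -> Cmod (y - c) < d.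
Proof.
intros HY Hlam Hc Hpos Hd.
pose proof (continuous_gt lam c (lam c / 2) (proj2 (Hlam c Hc)) ltac:(lra)) as L.
apply locally_disk in L; destruct L as (r & Hr & L).
set (e := Rmin d r); assert (He : 0 < e) by (apply Rmin_pos; assumption).
assert (e <= d) by apply Rmin_l; assert (e <= r) by apply Rmin_r.
set (b := fun y => Rmax 0 (e ^ 2 - dist2 c y) ^ 2).
assert (Gb : forall y, has_grad b y (- (4 * Rmax 0 (e ^ 2 - dist2 c y)) * (fst y - fst c))
                                    (- (4 * Rmax 0 (e ^ 2 - dist2 c y)) * (snd y - snd c))).
{ intros y; eapply has_grad_eq.
  - apply (has_grad_fun (fun x => Rmax 0 x ^ 2) (fun y => e ^ 2 - dist2 c y)); [apply Rmax_sqr_derive|].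
    apply has_grad_minus; [apply has_grad_const|apply has_grad_dist2].
  - ring.
  - ring. }
assert (Hc2 : 0 < lam c / 2) by lra.
assert (GB : gradient_bound Y lam (4 * e ^ 3 / (lam c / 2)) b).
{ intros y Hy; eexists; eexists; split; [apply Gb|].
  set (M := Rmax 0 (e ^ 2 - dist2 c y)).
  replace ((- (4 * M) * (fst y - fst c)) ^ 2 + (- (4 * M) * (snd y - snd c)) ^ 2)
    with (16 * M ^ 2 * dist2 c y) by (unfold dist2; ring).
  assert (D0 : 0 <= dist2 c y) by (rewrite dist2_Cmod; apply pow2_ge_0).
  destruct (Rle_lt_dec (e ^ 2) (dist2 c y)) as [Hle|Hlt].
  - unfold M; rewrite Rmax_left by lra.
    replace (16 * 0 ^ 2 * dist2 c y) with 0 by ring; apply pow2_ge_0.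
  - assert (HM : 0 <= M <= e ^ 2) by (unfold M; rewrite Rmax_right; lra).
    assert (Ly : lam c / 2 <= lam y).
    { left; apply L; rewrite dist2_Cmod in Hlt; pose proof (Cmod_ge_0 (y - c)); nra. }
    assert (K1 : 4 * e ^ 3 <= 4 * e ^ 3 / (lam c / 2) * lam y).
    { replace (4 * e ^ 3) with (4 * e ^ 3 / (lam c / 2) * (lam c / 2)) at 1 by (field; lra).
      apply Rmult_le_compat_l; [|exact Ly].
      apply Rlt_le, Rdiv_lt_0_compat; [|exact Hc2]; pose proof (pow_lt e 3 He); lra. }
    assert (E3 : 0 < e ^ 3) by (apply pow_lt; exact He).
    apply Rle_trans with ((4 * e ^ 3) ^ 2).
    + replace ((4 * e ^ 3) ^ 2) with (16 * (e ^ 2) ^ 2 * e ^ 2) by ring.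
      apply Rmult_le_compat; [|exact D0| |lra].
      * pose proof (pow2_ge_0 M); lra.
      * apply Rmult_le_compat_l; [lra|apply pow_incr; exact HM].
    + apply pow_incr; lra. }
exists ((lam c / 2) * e / 4); split; [apply Rdiv_lt_0_compat; [apply Rmult_lt_0_compat|]; lra|].
intros y l Hl Hlt.
assert (E3 : 0 < e ^ 3) by (apply pow_lt; exact He).
assert (K0 : 0 < 4 * e ^ 3 / (lam c / 2)) by (apply Rdiv_lt_0_compat; lra).
pose proof (gradient_bound_path Y lam _ b y c l Hlam (Rlt_le _ _ K0) GB Hl) as B.
assert (Bc : b c = e ^ 4).
{ unfold b; replace (dist2 c c) with 0 by (unfold dist2; ring); rewrite Rminus_0_r, Rmax_right by nra; ring. }
rewrite Bc in B; apply Rabs_le_between in B.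
assert (4 * e ^ 3 / (lam c / 2) * l < e ^ 4).
{ apply Rlt_le_trans with (4 * e ^ 3 / (lam c / 2) * ((lam c / 2) * e / 4)).
  - apply Rmult_lt_compat_l; assumption.
  - right; field; lra. }
assert (Pb : 0 < b y) by lra.
assert (Hy : dist2 c y < e ^ 2).
{ apply Rnot_le_lt; intros Hle; unfold b in Pb; rewrite Rmax_left in Pb by lra; lra. }
rewrite dist2_Cmod in Hy; pose proof (Cmod_ge_0 (y - c)); nra.
Qed.

(** The indicator function of a locally constant property has zero derivative. *)
Lemma interval_connected (P : R -> Prop) :
  (forall t, 0 <= t <= 1 -> locally t (fun s => P s <-> P t)) -> P 0 -> P 1.
Proof.
intros H H0.
set (chi := fun t => if excluded_middle_informative (P t) then 1 else 0).
assert (Hd : forall t, 0 <= t <= 1 -> is_derive chi t 0).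
{ intros t Ht; apply is_derive_ext_loc with (fun _ => chi t); [|apply Rderiv_const].
  apply filter_imp with (2 := H t Ht); intros s Hs; unfold chi.
  destruct (excluded_middle_informative (P s)); destruct (excluded_middle_informative (P t)); tauto. }
destruct (MVT_cor2 chi (fun _ => 0) 0 1 Rlt_0_1) as [c [Hc _]].
{ intros t Ht; apply is_derive_Reals, Hd, Ht. }
unfold chi in Hc; destruct (excluded_middle_informative (P 1)); [assumption|].
destruct (excluded_middle_informative (P 0)); [lra|contradiction].
Qed.

Lemma evenly_covered_segment (X : C -> Prop) (p : C -> C) (U : C -> Prop) (I : Type) (V : I -> C -> Prop) i z w :
  (forall i, open (V i)) -> (forall z, (X z /\ U (p z)) <-> exists i, V i z) ->
  (forall i j z, V i z -> V j z -> i = j) ->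
  (forall t, 0 <= t <= 1 -> X (seg z w t) /\ U (p (seg z w t))) ->
  V i z -> V i w.
Proof.
intros HV1 HV2 HV3 H Hz; rewrite <- (seg_1 z w); rewrite <- (seg_0 z w) in Hz.
apply (interval_connected (fun t => V i (seg z w t))); [|exact Hz].
intros t Ht; destruct (proj1 (HV2 _) (H t Ht)) as [j Hj].
apply filter_imp with (2 := seg_locally (V j) z w t (HV1 j) Hj); intros s Hs.
split; intros K; [rewrite (HV3 _ _ _ K Hs); exact Hj|rewrite (HV3 _ _ _ K Hj); exact Hs].
Qed.

Lemma log_norm_C2 :
  let Y := fun z : C => 0 < dist2 0 z in
  open Y /\ Ck_on 2 Y (fun z => ln (dist2 0 z)) /\
  (forall z, Y z -> laplacian (fun z => ln (dist2 0 z)) z = 0).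
Proof.
cbv zeta; set (Y := fun z : C => 0 < dist2 0 z).
assert (HY : open Y) by (intros z Hz; apply continuous_gt; [apply dist2_continuous|exact Hz]).
destruct (C2_sqr_norm Y 0 HY) as [H1 H2].
destruct (C2_fun Y ln (fun x => / x) (fun x => - / x ^ 2) (dist2 0) HY H1) as (C1 & _ & C2).
- intros z Hz; unfold Y in Hz; split; [|split].
  + apply is_derive_Reals, derivable_pt_lim_ln, Hz.
  + auto_derive; [lra|field; lra].
  + apply (is_derive_continuous (fun x => - / x ^ 2) _ (2 / dist2 0 z ^ 3)).
    auto_derive; [apply Rgt_not_eq, Rmult_lt_0_compat; lra|field; lra].
- split; [exact HY|split; [exact C1|]]; intros z Hz; rewrite (C2 z Hz), (H2 z Hz).
  unfold grad_norm_sqr; destruct (has_grad_partial _ _ _ _ (has_grad_dist2 0 z)) as [-> ->].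
  unfold Y in Hz.
  replace ((2 * (fst z - fst (RtoC 0))) ^ 2 + (2 * (snd z - snd (RtoC 0))) ^ 2) with (4 * dist2 0 z)
    by (unfold dist2; ring).
  field; lra.
Qed.

(** The logarithm of the density on the disk obtained by pulling back [lam]. *)
Definition log_pullback (lam : C -> R) (p : C -> C) (z : C) : R :=
  ln (lam (p z)) + / 2 * ln (dist2 0 (cderiv p z)).

Lemma exp_log_pullback lam p z : 0 < lam (p z) -> cderiv p z <> 0 ->
  exp (log_pullback lam p z) = lam (p z) * Cmod (cderiv p z).
Proof.
intros H1 H2; unfold log_pullback; apply Cmod_gt_0 in H2.
rewrite dist2_0_Cmod; replace (Cmod (cderiv p z) ^ 2) with (Cmod (cderiv p z) * Cmod (cderiv p z)) by ring.
rewrite ln_mult by assumption.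
replace (/ 2 * (ln (Cmod (cderiv p z)) + ln (Cmod (cderiv p z)))) with (ln (Cmod (cderiv p z))) by field.
rewrite exp_plus, !exp_ln by assumption; reflexivity.
Qed.

(** [ln |p'|] is harmonic, and the Laplacian of [ln lam] is multiplied by
    [|p'|^2] under composition with [p]. *)
Lemma log_pullback_liouville Y lam p :
  open Y -> conformal_density Y lam -> (forall z, Y z -> gaussian_curvature lam z = -4) ->
  holo_on D p -> (forall z, D z -> Y (p z)) -> (forall z, D z -> cderiv p z <> 0) ->
  liouville (log_pullback lam p).
Proof.
intros HY [Hpos Hs] Hcurv Hp HDY Hne.
destruct (C2_fun Y ln (fun x => / x) (fun x => - / x ^ 2) lam HY (Hs 2%nat)) as (A1 & _ & _).
{ intros z Hz; pose proof (Hpos z Hz) as P; split; [|split].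
  - apply is_derive_Reals, derivable_pt_lim_ln, P.
  - auto_derive; [lra|field; lra].
  - apply (is_derive_continuous (fun x => - / x ^ 2) _ (2 / lam z ^ 3)).
    auto_derive; [apply Rgt_not_eq, Rmult_lt_0_compat; lra|field; lra]. }
destruct (C2_comp_holo D Y _ p (open_disk 0 1) HY Hp HDY A1) as (B1 & _ & B2).
destruct log_norm_C2 as (N0 & N1 & N2).
assert (Hd : forall z, D z -> 0 < dist2 0 (cderiv p z)).
{ intros z Hz; rewrite dist2_0_Cmod; apply pow_lt, Cmod_gt_0, Hne, Hz. }
destruct (C2_comp_holo D _ _ (cderiv p) (open_disk 0 1) N0 (cderiv_holo D p (open_disk 0 1) Hp) Hd N1)
  as (E1 & _ & E2).
destruct (C2_scal D (/ 2) _ (open_disk 0 1) E1) as [F1 F2].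
destruct (C2_plus D _ _ (open_disk 0 1) B1 F1) as [G1 G2].
split; [exact G1|]; intros z Hz; unfold log_pullback at 1.
rewrite (G2 z Hz), (B2 z Hz), (F2 z Hz), (E2 z Hz), (N2 _ (Hd z Hz)).
pose proof (Hcurv (p z) (HDY z Hz)) as K; unfold gaussian_curvature in K.
pose proof (Hpos (p z) (HDY z Hz)) as P.
replace (2 * log_pullback lam p z) with (log_pullback lam p z + log_pullback lam p z) by ring.
rewrite exp_plus, (exp_log_pullback lam p z P (Hne z Hz)).
assert (K' : laplacian (fun w => ln (lam w)) (p z) = 4 * lam (p z) ^ 2).
{ apply Rmult_eq_reg_r with (/ lam (p z) ^ 2); [|apply Rinv_neq_0_compat, pow_nonzero; lra].
  replace (4 * lam (p z) ^ 2 * / lam (p z) ^ 2) with 4 by (field; lra).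
  unfold Rdiv in K; lra. }
rewrite K'; ring.
Qed.

Lemma covering_derivative_neq_0 Y p z :
  holo_on D p -> covering_map unit_disk Y p -> D z -> cderiv p z <> 0.
Proof.
intros Hp (H1 & _ & H3) Hz.
assert (Hu : unit_disk z) by (apply unit_disk_disk, Hz).
destruct (H3 (p z) (H1 z Hu)) as (U & HU & Uz & _ & I & V & s & V1 & V2 & V3 & V4 & V5).
destruct (proj1 (V2 z) (conj Hu Uz)) as [i Hi].
apply (derivative_neq_0 p (s i) (V i) U z); auto.
- intros w Hw; apply Hp, unit_disk_disk, V2; exists i; exact Hw.
- intros w Hw; split; [apply (proj2 (V2 w)); exists i; exact Hw|apply (V4 i w Hw)].
Qed.

(** Completeness forces the pulled back metric to be at least the hyperbolic
    metric of the disk: otherwise the escaping sequence has an image of finite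
    length, which converges; its tail stays in one sheet of the covering, so the
    sequence itself converges in the disk, where the defect is bounded. *)
Theorem complete_density_bound Y lam p z0 :
  plane_domain Y -> hyperbolic_metric Y lam ->
  holo_on D p -> covering_map unit_disk Y p -> D z0 ->
  1 <= (1 - dist2 0 z0) * (lam (p z0) * Cmod (cderiv p z0)).
Proof.
intros HYd (Hcd & Hcurv & Hcomp) Hp Hcov Hz0.
assert (HY : open Y) by apply HYd.
assert (HDY : forall z, D z -> Y (p z)) by (intros z Hz; apply Hcov, unit_disk_disk, Hz).
assert (Hne : forall z, D z -> cderiv p z <> 0) by (intros z Hz; apply (covering_derivative_neq_0 Y); assumption).
assert (Hlam : nonneg_continuous_on Y lam).
{ intros z Hz; destruct Hcd as [H1 H2]; split; [left; apply H1, Hz|apply (Ck_continuous 0 Y); [apply H2|exact Hz]]. }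
set (l := log_pullback lam p).
assert (Hl : liouville l) by (apply (log_pullback_liouville Y); assumption).
assert (El : forall z, D z -> exp (l z) = lam (p z) * Cmod (cderiv p z)).
{ intros z Hz; apply exp_log_pullback; [apply Hcd, HDY, Hz|apply Hne, Hz]. }
rewrite <- (El z0 Hz0); apply Rnot_lt_le; intros Hlt.
assert (Hpos : 0 < defect l z0).
{ apply Rnot_le_lt; intros Hle; rewrite (defect_exp l z0 Hz0) in Hlt.
  destruct (density_bounds z0 Hz0) as [B1 B2].
  replace ((1 - dist2 0 z0) * (exp (- defect l z0) / (1 - dist2 0 z0))) with (exp (- defect l z0)) in Hlt by (field; lra).
  rewrite <- exp_0 in Hlt; apply exp_lt_inv in Hlt; lra. }
destruct (defect_escape l z0 Hl Hz0 Hpos) as (s & A & q & k & Hs0 & HA & Hq & Hk & HS).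
set (T := fun n => A * q ^ n / (1 - q)).
assert (HT : forall n, 0 < T n).
{ intros n; apply Rdiv_lt_0_compat; [apply Rmult_lt_0_compat; [exact HA|apply pow_lt; lra]|lra]. }
assert (HTS : forall n, A * q ^ n = T n - T (S n)) by (intros n; unfold T; simpl; field; lra).
assert (HTlim : forall eps, 0 < eps -> exists N, forall n, (N <= n)%nat -> T n < eps).
{ intros eps He.
  destruct (pow_lt_1_zero q ltac:(rewrite Rabs_pos_eq; lra) (eps * (1 - q) / A)) as [N HN].
  { apply Rdiv_lt_0_compat; [apply Rmult_lt_0_compat|]; lra. }
  exists N; intros n Hn; specialize (HN n Hn); rewrite Rabs_pos_eq in HN by (apply pow_le; lra).
  unfold T; apply Rmult_lt_reg_r with ((1 - q) / A); [apply Rdiv_lt_0_compat; lra|].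
  replace (A * q ^ n / (1 - q) * ((1 - q) / A)) with (q ^ n) by (field; lra).
  replace (eps * ((1 - q) / A)) with (eps * (1 - q) / A) by (field; lra); exact HN. }
(* sub-arcs of the image of the polygonal curve, traversed in either direction *)
assert (Arc : forall n a b, 0 <= a <= 1 -> 0 <= b <= 1 ->
  let z := seg (s n) (s (S n)) a in let w := seg (s n) (s (S n)) b in
  C1_arc Y (fun t => p (seg z w t)) /\ arc_length lam (fun t => p (seg z w t)) <= A * q ^ n).
{ intros n a b Ha Hb z w.
  apply (holo_segment_arc D Y lam p z w (A * q ^ n) (open_disk 0 1) Hp HDY Hlam).
  intros t Ht.
  assert (Es : seg z w t = seg (s n) (s (S n)) (a + t * (b - a))) by (unfold z, w; apply C_ext; simpl; ring).
  assert (Ew : (w - z = RtoC (b - a) * (s (S n) - s n))%C) by (unfold z, w; apply C_ext; simpl; ring).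
  destruct (HS n) as (_ & _ & H); destruct (H (a + t * (b - a)) ltac:(nra)) as [H1 H2].
  rewrite Es; split; [exact H1|]; rewrite <- El, Ew, Cmod_mult, Cmod_R by exact H1.
  apply Rle_trans with (2 := H2); apply Rmult_le_compat_l; [left; apply exp_pos|].
  assert (Rabs (b - a) <= 1) by (apply Rabs_le; lra).
  pose proof (Cmod_ge_0 (s (S n) - s n)); nra. }
set (u := fun n => p (s n)).
assert (Yu : forall n, Y (u n)) by (intros n; apply HDY, HS).
assert (Fwd : forall j n, exists L, path_of_length Y lam (u n) (u (n + j)%nat) L /\ L <= T n - T (n + j)%nat).
{ induction j as [|j IH]; intros n.
  - exists 0; rewrite Nat.add_0_r; split; [apply path_nil, Yu|lra].
  - destruct (IH (S n)) as (L & HL1 & HL2).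
    destruct (Arc n 0 1 ltac:(lra) ltac:(lra)) as [C1 C2]; cbv zeta in C1, C2; rewrite seg_0, seg_1 in C1, C2.
    exists (arc_length lam (fun t => p (seg (s n) (s (S n)) t)) + L); split.
    + rewrite Nat.add_succ_r; pose proof (path_cons Y lam _ (u (S n + j)%nat) L C1) as PC.
      cbv beta in PC; rewrite seg_0, seg_1 in PC; apply PC, HL1.
    + rewrite Nat.add_succ_r; change (S (n + j)) with (S n + j)%nat; rewrite HTS in C2; lra. }
assert (Bwd : forall j n, exists L, path_of_length Y lam (u (n + j)%nat) (u n) L /\ L <= T n - T (n + j)%nat).
{ induction j as [|j IH]; intros n.
  - exists 0; rewrite Nat.add_0_r; split; [apply path_nil, Yu|lra].
  - destruct (IH n) as (L & HL1 & HL2).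
    destruct (Arc (n + j)%nat 1 0 ltac:(lra) ltac:(lra)) as [C1 C2]; cbv zeta in C1, C2; rewrite seg_0, seg_1 in C1, C2.
    exists (arc_length lam (fun t => p (seg (s (S (n + j))) (s (n + j)%nat) t)) + L); split.
    + rewrite Nat.add_succ_r; pose proof (path_cons Y lam _ (u n) L C1) as PC.
      cbv beta in PC; rewrite seg_0, seg_1 in PC; apply PC, HL1.
    + rewrite Nat.add_succ_r; rewrite HTS in C2; lra. }
destruct (Hcomp u Yu) as (c & Hc & Hlim).
{ intros eps He; destruct (HTlim eps He) as [N HN]; exists N; intros m n Hm Hn.
  destruct (Nat.le_ge_cases m n) as [Hle|Hle].
  - destruct (Fwd (n - m)%nat m) as (L & HL1 & HL2); replace (m + (n - m))%nat with n in * by lia.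
    apply Rle_lt_trans with (1 := metric_dist_le Y lam _ _ L Hlam HL1).
    pose proof (HN m Hm); pose proof (HT n); lra.
  - destruct (Bwd (m - n)%nat n) as (L & HL1 & HL2); replace (n + (m - n))%nat with m in * by lia.
    apply Rle_lt_trans with (1 := metric_dist_le Y lam _ _ L Hlam HL1).
    pose proof (HN n Hn); pose proof (HT m); lra. }
destruct Hcov as (_ & _ & Hev); destruct (Hev c Hc) as (U & HU & Uc & _ & I & V & sg & V1 & V2 & V3 & V4 & V5).
(* eventually, the whole curve is as close to [c] as we like *)
assert (Close : forall d, 0 < d -> exists N, forall n t, (N <= n)%nat -> 0 <= t <= 1 ->
  Cmod (p (seg (s n) (s (S n)) t) - c) < d).
{ intros d Hd.
  destruct (short_path_close Y lam c d HY Hlam Hc (proj1 Hcd c Hc) Hd) as (eps & He & HE).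
  destruct (HTlim (eps / 2) ltac:(lra)) as [N1 HN1].
  apply is_lim_seq_spec in Hlim; destruct (Hlim (mkposreal (eps / 2) ltac:(lra))) as [N2 HN2]; simpl in HN2.
  exists (N1 + N2)%nat; intros n t Hn Ht.
  pose proof (HN1 n ltac:(lia)) as B1; pose proof (HN2 n ltac:(lia)) as B2.
  rewrite Rminus_0_r in B2; apply Rabs_def2 in B2.
  destruct (metric_dist_approx Y lam (u n) c (eps / 2) Hlam (path_exists Y lam _ _ HYd (Yu n) Hc) (proj1 B2))
    as (L & HL1 & HL2).
  destruct (Arc n t 0 Ht ltac:(lra)) as [C1 C2]; cbv zeta in C1, C2; rewrite seg_0 in C1, C2.
  pose proof (path_cons Y lam _ c L C1) as PC; cbv beta in PC; rewrite seg_0, seg_1 in PC; specialize (PC HL1).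
  apply (HE _ _ PC); rewrite HTS in C2; pose proof (HT (S n)); lra. }
pose proof (open_locally _ _ HU Uc) as LU; apply locally_disk in LU; destruct LU as (d & Hd & LU).
destruct (Close d Hd) as [N HN].
assert (InU : forall n t, (N <= n)%nat -> 0 <= t <= 1 ->
  unit_disk (seg (s n) (s (S n)) t) /\ U (p (seg (s n) (s (S n)) t))).
{ intros n t Hn Ht; split; [apply unit_disk_disk, HS, Ht|apply LU, HN; assumption]. }
destruct (proj1 (V2 _) (InU N 0 (Nat.le_refl N) ltac:(lra))) as [i Hi]; rewrite seg_0 in Hi.
assert (Sheet : forall j, V i (s (N + j)%nat)).
{ induction j as [|j IH]; [rewrite Nat.add_0_r; exact Hi|]; rewrite Nat.add_succ_r.
  apply (evenly_covered_segment unit_disk p U I V i (s (N + j)%nat)); auto.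
  intros t Ht; apply InU; [lia|exact Ht]. }
destruct (V5 i c Uc) as (Sc & Vc & Pc).
assert (Dc : D (sg i c)) by (apply unit_disk_disk, V2; exists i; exact Vc).
set (M := defect l (sg i c) + 1).
assert (LM : locally (sg i c) (fun w => defect l w < M)).
{ apply continuous_lt; [|unfold M; lra]; apply (Ck_continuous 2 D); [apply (defect_C2 l Hl)|exact Dc]. }
apply Sc in LM; apply locally_disk in LM; destruct LM as (d' & Hd' & LM).
destruct (Close d' Hd') as [N' HN'].
destruct (INR_unbounded (M / k)) as [N'' HN''].
set (j := (N' + N'')%nat).
pose proof (HN' (N + j)%nat 0 ltac:(lia) ltac:(lra)) as B; rewrite seg_0 in B.
apply LM in B; rewrite (proj2 (V4 i _ (Sheet j))) in B.
destruct (HS (N + j)%nat) as (_ & B' & _).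
assert (INR N'' <= INR (N + j)) by (apply le_INR; lia).
assert (M < INR N'' * k).
{ apply Rmult_lt_reg_r with (/ k); [apply Rinv_0_lt_compat, Hk|].
  rewrite Rmult_assoc, Rinv_r, Rmult_1_r by lra; exact HN''. }
assert (INR N'' * k <= INR (N + j) * k) by (apply Rmult_le_compat_r; lra).
lra.
Qed.

(** * Log-concave densities on an interval *)

(** The sine is concave on [0, PI/4], hence above its chord. *)
Lemma sin_chord y : 0 <= y <= PI / 4 -> 2 * sqrt 2 / PI * y <= sin y.
Proof.
intros Hy; assert (P := PI_RGT_0); set (c := 2 * sqrt 2 / PI).
assert (E4 : sin (PI / 4) = c * (PI / 4)).
{ rewrite sin_PI4; unfold c.
  assert (Hs : sqrt 2 * sqrt 2 = 2) by (apply sqrt_sqrt; lra).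
  assert (0 < sqrt 2) by (apply sqrt_lt_R0; lra).
  replace (2 * sqrt 2 / PI * (PI / 4)) with (sqrt 2 / 2) by (field; lra).
  apply Rmult_eq_reg_r with (sqrt 2); [|lra]; unfold Rdiv.
  rewrite Rmult_assoc, Rinv_l by lra; nra. }
apply Rnot_lt_le; intros Hlt.
assert (D : forall t, derivable_pt_lim (fun t => sin t - c * t) t (cos t - c)).
{ intros t; apply is_derive_Reals; auto_derive; trivial; ring. }
destruct (Req_dec y 0) as [->|H0]; [rewrite sin_0 in Hlt; lra|].
destruct (Req_dec y (PI / 4)) as [->|H4]; [lra|].
destruct (MVT_cor2 (fun t => sin t - c * t) (fun t => cos t - c) 0 y ltac:(lra) (fun t _ => D t)) as [x1 [E1 B1]].
destruct (MVT_cor2 (fun t => sin t - c * t) (fun t => cos t - c) y (PI / 4) ltac:(lra) (fun t _ => D t)) as [x2 [E2 B2]].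
rewrite sin_0 in E1.
assert (cos x2 < cos x1) by (apply cos_decreasing_1; lra).
assert (cos x1 - c < 0).
{ apply Rmult_lt_reg_r with (y - 0); lra. }
assert (0 < cos x2 - c).
{ apply Rmult_lt_reg_r with (PI / 4 - y); lra. }
lra.
Qed.

(** With [y = PI/4 - PI x/2] the sine is [1 - 2 sin y ^ 2], and the chord bound at
    [y] becomes the parabola. *)
Lemma sin_parabola x : 0 <= x <= 1 -> sin (PI * x) <= 4 * x * (1 - x).
Proof.
intros Hx; assert (P := PI_RGT_0).
assert (Q : forall y, 0 <= y <= PI / 4 -> 1 - 2 * sin y ^ 2 <= 1 - 16 * y ^ 2 / PI ^ 2).
{ intros y Hy; pose proof (sin_chord y Hy) as S.
  assert (Hs : sqrt 2 ^ 2 = 2) by (apply pow2_sqrt; lra).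
  assert (0 < sqrt 2) by (apply sqrt_lt_R0; lra).
  assert (0 <= 2 * sqrt 2 / PI * y).
  { apply Rmult_le_pos; [apply Rlt_le, Rdiv_lt_0_compat; lra|lra]. }
  assert (K : (2 * sqrt 2 / PI * y) ^ 2 <= sin y ^ 2) by (apply pow_incr; lra).
  replace ((2 * sqrt 2 / PI * y) ^ 2) with (4 * sqrt 2 ^ 2 * y ^ 2 / PI ^ 2) in K by (field; lra).
  rewrite Hs in K; replace (16 * y ^ 2 / PI ^ 2) with (2 * (4 * 2 * y ^ 2 / PI ^ 2)) by (field; lra); lra. }
assert (H : forall x, 0 <= x <= 1 / 2 -> sin (PI * x) <= 4 * x * (1 - x)).
{ clear x Hx; intros x Hx.
  set (y := PI / 4 - PI * x / 2).
  assert (Hy : 0 <= y <= PI / 4) by (unfold y; nra).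
  replace (PI * x) with (PI / 2 - 2 * y) by (unfold y; field).
  rewrite sin_shift, cos_2a_sin.
  pose proof (Q y Hy) as K; replace (1 - 2 * sin y * sin y) with (1 - 2 * sin y ^ 2) by ring.
  apply Rle_trans with (1 := K); right; unfold y; field; lra. }
destruct (Rle_lt_dec x (1 / 2)) as [Hle|Hlt]; [apply H; lra|].
replace (PI * x) with (PI - PI * (1 - x)) by ring; rewrite <- sin_PI_x.
replace (PI - (PI - PI * (1 - x))) with (PI * (1 - x)) by ring.
apply Rle_trans with (1 := H (1 - x) ltac:(lra)); lra.
Qed.

(** [G d] is at most [rho * E], with [E] the integral of [exp (- s t)] over
    [0, d], and [E * (2 + s d) <= 2 d] is the inequality [x coth x >= 1] at
    [x = s d / 2]. *)
Lemma exponential_growth_bound (G G' : R -> R) rho s d :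
  0 < d -> 0 < rho -> G 0 = 0 ->
  (forall t, 0 <= t <= d -> is_derive G t (G' t) /\ 0 <= G' t <= rho * exp (- s * t)) ->
  G d * (2 + s * d) <= 2 * d * rho.
Proof.
intros Hd Hrho G0 HG.
set (E := (fun t => RInt (fun x => exp (- s * x)) 0 t) : R -> R).
assert (CE : forall x, continuous (fun x => exp (- s * x)) x).
{ intros x; apply (is_derive_continuous _ _ (- s * exp (- s * x))); auto_derive; trivial; ring. }
assert (DE : forall t, is_derive E t (exp (- s * t))).
{ intros t; apply (is_derive_RInt (V := R_NormedModule) (fun x => exp (- s * x)) E 0 t); [|apply CE].
  apply filter_forall; intros u; apply (RInt_correct (fun x => exp (- s * x))), ex_RInt_Rcont, CE. }
assert (E0 : E 0 = 0) by (unfold E; rewrite RInt_point; reflexivity).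
assert (Mono : forall (f f' : R -> R) b, 0 <= b <= d -> (forall t, 0 <= t <= d -> is_derive f t (f' t)) ->
  (forall t, 0 <= t <= d -> 0 <= f' t) -> f 0 <= f b).
{ intros f f' b [[Hb|Hb] Hbd] H1 H2; [|rewrite <- Hb; lra].
  destruct (MVT_cor2 f f' 0 b Hb) as [c [Hc1 Hc2]].
  - intros t Ht; apply is_derive_Reals, H1; lra.
  - pose proof (H2 c ltac:(lra)); nra. }
assert (SE : forall t, 0 <= t <= d -> s * E t = 1 - exp (- s * t)).
{ intros t [[Ht|Ht] Htd].
  2:{ rewrite <- Ht, E0, Rmult_0_r, Rmult_0_r, exp_0; ring. }
  destruct (MVT_cor2 (fun t => s * E t + exp (- s * t)) (fun _ => 0) 0 t Ht) as [c [Hc _]].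
  - intros x _; apply is_derive_Reals.
    assert (De : is_derive (fun t => exp (- s * t)) x (- s * exp (- s * x))) by (auto_derive; trivial; ring).
    eapply Rderiv_eq; [apply Rderiv_plus; [apply (is_derive_scal E x s), DE|exact De]|].
    unfold scal; simpl; unfold mult; simpl; ring.
  - rewrite E0, !Rmult_0_r, exp_0 in Hc; lra. }
assert (B1 : G d <= rho * E d).
{ pose proof (Mono (fun t => rho * E t - G t) (fun t => rho * exp (- s * t) - G' t) d ltac:(lra)) as K.
  cbv beta in K; rewrite E0, G0 in K.
  assert (rho * 0 - 0 <= rho * E d - G d); [|lra]; apply K.
  - intros t Ht; apply Rderiv_minus; [apply (is_derive_scal E t rho), DE|apply HG, Ht].
  - intros t Ht; destruct (HG t Ht) as [_ B]; lra. }
assert (B2 : E d * (2 + s * d) <= 2 * d).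
{ pose proof (Mono (fun t => 2 * t - E t * (2 + s * t)) (fun t => 1 - exp (- s * t) * (1 + s * t)) d ltac:(lra)) as K.
  cbv beta in K; rewrite E0 in K.
  assert (2 * 0 - 0 * (2 + s * 0) <= 2 * d - E d * (2 + s * d)); [|lra]; apply K.
  - intros t Ht; pose proof (SE t Ht) as SEt.
    assert (D2 : is_derive (fun t => 2 + s * t) t s) by (auto_derive; trivial; ring).
    assert (D1 : is_derive (fun t => 2 * t) t 2) by (auto_derive; trivial; ring).
    eapply Rderiv_eq; [apply Rderiv_minus; [exact D1|apply Rderiv_mult; [apply DE|exact D2]]|].
    cbv beta; lra.
  - intros t Ht; pose proof (exp_ineq1_le (s * t)) as X; pose proof (exp_pos (- s * t)).
    assert (exp (- s * t) * exp (s * t) = 1).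
    { rewrite <- exp_plus; replace (- s * t + s * t) with 0 by ring; apply exp_0. }
    nra. }
assert (Gd : 0 <= G d).
{ rewrite <- G0; apply (Mono G G' d); [lra|intros t Ht; apply HG, Ht|intros t Ht; apply HG, Ht]. }
destruct (Rle_lt_dec 0 (2 + s * d)) as [Hp|Hn].
- apply Rle_trans with (rho * E d * (2 + s * d)); [apply Rmult_le_compat_r; assumption|].
  replace (2 * d * rho) with (rho * (2 * d)) by ring; rewrite Rmult_assoc; apply Rmult_le_compat_l; lra.
- apply Rle_trans with 0; [nra|apply Rmult_le_pos; lra].
Qed.

Lemma strip_laplacian (g : R -> R) (z : C) :
  laplacian (fun w => g (Re w)) z = Derive (Derive g) (Re z).
Proof.
unfold laplacian.
assert (E1 : partial_y (partial_y (fun w => g (Re w))) z = 0).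
{ unfold partial_y; simpl; rewrite (Derive_ext _ (fun _ => 0)).
  - apply Derive_const.
  - intros t; apply Derive_const. }
rewrite E1, Rplus_0_r; reflexivity.
Qed.

(** The curvature is [- (ln r)'' / r ^ 2], so that [ln r] is concave and lies below
    its tangents. *)
Lemma curvature_log_concave r :
  (forall t, -1 < t < 1 -> 0 < r t) -> smooth_on_unit_interval r ->
  (forall w : C, -1 < Re w < 1 -> 0 <= gaussian_curvature (strip_density r) w) ->
  forall u t, -1 < u < 1 -> -1 < t < 1 -> r t <= r u * exp (Derive r u / r u * (t - u)).
Proof.
intros Hpos Hsm Hcurv.
assert (Dr : forall t, -1 < t < 1 -> is_derive r t (Derive r t)).
{ intros t Ht; apply Derive_correct; exact (Hsm 1%nat t Ht). }
assert (Dr2 : forall t, -1 < t < 1 -> ex_derive (Derive r) t) by (intros t Ht; exact (Hsm 2%nat t Ht)).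
set (sg := fun t => Derive r t / r t).
assert (Dln : forall t, -1 < t < 1 -> is_derive (fun t => ln (r t)) t (sg t)).
{ intros t Ht; pose proof (Hpos t Ht) as P; eapply Rderiv_eq.
  - apply (is_derive_comp ln r); [apply is_derive_Reals, derivable_pt_lim_ln, P|apply Dr, Ht].
  - unfold scal, sg; simpl; unfold mult; simpl; field; lra. }
assert (Dsg : forall t, -1 < t < 1 -> is_derive sg t (Derive (Derive (fun t => ln (r t))) t)).
{ intros t Ht; replace (Derive (Derive (fun t => ln (r t))) t) with (Derive sg t).
  - apply Derive_correct; unfold sg, Rdiv; apply (ex_derive_mult (Derive r) (fun t => / r t)); [apply Dr2, Ht|].
    apply ex_derive_inv; [exists (Derive r t); apply Dr, Ht|pose proof (Hpos t Ht); lra].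
  - apply Derive_ext_loc.
    assert (Hm : 0 < Rmin (t + 1) (1 - t)) by (apply Rmin_pos; lra).
    exists (mkposreal _ Hm); intros v Hv; symmetry; apply is_derive_unique, Dln.
    pose proof (Rmin_l (t + 1) (1 - t)); pose proof (Rmin_r (t + 1) (1 - t)).
    change (Rabs (v - t) < Rmin (t + 1) (1 - t)) in Hv; apply Rabs_def2 in Hv; lra. }
assert (Neg : forall t, -1 < t < 1 -> Derive (Derive (fun t => ln (r t))) t <= 0).
{ intros t Ht; pose proof (Hcurv (t, 0) Ht) as K; unfold gaussian_curvature, strip_density in K.
  rewrite (strip_laplacian (fun t => ln (r t))) in K; simpl Re in K.
  pose proof (Hpos t Ht) as P; pose proof (pow_lt (r t) 2 P) as P2.
  apply (Rmult_le_compat_r (r t ^ 2)) in K; [|lra].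
  unfold Rdiv in K; rewrite Rmult_assoc, Rinv_l in K by lra; lra. }
assert (Dec : forall x y, -1 < x < 1 -> -1 < y < 1 -> x <= y -> sg y <= sg x).
{ intros x y Hx Hy [Hxy| ->]; [|lra].
  destruct (MVT_cor2 sg (fun t => Derive (Derive (fun t => ln (r t))) t) x y Hxy) as [c [Hc1 Hc2]].
  - intros t Ht; apply is_derive_Reals, Dsg; lra.
  - pose proof (Neg c ltac:(lra)); nra. }
intros u t Hu Ht; fold (sg u).
assert (L : ln (r t) <= ln (r u) + sg u * (t - u)).
{ destruct (Rtotal_order u t) as [Hlt|[->|Hgt]].
  - destruct (MVT_cor2 (fun t => ln (r t)) sg u t Hlt) as [c [Hc1 Hc2]].
    + intros x Hx; apply is_derive_Reals, Dln; lra.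
    + pose proof (Dec u c Hu ltac:(lra) ltac:(lra)); nra.
  - lra.
  - destruct (MVT_cor2 (fun t => ln (r t)) sg t u Hgt) as [c [Hc1 Hc2]].
    + intros x Hx; apply is_derive_Reals, Dln; lra.
    + pose proof (Dec c u ltac:(lra) Hu ltac:(lra)); nra. }
rewrite <- (exp_ln (r t)), <- (exp_ln (r u)) by auto; rewrite <- exp_plus.
destruct (Req_dec (ln (r t)) (ln (r u) + sg u * (t - u))) as [->|N]; [lra|left; apply exp_increasing; lra].
Qed.

(** The mass [X] of one side of a point, on an interval of length [L]. The bound
    for intervals of length [t < L] weakens to the rate [/ L + s / 2], which does
    not depend on [t], and passes to the supremum. *)
Lemma one_sided_mass (G G' : R -> R) rho s L X :
  0 < rho -> 0 < X -> G 0 = 0 ->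
  (forall t, 0 <= t < L -> is_derive G t (G' t) /\ 0 <= G' t <= rho * exp (- s * t)) ->
  (forall c, 0 < c -> (forall t, 0 < t < L -> G t <= c) -> X <= c) ->
  X * (/ L + s / 2) <= rho.
Proof.
intros Hrho HX G0 HG Hsup.
destruct (Rle_lt_dec (/ L + s / 2) 0) as [Hn|Hp]; [nra|].
set (c := / L + s / 2) in *.
apply Rle_trans with (rho / c * c); [|right; field; lra].
apply Rmult_le_compat_r; [lra|]; apply Hsup; [apply Rdiv_lt_0_compat; assumption|].
intros t Ht.
assert (B : G t * (2 + s * t) <= 2 * t * rho).
{ apply (exponential_growth_bound G G'); [lra|exact Hrho|exact G0|intros x Hx; apply HG; lra]. }
destruct (Rle_lt_dec (G t) 0) as [HGt|HGt].
{ apply Rle_trans with (1 := HGt), Rlt_le, Rdiv_lt_0_compat; assumption. }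
assert (Hi : / L <= / t) by (apply Rinv_le_contravar; lra).
apply Rmult_le_reg_r with c; [exact Hp|].
replace (rho / c * c) with rho by (field; lra).
apply Rle_trans with (G t * (/ t + s / 2)); [apply Rmult_le_compat_l; unfold c; lra|].
apply Rmult_le_reg_r with (2 * t); [lra|].
replace (G t * (/ t + s / 2) * (2 * t)) with (G t * (2 + s * t)) by (field; lra); lra.
Qed.

(** Let [X] and [Y] be the masses of [r] on the two sides of [u] and [s] the
    logarithmic derivative of [r] at [u]. Log-concavity gives
    [X (1 / (1 + u) + s / 2) <= r u] and [Y (1 / (1 - u) - s / 2) <= r u]. Adding
    [Y] times the first inequality and [X] times the second one removes [s]:
    [2 X Y <= r u (X + Y) (1 - u ^ 2)]. The sine is dominated by the parabola. *)
Theorem log_concave_profile r :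
  (forall t, -1 < t < 1 -> 0 < r t) -> smooth_on_unit_interval r ->
  (forall w : C, -1 < Re w < 1 -> 0 <= gaussian_curvature (strip_density r) w) ->
  exists (F : R -> R) (a b : R), forall u, -1 < u < 1 ->
    is_derive F u (r u) /\ a < F u < b /\
    (b - a) * sin (PI * ((F u - a) / (b - a))) <= 2 * r u * (1 - u ^ 2).
Proof.
intros Hpos Hsm Hcurv.
pose proof (curvature_log_concave r Hpos Hsm Hcurv) as LC.
assert (Cr : forall t, -1 < t < 1 -> continuous r t).
{ intros t Ht; apply (is_derive_continuous r t (Derive r t)), Derive_correct; exact (Hsm 1%nat t Ht). }
set (F := (fun u => RInt r 0 u) : R -> R).
assert (Near : forall t, -1 < t < 1 -> locally t (fun v => -1 < v < 1)).
{ intros t Ht; assert (Hm : 0 < Rmin (t + 1) (1 - t)) by (apply Rmin_pos; lra).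
  exists (mkposreal _ Hm); intros v Hv.
  pose proof (Rmin_l (t + 1) (1 - t)); pose proof (Rmin_r (t + 1) (1 - t)).
  change (Rabs (v - t) < Rmin (t + 1) (1 - t)) in Hv; apply Rabs_def2 in Hv; lra. }
assert (DF : forall t, -1 < t < 1 -> is_derive F t (r t)).
{ intros t Ht; apply (is_derive_RInt (V := R_NormedModule) r F 0 t); [|apply Cr, Ht].
  apply filter_imp with (2 := Near t Ht); intros v Hv; apply (RInt_correct r).
  apply (ex_RInt_continuous (V := R_CompleteNormedModule)); intros x Hx; apply Cr.
  unfold Rmin, Rmax in Hx; destruct (Rle_dec 0 v); lra. }
assert (Inc : forall x y, -1 < x < 1 -> -1 < y < 1 -> x < y -> F x < F y).
{ intros x y Hx Hy Hxy; destruct (MVT_cor2 F r x y Hxy) as [c [Hc1 Hc2]].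
  - intros t Ht; apply is_derive_Reals, DF; lra.
  - pose proof (Hpos c ltac:(lra)); nra. }
set (M := r 0 * exp (Rabs (Derive r 0 / r 0))).
assert (HM : forall t, -1 < t < 1 -> Rabs (F t) <= M).
{ assert (rM : forall t, -1 < t < 1 -> r t <= M).
  { intros t Ht; apply Rle_trans with (1 := LC 0 t ltac:(lra) Ht); unfold M.
    apply Rmult_le_compat_l; [left; apply Hpos; lra|].
    assert (Derive r 0 / r 0 * (t - 0) <= Rabs (Derive r 0 / r 0)).
    { apply Rle_trans with (1 := Rle_abs _); rewrite Rabs_mult.
      assert (Rabs (t - 0) <= 1) by (apply Rabs_le; lra).
      pose proof (Rabs_pos (Derive r 0 / r 0)); nra. }
    destruct H as [H| ->]; [left; apply exp_increasing, H|lra]. }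
  assert (HM0 : 0 < M) by (apply Rlt_le_trans with (r 0); [apply Hpos|apply rM]; lra).
  assert (F0 : F 0 = 0) by (unfold F; rewrite RInt_point; reflexivity).
  intros t Ht; destruct (Rtotal_order 0 t) as [H|[<-|H]].
  - pose proof (mean_value_bound F r 0 t M ltac:(lra)) as B; rewrite F0, !Rminus_0_r in B.
    apply Rle_trans with (M * t); [apply B|nra].
    + intros x Hx; apply DF; lra.
    + intros x Hx; rewrite Rabs_pos_eq; [apply rM; lra|left; apply Hpos; lra].
  - rewrite F0, Rabs_R0; lra.
  - pose proof (mean_value_bound F r t 0 M ltac:(lra)) as B; rewrite F0, Rminus_0_l, Rabs_Ropp in B.
    apply Rle_trans with (M * (0 - t)); [apply B|nra].
    + intros x Hx; apply DF; lra.
    + intros x Hx; rewrite Rabs_pos_eq; [apply rM; lra|left; apply Hpos; lra]. }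
(* [a] and [b] are the limits of [F] at the ends of the interval *)
destruct (completeness (fun y => exists t, -1 < t < 1 /\ y = F t)) as [b [Hb1 Hb2]].
{ exists M; intros y [t [Ht ->]]; pose proof (HM t Ht); pose proof (Rle_abs (F t)); lra. }
{ exists (F 0), 0; split; [lra|reflexivity]. }
destruct (completeness (fun y => exists t, -1 < t < 1 /\ y = - F t)) as [na [Ha1 Ha2]].
{ exists M; intros y [t [Ht ->]]; pose proof (HM t Ht); pose proof (Rle_abs (- F t)); rewrite Rabs_Ropp in H0; lra. }
{ exists (- F 0), 0; split; [lra|reflexivity]. }
set (a := - na); exists F, a, b; intros u Hu; split; [apply DF, Hu|].
assert (Hub : F u < b).
{ apply Rlt_le_trans with (F ((u + 1) / 2)); [apply Inc; lra|].
  apply Hb1; exists ((u + 1) / 2); split; [lra|reflexivity]. }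
assert (Hua : a < F u).
{ apply Rle_lt_trans with (F ((u - 1) / 2)); [|apply Inc; lra].
  assert (- F ((u - 1) / 2) <= na); [|unfold a; lra].
  apply Ha1; exists ((u - 1) / 2); split; [lra|reflexivity]. }
split; [split; assumption|].
pose proof (Hpos u Hu) as Pu; set (s := Derive r u / r u).
assert (Left : (F u - a) * (/ (1 + u) + s / 2) <= r u).
{ apply (one_sided_mass (fun t => F u - F (u - t)) (fun t => r (u - t))); [exact Pu|lra| | |].
  - replace (u - 0) with u by ring; ring.
  - intros t Ht; split.
    + eapply Rderiv_eq; [apply Rderiv_minus; [apply Rderiv_const|]|].
      * apply (is_derive_comp F (fun t => u - t) t (r (u - t)) (-1)); [apply DF; lra|auto_derive; trivial; ring].
      * unfold scal; simpl; unfold mult; simpl; ring.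
    + split; [left; apply Hpos; lra|]; apply Rle_trans with (1 := LC u (u - t) Hu ltac:(lra)).
      right; fold s; f_equal; f_equal; ring.
  - intros c Hc H; assert (na <= c - F u); [|unfold a; lra].
    apply Ha2; intros y [t [Ht ->]]; destruct (Rlt_le_dec t u) as [Htu|[Htu| ->]]; [|pose proof (Inc u t Hu Ht Htu); lra|lra].
    pose proof (H (u - t) ltac:(lra)) as K; replace (u - (u - t)) with t in K by ring; lra. }
assert (Right : (b - F u) * (/ (1 - u) - s / 2) <= r u).
{ replace (/ (1 - u) - s / 2) with (/ (1 - u) + - s / 2) by (field; lra).
  apply (one_sided_mass (fun t => F (u + t) - F u) (fun t => r (u + t))); [exact Pu|lra| | |].
  - replace (u + 0) with u by ring; ring.
  - intros t Ht; split.
    + eapply Rderiv_eq; [apply Rderiv_minus; [|apply Rderiv_const]|].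
      * apply (is_derive_comp F (fun t => u + t) t (r (u + t)) 1); [apply DF; lra|auto_derive; trivial; ring].
      * unfold scal; simpl; unfold mult; simpl; ring.
    + split; [left; apply Hpos; lra|]; apply Rle_trans with (1 := LC u (u + t) Hu ltac:(lra)).
      right; fold s; f_equal; f_equal; ring.
  - intros c Hc H; assert (b <= c + F u); [|lra].
    apply Hb2; intros y [t [Ht ->]]; destruct (Rlt_le_dec u t) as [Htu|[Htu| ->]]; [|pose proof (Inc t u Ht Hu Htu); lra|lra].
    pose proof (H (t - u) ltac:(lra)) as K; replace (u + (t - u)) with t in K by ring; lra. }
set (X := F u - a) in *; set (Y := b - F u) in *.
assert (HX : 0 < X) by (unfold X; lra); assert (HY : 0 < Y) by (unfold Y; lra).
assert (EXY : b - a = X + Y) by (unfold X, Y; ring).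
assert (Main : 2 * (X * Y) <= r u * (X + Y) * (1 - u ^ 2)).
{ assert (K1 : X * Y * (/ (1 + u) + / (1 - u)) <= r u * (X + Y)).
  { assert (Y * (X * (/ (1 + u) + s / 2)) <= Y * r u) by (apply Rmult_le_compat_l; lra).
    assert (X * (Y * (/ (1 - u) - s / 2)) <= X * r u) by (apply Rmult_le_compat_l; lra).
    lra. }
  apply (Rmult_le_compat_r (1 - u ^ 2)) in K1; [|nra].
  replace (X * Y * (/ (1 + u) + / (1 - u)) * (1 - u ^ 2)) with (2 * (X * Y)) in K1 by (field; lra); exact K1. }
rewrite EXY.
assert (Hx : 0 <= X / (X + Y) <= 1).
{ split; [apply Rlt_le, Rdiv_lt_0_compat; lra|].
  apply Rmult_le_reg_r with (X + Y); [lra|]; unfold Rdiv; rewrite Rmult_assoc, Rinv_l by lra; lra. }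
pose proof (sin_parabola _ Hx) as S.
apply Rle_trans with ((X + Y) * (4 * (X / (X + Y)) * (1 - X / (X + Y)))); [apply Rmult_le_compat_l; lra|].
replace ((X + Y) * (4 * (X / (X + Y)) * (1 - X / (X + Y)))) with (2 * (2 * (X * Y)) / (X + Y)) by (field; lra).
apply Rmult_le_reg_r with (X + Y); [lra|]; unfold Rdiv; rewrite Rmult_assoc, Rinv_l by lra; lra.
Qed.

(** * The Schwarz-Pick inequality *)

(** The derivative [U_x(0)] is a first Fourier coefficient of a function with
    values in (a, b) and, by the mean value property, prescribed mean. It is
    largest when the function is [b] on the arc [|t| < al] and [a] on the
    complement, and the mean determines [al]. *)
Lemma harmonic_schwarz U a b :
  Ck_on 2 D U -> (forall z, D z -> laplacian U z = 0) -> (forall z, D z -> a < U z < b) ->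
  partial_x U 0 <= 2 * (b - a) / PI * sin (PI * ((U 0 - a) / (b - a))).
Proof.
intros HU HL HB; assert (P := PI_RGT_0).
assert (D0 : D 0) by (unfold disk, dist2; simpl; lra).
destruct (HB 0 D0) as [B1 B2].
set (x := (U 0 - a) / (b - a)).
assert (Hx : 0 < x < 1).
{ unfold x; split; [apply Rdiv_lt_0_compat; lra|].
  apply Rmult_lt_reg_r with (b - a); [lra|]; unfold Rdiv; rewrite Rmult_assoc, Rinv_l by lra; lra. }
assert (Ex : U 0 - a = (b - a) * x) by (unfold x; field; lra).
set (al := PI * x); assert (Hal : 0 < al < PI) by (unfold al; nra).
assert (Hsin : 0 < sin al) by (apply sin_gt_0; lra).
assert (HK : forall z, D z -> Rabs (laplacian U z) <= 0) by (intros z Hz; rewrite HL, Rabs_R0; [lra|exact Hz]).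
assert (Main : forall r, 0 < r < 1 -> r * partial_x U 0 <= 2 * (b - a) / PI * sin al).
{ intros r Hr; assert (Hr1 : -1 < r < 1) by lra.
  pose proof (circle_mean U HU 0 HK r Hr) as M0; pose proof (circle_first_mode U HU 0 HK r Hr) as M1.
  apply Rabs_le_between in M0; apply Rabs_le_between in M1.
  set (v := fun t => U (polar (r, t))) in *.
  assert (Cv : forall t, continuous v t).
  { intros t; apply (Rc_of_C (fun w => U (polar w))), polar_comp_continuous.
    apply (Ck_continuous 2 D); [exact HU|apply polar_unit, Hr1]. }
  assert (Bv : forall t, a < v t < b) by (intros t; apply HB, polar_unit, Hr1).
  set (k := fun t => (v t - a) * (cos t - cos al)).
  assert (Ck : forall t, continuous k t).
  { intros t; apply Rc_mult; apply Rc_minus; auto; try apply Rc_const; apply Rc_cos. }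
  assert (Ec : RInt cos (- PI) PI = 0).
  { apply (RInt_periodic_derivative sin cos); [apply Rderiv_sin|apply Rc_cos|rewrite sin_neg, sin_PI; ring]. }
  assert (E1 : RInt k (- PI) PI = RInt (fun t => v t * cos t) (- PI) PI - cos al * RInt v (- PI) PI
     + 2 * PI * a * cos al).
  { assert (Evc : ex_RInt (fun t => v t * cos t) (- PI) PI) by (apply ex_RInt_Rcont; intros t; apply Rc_mult; [apply Cv|apply Rc_cos]).
    assert (Ev : ex_RInt v (- PI) PI) by (apply ex_RInt_Rcont, Cv).
    assert (Eco : ex_RInt cos (- PI) PI) by (apply ex_RInt_Rcont; intros t; apply Rc_cos).
    transitivity (RInt (fun t => (v t * cos t - cos al * v t) - (a * cos t - a * cos al)) (- PI) PI).
    - apply RInt_ext; intros t _; unfold k; simpl; ring.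
    - rewrite !RInt_minus_R, !RInt_scal_R, Ec, RInt_const.
      { unfold scal; simpl; unfold mult; simpl; ring. }
      all: apply ex_RInt_Rcont; intros t; repeat match goal with
        | |- continuous (fun _ => _ - _) _ => apply Rc_minus
        | |- continuous (fun _ => _ * _) _ => first [apply Rc_const | apply Rc_mult]
        | _ => first [apply Rc_const | apply Rc_cos | apply Cv]
        end. }
  assert (Ek : forall c d, ex_RInt k c d) by (intros; apply ex_RInt_Rcont, Ck).
  assert (E2 : RInt k (- PI) PI = RInt k (- PI) (- al) + RInt k (- al) al + RInt k al PI).
  { rewrite (RInt_Chasles_R k (- PI) al PI), (RInt_Chasles_R k (- PI) (- al) al) by apply Ek.
    reflexivity. }
  assert (Neg : forall c d, c <= d -> (forall t, c <= t <= d -> k t <= 0) -> RInt k c d <= 0).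
  { intros c d Hcd H; apply Rle_trans with (RInt (fun _ => 0) c d).
    - apply RInt_le; [exact Hcd|apply Ek|apply ex_RInt_const|intros t Ht; apply H; lra].
    - rewrite RInt_const; unfold scal; simpl; unfold mult; simpl; lra. }
  assert (N1 : RInt k al PI <= 0).
  { apply Neg; [lra|]; intros t Ht; pose proof (Bv t).
    assert (cos t <= cos al) by (apply cos_decr_1; lra); unfold k; nra. }
  assert (N2 : RInt k (- PI) (- al) <= 0).
  { apply Neg; [lra|]; intros t Ht; pose proof (Bv t).
    assert (cos t <= cos al) by (rewrite <- cos_neg; apply cos_decr_1; lra); unfold k; nra. }
  assert (N3 : RInt k (- al) al <= (b - a) * (2 * sin al - 2 * al * cos al)).
  { assert (Cc : forall t, continuous (fun t => (b - a) * (cos t - cos al)) t).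
    { intros t; apply Rc_mult; [apply Rc_const|apply Rc_minus; [apply Rc_cos|apply Rc_const]]. }
    apply Rle_trans with (RInt (fun t => (b - a) * (cos t - cos al)) (- al) al).
    - apply RInt_le; [lra|apply Ek|apply ex_RInt_Rcont, Cc|].
      intros t Ht; unfold k; apply Rmult_le_compat_r; [|pose proof (Bv t); lra].
      assert (cos al <= cos t); [|lra].
      destruct (Rle_lt_dec 0 t); [apply cos_decr_1; lra|rewrite <- (cos_neg t); apply cos_decr_1; lra].
    - right; assert (I : is_RInt (fun t => (b - a) * (cos t - cos al)) (- al) al
        (minus ((fun t => (b - a) * (sin t - t * cos al)) al) ((fun t => (b - a) * (sin t - t * cos al)) (- al)))).
      { apply (is_RInt_derive (V := R_CompleteNormedModule) (fun t => (b - a) * (sin t - t * cos al))).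
        - intros t _; auto_derive; trivial; ring.
        - intros t _; apply Cc. }
      rewrite (is_RInt_unique _ _ _ _ I); unfold minus, plus, opp; simpl; rewrite sin_neg; ring. }
  assert (Ev : RInt v (- PI) PI = 2 * PI * U 0) by lra.
  assert (Em : RInt (fun t => v t * cos t) (- PI) PI = PI * r * partial_x U 0).
  { change (fun t => v t * cos t) with (fun t => U (polar (r, t)) * cos t); lra. }
  rewrite Ev, Em in E1.
  assert (K : PI * r * partial_x U 0 <= 2 * (b - a) * sin al).
  { assert (PI * r * partial_x U 0 = RInt k (- PI) PI + 2 * PI * cos al * (U 0 - a)) by (rewrite E1; ring).
    rewrite H, Ex.
    replace (2 * PI * cos al * ((b - a) * x)) with ((b - a) * (2 * al * cos al)) by (unfold al; ring).
    lra. }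
  apply Rmult_le_reg_l with PI; [exact P|].
  replace (PI * (2 * (b - a) / PI * sin al)) with (2 * (b - a) * sin al) by (field; lra); lra. }
apply Rnot_lt_le; intros Hlt.
set (S := 2 * (b - a) / PI * sin al) in *.
assert (HS : 0 < S) by (apply Rmult_lt_0_compat; [apply Rdiv_lt_0_compat; lra|exact Hsin]).
fold al S in Hlt.
assert (Hr : 0 < (S + partial_x U 0) / (2 * partial_x U 0) < 1).
{ split; [apply Rdiv_lt_0_compat; lra|].
  apply Rmult_lt_reg_r with (2 * partial_x U 0); [lra|].
  unfold Rdiv; rewrite Rmult_assoc, Rinv_l by lra; lra. }
specialize (Main _ Hr).
replace ((S + partial_x U 0) / (2 * partial_x U 0) * partial_x U 0) with ((S + partial_x U 0) / 2) in Main by (field; lra).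
lra.
Qed.

(** ** Automorphisms of the disk *)

(** The automorphism taking 0 to [z0], preceded by the rotation by [c]. *)
Definition moebius (c z0 w : C) : C := ((z0 + c * w) / (1 + Cconj z0 * c * w))%C.

Lemma Cmod_Cconj z : Cmod (Cconj z) = Cmod z.
Proof. unfold Cmod, Cconj; simpl; f_equal; ring. Qed.

Lemma moebius_denominator c z0 w : Cmod c = 1 -> D z0 -> D w -> (1 + Cconj z0 * c * w)%C <> 0.
Proof.
intros Hc Hz Hw E; apply disk0_Cmod in Hz; [|lra]; apply disk0_Cmod in Hw; [|lra].
assert (N : Cmod (Cconj z0 * c * w)%C < 1).
{ rewrite !Cmod_mult, Cmod_Cconj, Hc, Rmult_1_r; pose proof (Cmod_ge_0 z0); pose proof (Cmod_ge_0 w); nra. }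
assert (E' : (Cconj z0 * c * w)%C = (- (1))%C).
{ replace (Cconj z0 * c * w)%C with ((1 + Cconj z0 * c * w) - 1)%C by ring; rewrite E; ring. }
rewrite E', Cmod_opp, Cmod_1 in N; lra.
Qed.

Lemma moebius_holo c z0 w : Cmod c = 1 -> D z0 -> D w ->
  holo_at (moebius c z0) w
    ((c * (1 + Cconj z0 * c * w) - (z0 + c * w) * (Cconj z0 * c)) /
     ((1 + Cconj z0 * c * w) * (1 + Cconj z0 * c * w)))%C.
Proof.
intros Hc Hz Hw; apply (holo_at_div (fun w => z0 + c * w)%C (fun w => 1 + Cconj z0 * c * w)%C).
- apply moebius_denominator; assumption.
- apply holo_at_affine.
- apply holo_at_affine.
Qed.

Lemma moebius_disk c z0 w : Cmod c = 1 -> D z0 -> D w -> D (moebius c z0 w).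
Proof.
intros Hc Hz Hw; pose proof (moebius_denominator c z0 w Hc Hz Hw) as N.
apply disk0_Cmod; [lra|]; unfold moebius; rewrite Cmod_div by exact N.
apply Cmod_gt_0 in N; apply Rmult_lt_reg_r with (Cmod (1 + Cconj z0 * c * w)); [exact N|].
unfold Rdiv; rewrite Rmult_assoc, Rinv_l, Rmult_1_r, Rmult_1_l by lra.
unfold disk in Hz, Hw; rewrite dist2_0_Cmod in Hz, Hw.
assert (E : Cmod (1 + Cconj z0 * c * w) ^ 2 - Cmod (z0 + c * w) ^ 2 = (1 - Cmod z0 ^ 2) * (1 - Cmod w ^ 2)).
{ assert (C1 : fst c ^ 2 + snd c ^ 2 = 1) by (rewrite <- Cmod_sqr, Hc; ring).
  rewrite !Cmod_sqr; destruct z0 as [x y], c as [c1 c2], w as [u v]; simpl in *.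
  transitivity ((1 - (x * x + y * y)) * (1 - (c1 * (c1 * 1) + c2 * (c2 * 1)) * (u * u + v * v))).
  - assert (H : c1 * c1 + c2 * c2 = 1) by lra. 
    transitivity (1 - (x * x + y * y) - (c1 * c1 + c2 * c2) * (u * u + v * v) * (1 - (x * x + y * y))); ring.
  - rewrite C1; ring. }
pose proof (Cmod_ge_0 (z0 + c * w)).
assert (0 < (1 - Cmod z0 ^ 2) * (1 - Cmod w ^ 2)) by (apply Rmult_lt_0_compat; lra).
nra.
Qed.

(** A disk automorphism moves the point to the center of the covering disk and the
    direction [e] to the real axis; [complete_density_bound] compares the metric
    of the disk with [lam]. *)
Lemma harmonic_gradient Y lam p h a b y e :
  plane_domain Y -> hyperbolic_metric Y lam -> holo_on D p -> covering_map unit_disk Y p ->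
  Ck_on 2 Y h -> (forall z, Y z -> laplacian h z = 0) -> (forall z, Y z -> a < h z < b) ->
  Y y -> Cmod e = 1 ->
  partial_x h y * fst e + partial_y h y * snd e
  <= 2 * (b - a) / PI * sin (PI * ((h y - a) / (b - a))) * lam y.
Proof.
intros HYd Hlam Hp Hcov Hh HL HB Hy He; assert (P := PI_RGT_0).
destruct (proj1 (proj2 Hcov) y Hy) as (z0 & Hz0 & Ey); apply unit_disk_disk in Hz0.
pose proof (complete_density_bound Y lam p z0 HYd Hlam Hp Hcov Hz0) as CB.
pose proof (covering_derivative_neq_0 Y p z0 Hp Hcov Hz0) as Hd.
set (d := cderiv p z0) in *.
assert (Hdm : 0 < Cmod d) by (apply Cmod_gt_0, Hd).
set (c := (e * RtoC (Cmod d) / d)%C).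
assert (Hc : Cmod c = 1).
{ unfold c; rewrite Cmod_div, Cmod_mult, Cmod_R, He, Rabs_pos_eq by (assumption || lra); field; lra. }
set (q := fun w => p (moebius c z0 w)).
assert (Hq : holo_on D q).
{ apply holo_on_intro; intros w Hw; eexists.
  apply (holo_at_comp p (moebius c z0)); [apply Hp, moebius_disk; assumption|apply moebius_holo; assumption]. }
assert (DqY : forall w, D w -> Y (q w)).
{ intros w Hw; apply Hcov, unit_disk_disk, moebius_disk; assumption. }
assert (D0 : D 0) by (unfold disk, dist2; simpl; lra).
assert (M0 : moebius c z0 0 = z0) by (unfold moebius; field; intros E; apply (f_equal fst) in E; simpl in E; lra).
assert (q0 : q 0 = y) by (unfold q; rewrite M0; exact Ey).
assert (E1 : (1 + Cconj z0 * c * 0)%C = 1) by ring.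
assert (q'0 : cderiv q 0 = (RtoC (Cmod d * (1 - dist2 0 z0)) * e)%C).
{ apply holo_at_cderiv; eapply holo_at_eq.
  - apply (holo_at_comp p (moebius c z0)); [rewrite M0; apply Hp, Hz0|apply moebius_holo; assumption].
  - fold d; rewrite E1.
    replace (z0 + c * 0)%C with z0 by ring.
    assert (Zz : (z0 * Cconj z0)%C = RtoC (dist2 0 z0)).
    { apply C_ext; unfold dist2; destruct z0; simpl; ring. }
    assert (dc : (d * c = e * RtoC (Cmod d))%C) by (unfold c; field; exact Hd).
    replace (d * ((c * 1 - z0 * (Cconj z0 * c)) / (1 * 1)))%C with (d * c * (1 - z0 * Cconj z0))%C by field.
    rewrite dc, Zz, RtoC_mult, RtoC_minus; ring. }
destruct (C2_comp_holo D Y h q (open_disk 0 1) (proj1 HYd) Hq DqY Hh) as (U1 & U2 & U3).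
pose proof (harmonic_schwarz (fun z => h (q z)) a b U1) as HS.
rewrite (proj1 (U2 0 D0)), q0, q'0 in HS.
set (g := partial_x h y * fst e + partial_y h y * snd e).
set (S := 2 * (b - a) / PI * sin (PI * ((h y - a) / (b - a)))) in *.
assert (G : Cmod d * (1 - dist2 0 z0) * g <= S).
{ replace (Cmod d * (1 - dist2 0 z0) * g) with
    (partial_x h y * fst (RtoC (Cmod d * (1 - dist2 0 z0)) * e)%C +
     partial_y h y * snd (RtoC (Cmod d * (1 - dist2 0 z0)) * e)%C) by (unfold g; simpl; ring).
  apply HS.
  - intros z Hz; rewrite (U3 z Hz), HL by (apply DqY, Hz); ring.
  - intros z Hz; apply HB, DqY, Hz. }
assert (HlamY : 0 < lam y) by (apply (proj1 (proj1 Hlam)), Hy).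
rewrite Ey in CB.
destruct (Rle_lt_dec g 0) as [Hg|Hg].
- assert (0 <= S).
  { destruct (HB y Hy); apply Rmult_le_pos; [apply Rlt_le, Rdiv_lt_0_compat; lra|].
    assert (0 < (h y - a) / (b - a) < 1).
    { split; [apply Rdiv_lt_0_compat; lra|].
      apply Rmult_lt_reg_r with (b - a); [lra|]; unfold Rdiv; rewrite Rmult_assoc, Rinv_l by lra; lra. }
    apply sin_ge_0; nra. }
  apply Rle_trans with (1 := Hg), Rmult_le_pos; lra.
- apply Rle_trans with (g * ((1 - dist2 0 z0) * (lam y * Cmod d))); [nra|].
  replace (g * ((1 - dist2 0 z0) * (lam y * Cmod d))) with (Cmod d * (1 - dist2 0 z0) * g * lam y) by ring.
  apply Rmult_le_compat_r; lra.
Qed.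

Lemma artanh_derive x : -1 < x < 1 -> is_derive artanh x (/ (1 - x ^ 2)).
Proof.
intros Hx; unfold artanh; auto_derive.
- split; [lra|split; [apply Rdiv_lt_0_compat; lra|trivial]].
- field; nra.
Qed.

Lemma disk_dist_real x y : -1 < x < 1 -> -1 < y < 1 ->
  disk_dist (RtoC x) (RtoC y) = Rabs (artanh x - artanh y).
Proof.
intros Hx Hy; unfold disk_dist.
assert (Hp : 0 < 1 - x * y) by nra.
assert (E1 : Cmod (RtoC x - RtoC y) = Rabs (x - y)) by (rewrite <- RtoC_minus; apply Cmod_R).
assert (E2 : Cmod (1 - RtoC x * Cconj (RtoC y)) = 1 - x * y).
{ replace (1 - RtoC x * Cconj (RtoC y))%C with (RtoC (1 - x * y)) by (apply C_ext; simpl; ring).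
  rewrite Cmod_R, Rabs_pos_eq; lra. }
rewrite E1, E2.
assert (Q : forall x y, -1 < x < 1 -> -1 < y < 1 -> y <= x ->
  artanh ((x - y) / (1 - x * y)) = artanh x - artanh y /\ 0 <= artanh x - artanh y).
{ clear x y Hx Hy Hp E1 E2; intros x y Hx Hy Hxy; assert (Hp : 0 < 1 - x * y) by nra; unfold artanh.
  assert (L : / 2 * ln ((1 + x) / (1 - x)) - / 2 * ln ((1 + y) / (1 - y)) =
    / 2 * ln ((1 + x) / (1 - x) * / ((1 + y) / (1 - y)))).
  { rewrite ln_mult, ln_Rinv; try ring; try apply Rinv_0_lt_compat; apply Rdiv_lt_0_compat; lra. }
  rewrite L; split.
  - f_equal; f_equal; field; repeat split; nra.
  - apply Rmult_le_pos; [lra|]; rewrite <- ln_1; apply ln_le; [lra|].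
    replace ((1 + x) / (1 - x) * / ((1 + y) / (1 - y))) with ((1 + x) * (1 - y) / ((1 - x) * (1 + y))) by (field; lra).
    assert (0 < (1 - x) * (1 + y)) by nra.
    apply Rmult_le_reg_r with ((1 - x) * (1 + y)); [assumption|].
    unfold Rdiv; rewrite Rmult_assoc, Rinv_l by lra; nra. }
destruct (Rle_lt_dec y x) as [H|H].
- rewrite (Rabs_pos_eq (x - y)) by lra; destruct (Q x y Hx Hy H) as [-> K]; rewrite Rabs_pos_eq; lra.
- rewrite Rabs_minus_sym, (Rabs_pos_eq (y - x)) by lra.
  rewrite Rabs_minus_sym, (Rmult_comm x y); destruct (Q y x Hy Hx ltac:(lra)) as [-> K]; rewrite Rabs_pos_eq; lra.
Qed.

(* Test with the direction of [(u, v)] itself. *)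
Lemma norm_of_directions u v M : 0 <= M ->
  (forall e, Cmod e = 1 -> u * fst e + v * snd e <= M) -> u ^ 2 + v ^ 2 <= M ^ 2.
Proof.
intros HM H; destruct (classic ((u, v) = RtoC 0)) as [E|N].
- injection E as -> ->; nra.
- apply Cmod_gt_0 in N; set (n := Cmod (u, v)) in *.
  assert (En : n ^ 2 = u ^ 2 + v ^ 2) by apply Cmod_sqr.
  assert (Hn : Cmod (u / n, v / n) = 1).
  { unfold Cmod; simpl; replace (u / n * (u / n * 1) + v / n * (v / n * 1)) with ((u ^ 2 + v ^ 2) / n ^ 2) by (field; lra).
    rewrite <- En; replace (n ^ 2 / n ^ 2) with 1 by (field; lra); apply sqrt_1. }
  specialize (H _ Hn); simpl in H.
  replace (u * (u / n) + v * (v / n)) with ((u ^ 2 + v ^ 2) / n) in H by (field; lra).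
  rewrite <- En in H |- *; replace (n ^ 2 / n) with n in H by (field; lra); apply pow_incr; lra.
Qed.

(** The composition [F o f] with a primitive [F] of [r] is harmonic, because
    [F'' / F' = r' / r]. Its gradient bound is in terms of a sine profile, which
    [log_concave_profile] converts into [1 - f ^ 2], the inverse of the derivative
    of [artanh] at [f]. *)
Theorem rho_harmonic_contraction (Omega : C -> Prop) (lam : C -> R) (r : R -> R) (f : C -> R) z w :
  hyperbolic_domain Omega -> hyperbolic_metric Omega lam ->
  (forall t, -1 < t < 1 -> 0 < r t) -> smooth_on_unit_interval r ->
  (forall w : C, -1 < Re w < 1 -> 0 <= gaussian_curvature (strip_density r) w) ->
  rho_harmonic Omega r f -> Omega z -> Omega w ->
  disk_dist (RtoC (f z)) (RtoC (f w)) <= 4 / PI * metric_dist Omega lam z w.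
Proof.
intros [HYd [p [Hhol Hcov]]] Hlam Hpos Hsm Hcurv (Hf1 & Hf2 & Hf3) Hz Hw; assert (P := PI_RGT_0).
assert (Hp : holo_on D p).
{ apply holo_on_intro; intros v Hv; apply holo_at_of_C_derive, Hhol, unit_disk_disk, Hv. }
assert (HY : open Omega) by apply HYd.
destruct (log_concave_profile r Hpos Hsm Hcurv) as (F & a & b & HF).
destruct (C2_fun Omega F r (Derive r) f HY Hf2) as (h1 & h2 & h3).
{ intros v Hv; pose proof (Hf1 v Hv) as B; split; [apply HF, B|split].
  - apply Derive_correct; exact (Hsm 1%nat _ B).
  - apply (ex_derive_continuous (Derive r)); exact (Hsm 2%nat _ B). }
assert (Hnn : nonneg_continuous_on Omega lam).
{ intros v Hv; destruct Hlam as [[H1 H2] _]; split; [left; apply H1, Hv|apply (Ck_continuous 0 Omega); [apply H2|exact Hv]]. }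
assert (GB : gradient_bound Omega lam (4 / PI) (fun v => artanh (f v))).
{ intros v Hv; pose proof (Hf1 v Hv) as B; pose proof (Hpos _ B) as Pr.
  assert (B2 : 0 < 1 - f v ^ 2) by nra.
  eexists; eexists; split.
  - apply (has_grad_fun artanh); [apply artanh_derive, B|apply (Ck_on_grad 1 Omega); assumption].
  - assert (Lv : 0 < lam v) by (apply (proj1 (proj1 Hlam)), Hv).
    assert (K : partial_x f v ^ 2 + partial_y f v ^ 2 <= (4 / PI * lam v * (1 - f v ^ 2)) ^ 2).
    { apply norm_of_directions.
      - apply Rmult_le_pos; [apply Rmult_le_pos; [apply Rlt_le, Rdiv_lt_0_compat|]|]; lra.
      - intros e He.
        pose proof (harmonic_gradient Omega lam p (fun v => F (f v)) a b v e HYd Hlam Hp Hcov h1) as G.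
        rewrite (proj1 (h2 v Hv)), (proj2 (h2 v Hv)) in G.
        assert (G' : r (f v) * partial_x f v * fst e + r (f v) * partial_y f v * snd e <=
          2 * (b - a) / PI * sin (PI * ((F (f v) - a) / (b - a))) * lam v).
        { apply G; auto.
          - intros u Hu; rewrite (h3 u Hu); pose proof (Hf3 u Hu) as Q; pose proof (Hpos _ (Hf1 u Hu)).
            transitivity (r (f u) * (laplacian f u + Derive r (f u) / r (f u) * grad_norm_sqr f u)).
            + field; lra.
            + rewrite Q; ring.
          - intros u Hu; apply (HF _ (Hf1 u Hu)). }
        destruct (HF _ B) as (_ & _ & PB).
        apply Rmult_le_reg_l with (r (f v)); [exact Pr|].
        replace (r (f v) * (partial_x f v * fst e + partial_y f v * snd e))
          with (r (f v) * partial_x f v * fst e + r (f v) * partial_y f v * snd e) by ring.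
        apply Rle_trans with (1 := G').
        replace (r (f v) * (4 / PI * lam v * (1 - f v ^ 2))) with (2 / PI * lam v * (2 * r (f v) * (1 - f v ^ 2))) by (field; lra).
        replace (2 * (b - a) / PI * sin (PI * ((F (f v) - a) / (b - a))) * lam v)
          with (2 / PI * lam v * ((b - a) * sin (PI * ((F (f v) - a) / (b - a))))) by (field; destruct (HF _ B) as (_ & ? & _); lra).
        apply Rmult_le_compat_l; [apply Rmult_le_pos; [apply Rlt_le, Rdiv_lt_0_compat|]; lra|exact PB]. }
    replace ((/ (1 - f v ^ 2) * partial_x f v) ^ 2 + (/ (1 - f v ^ 2) * partial_y f v) ^ 2)
      with (/ (1 - f v ^ 2) ^ 2 * (partial_x f v ^ 2 + partial_y f v ^ 2)) by (field; lra).
    replace ((4 / PI * lam v) ^ 2) with (/ (1 - f v ^ 2) ^ 2 * (4 / PI * lam v * (1 - f v ^ 2)) ^ 2) by (field; lra).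
    apply Rmult_le_compat_l; [apply Rlt_le, Rinv_0_lt_compat, pow_lt, B2|exact K]. }
rewrite disk_dist_real by (apply Hf1; assumption).
apply Rmult_le_reg_l with (PI / 4); [lra|].
replace (PI / 4 * (4 / PI * metric_dist Omega lam z w)) with (metric_dist Omega lam z w) by (field; lra).
apply metric_dist_ge; [exact Hnn|apply path_exists; assumption|]; intros L HL.
assert (H4 : 0 <= 4 / PI) by (apply Rlt_le, Rdiv_lt_0_compat; lra).
pose proof (gradient_bound_path Omega lam _ _ z w L Hnn H4 GB HL) as G; rewrite Rabs_minus_sym in G.
apply Rmult_le_reg_l with (4 / PI); [apply Rdiv_lt_0_compat; lra|].
replace (4 / PI * (PI / 4 * Rabs (artanh (f z) - artanh (f w)))) with (Rabs (artanh (f z) - artanh (f w))) by (field; lra).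
exact G.
Qed.

(** * Sharpness *)

Definition poincare (z : C) : R := / (1 - dist2 0 z).

Lemma open_unit_disk : open unit_disk.
Proof.
intros z Hz; apply unit_disk_disk in Hz.
apply filter_imp with (2 := open_locally _ _ (open_disk 0 1) Hz); intros w Hw; apply unit_disk_disk, Hw.
Qed.

Lemma unit_disk_seg z w t : unit_disk z -> unit_disk w -> 0 <= t <= 1 -> unit_disk (seg z w t).
Proof.
intros Hz Hw Ht; unfold unit_disk.
replace (seg z w t) with (RtoC (1 - t) * z + RtoC t * w)%C by (apply C_ext; simpl; ring).
apply Rle_lt_trans with (1 := Cmod_triangle _ _).
rewrite !Cmod_mult, !Cmod_R, !Rabs_pos_eq by lra; unfold unit_disk in *.
destruct (Req_dec t 0) as [->|H]; [lra|].
pose proof (Cmod_ge_0 z); assert (t * Cmod w < t * 1) by (apply Rmult_lt_compat_l; lra).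
assert ((1 - t) * Cmod z <= (1 - t) * 1) by (apply Rmult_le_compat_l; lra); lra.
Qed.

Lemma unit_disk_domain : plane_domain unit_disk.
Proof.
split; [exact open_unit_disk|split].
- intros U V HU HV Hcov Hdis (z & Hz & Uz) (w & Hw & Vw).
  apply (Hdis w Hw); [|exact Vw].
  rewrite <- (seg_1 z w); rewrite <- (seg_0 z w) in Uz.
  apply (interval_connected (fun t => U (seg z w t))); [|exact Uz].
  intros t Ht; pose proof (unit_disk_seg z w t Hz Hw Ht) as Dt.
  pose proof (seg_locally unit_disk z w t open_unit_disk Dt) as L.
  destruct (Hcov _ Dt) as [Ut|Vt].
  + apply filter_imp with (2 := seg_locally U z w t HU Ut); tauto.
  + apply filter_imp with (2 := filter_and _ _ L (seg_locally V z w t HV Vt)).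
    intros s [Ds Vs]; split; intros Us; [contradiction (Hdis _ Ds Us Vs)|contradiction (Hdis _ Dt Us Vt)].
- exists 0; unfold unit_disk; rewrite Cmod_0; lra.
Qed.

Lemma unit_disk_hyperbolic : hyperbolic_domain unit_disk.
Proof.
split; [exact unit_disk_domain|]; exists (fun z => z); split.
- intros z _; exists (RtoC 1); split; [apply (is_linear_scal_l (K := C_AbsRing) (V := C_NormedModule))|].
  intros x _ eps; apply filter_forall; intros y.
  match goal with |- norm ?a <= _ => replace a with (zero : C_NormedModule) end.
  + rewrite norm_zero; apply Rmult_le_pos; [apply Rlt_le, cond_pos|apply norm_ge_0].
  + unfold minus, plus, opp, scal, zero; simpl; unfold mult; simpl; apply C_ext; simpl; ring.
- split; [auto|split; [intros w Hw; exists w; auto|]].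
  intros w Hw; exists unit_disk; split; [exact open_unit_disk|split; [exact Hw|split; [auto|]]].
  exists unit, (fun _ => unit_disk), (fun _ z => z).
  split; [intros _; exact open_unit_disk|split; [|split; [|split]]].
  + intros z; split; [intros [Hz _]; exists tt; exact Hz|intros [_ Hz]; auto].
  + intros [] [] _ _ _; reflexivity.
  + intros _ z Hz; split; [apply continuous_id|reflexivity].
  + intros _ z Hz; split; [apply continuous_id|split; [exact Hz|reflexivity]].
Qed.

Lemma unit_disk_pos z : unit_disk z -> 0 < 1 - dist2 0 z <= 1.
Proof.
intros Hz; apply unit_disk_disk in Hz; destruct (density_bounds z Hz) as [B1 B2].
assert (0 <= dist2 0 z) by (rewrite dist2_0_Cmod; apply pow2_ge_0); lra.
Qed.

Lemma poincare_grad z : unit_disk z ->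
  has_grad poincare z (2 * fst z * poincare z ^ 2) (2 * snd z * poincare z ^ 2).
Proof.
intros Hz; pose proof (unit_disk_pos z Hz) as B; unfold poincare.
eapply has_grad_eq.
- apply (has_grad_inv (fun z => 1 - dist2 0 z)); [lra|].
  apply has_grad_minus; [apply has_grad_const|apply has_grad_dist2].
- simpl; field; lra.
- simpl; field; lra.
Qed.

(** Polynomials in the coordinates and the hyperbolic density: they are closed
    under both partial derivatives, hence smooth. *)
Inductive disk_expr : Type :=
  | EConst (k : R) | EX | EY | EDensity | EAdd (a b : disk_expr) | EMul (a b : disk_expr).

Fixpoint eval_expr (e : disk_expr) (z : C) : R :=
  match e with
  | EConst k => k | EX => fst z | EY => snd z | EDensity => poincare z
  | EAdd a b => eval_expr a z + eval_expr b z
  | EMul a b => eval_expr a z * eval_expr b z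
  end.

Fixpoint diff_expr (x : bool) (e : disk_expr) : disk_expr :=
  match e with
  | EConst _ => EConst 0
  | EX => EConst (if x then 1 else 0)
  | EY => EConst (if x then 0 else 1)
  | EDensity => EMul (EMul (EConst 2) (if x then EX else EY)) (EMul EDensity EDensity)
  | EAdd a b => EAdd (diff_expr x a) (diff_expr x b)
  | EMul a b => EAdd (EMul (diff_expr x a) b) (EMul a (diff_expr x b))
  end.

Lemma eval_expr_grad e z : unit_disk z ->
  has_grad (eval_expr e) z (eval_expr (diff_expr true e) z) (eval_expr (diff_expr false e) z).
Proof.
intros Hz; induction e as [k| | | |a IHa b IHb|a IHa b IHb]; simpl.
- apply has_grad_const.
- apply has_grad_Re.
- apply has_grad_Im.
- eapply has_grad_eq; [apply poincare_grad, Hz|ring|ring].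
- apply has_grad_plus; assumption.
- apply has_grad_mult; assumption.
Qed.

Lemma eval_expr_smooth e : smooth_on unit_disk (eval_expr e).
Proof.
intros k; revert e; induction k as [|k IH]; intros e.
- split; [|trivial]; intros z Hz; apply (has_grad_continuous _ _ _ _ (eval_expr_grad e z Hz)).
- apply (Ck_on_intro k unit_disk _ (eval_expr (diff_expr true e)) (eval_expr (diff_expr false e)));
    [exact open_unit_disk|intros z Hz; apply eval_expr_grad, Hz|apply IH|apply IH].
Qed.

Lemma poincare_density : conformal_density unit_disk poincare.
Proof.
split; [|exact (eval_expr_smooth EDensity)].
intros z Hz; apply Rinv_0_lt_compat; apply (unit_disk_pos z Hz).
Qed.

Lemma laplacian_ext_on (X : C -> Prop) u v z :
  open X -> (forall w, X w -> u w = v w) -> X z -> laplacian u z = laplacian v z.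
Proof.
intros HX H Hz; unfold laplacian; f_equal.
- apply (partial_x_ext_on X); auto; intros w Hw; apply (partial_x_ext_on X); auto.
- apply (partial_y_ext_on X); auto; intros w Hw; apply (partial_y_ext_on X); auto.
Qed.

Lemma poincare_curvature z : unit_disk z -> gaussian_curvature poincare z = -4.
Proof.
intros Hz; unfold gaussian_curvature.
rewrite (laplacian_ext_on unit_disk _ (fun z => - ln (1 ^ 2 - dist2 0 z)) z open_unit_disk); [|
  intros w Hw; unfold poincare; rewrite ln_Rinv, pow1 by (apply unit_disk_pos, Hw); reflexivity|exact Hz].
rewrite (proj2 (poincare_C2 1 Rlt_0_1) z) by (apply unit_disk_disk, Hz).
pose proof (unit_disk_pos z Hz); unfold poincare; rewrite pow1; field; lra.
Qed.

Lemma poincare_nonneg_continuous : nonneg_continuous_on unit_disk poincare.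
Proof.
intros z Hz; split; [left; apply poincare_density, Hz|].
apply (has_grad_continuous _ _ _ _ (poincare_grad z Hz)).
Qed.

Lemma poincare_lipschitz b z w :
  gradient_bound unit_disk poincare 1 b -> unit_disk z -> unit_disk w ->
  Rabs (b w - b z) <= metric_dist unit_disk poincare z w.
Proof.
intros Hb Hz Hw; apply metric_dist_ge; [exact poincare_nonneg_continuous| |].
- apply path_exists; [exact unit_disk_domain|exact Hz|exact Hw].
- intros l Hl.
  pose proof (gradient_bound_path _ _ 1 b z w l poincare_nonneg_continuous Rle_0_1 Hb Hl); lra.
Qed.

Lemma poincare_ge_1 z : unit_disk z -> 1 <= poincare z.
Proof.
intros Hz; pose proof (unit_disk_pos z Hz); unfold poincare.
rewrite <- Rinv_1 at 1; apply Rinv_le_contravar; lra.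
Qed.

Lemma gradient_bound_fst : gradient_bound unit_disk poincare 1 fst.
Proof.
intros z Hz; exists 1, 0; split; [apply has_grad_Re|].
pose proof (poincare_ge_1 z Hz); nra.
Qed.

Lemma gradient_bound_snd : gradient_bound unit_disk poincare 1 snd.
Proof.
intros z Hz; exists 0, 1; split; [apply has_grad_Im|].
pose proof (poincare_ge_1 z Hz); nra.
Qed.

(** This exhaustion function of the disk keeps Cauchy sequences in a compact
    subset. *)
Lemma gradient_bound_exhaustion :
  gradient_bound unit_disk poincare 1 (fun z => - / 2 * ln (1 - dist2 0 z)).
Proof.
intros z Hz; pose proof (unit_disk_pos z Hz) as B.
exists (fst z * poincare z), (snd z * poincare z); split.
- eapply has_grad_eq.
  + apply has_grad_scal, (has_grad_ln (fun z => 1 - dist2 0 z)); [lra|].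
    apply has_grad_minus; [apply has_grad_const|apply has_grad_dist2].
  + unfold poincare; simpl; field; lra.
  + unfold poincare; simpl; field; lra.
- replace ((fst z * poincare z) ^ 2 + (snd z * poincare z) ^ 2) with (dist2 0 z * poincare z ^ 2)
    by (unfold dist2; simpl; ring).
  rewrite Rmult_1_l; pose proof (pow2_ge_0 (poincare z)).
  rewrite <- (Rmult_1_l (poincare z ^ 2)) at 2; apply Rmult_le_compat_r; lra.
Qed.

Lemma poincare_segment_bound z w d : unit_disk z -> unit_disk w -> 0 < d ->
  d <= 1 - dist2 0 z -> d <= 1 - dist2 0 w ->
  metric_dist unit_disk poincare z w <= / d * Cmod (w - z).
Proof.
intros Hz Hw Hd Bz Bw.
destruct (segment_arc unit_disk poincare z w (/ d * Cmod (w - z)) open_unit_disk poincare_nonneg_continuous)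
  as [A1 A2].
- intros t Ht; split; [apply unit_disk_seg; assumption|].
  apply Rmult_le_compat_r; [apply Cmod_ge_0|]; unfold poincare; apply Rinv_le_contravar; [exact Hd|].
  (* convexity of the squared norm *)
  assert (E : dist2 0 (seg z w t) = (1 - t) * dist2 0 z + t * dist2 0 w - t * (1 - t) * dist2 z w).
  { unfold dist2, seg; simpl; ring. }
  assert (0 <= t * (1 - t) * dist2 z w).
  { apply Rmult_le_pos; [nra|rewrite dist2_Cmod; apply pow2_ge_0]. }
  nra.
- apply Rle_trans with (arc_length poincare (seg z w) + 0); [|lra].
  apply metric_dist_le; [exact poincare_nonneg_continuous|].
  rewrite <- (seg_0 z w) at 1; apply path_cons; [exact A1|]; rewrite seg_1; apply path_nil, Hw.
Qed.

Lemma poincare_complete : complete_density unit_disk poincare.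
Proof.
intros u Hu HC.
assert (Cauchy : forall b, gradient_bound unit_disk poincare 1 b -> ex_finite_lim_seq (fun n => b (u n))).
{ intros b Hb; apply ex_lim_seq_cauchy_corr; intros eps.
  destruct (HC eps (cond_pos eps)) as [N HN]; exists N; intros n m Hn Hm.
  apply Rle_lt_trans with (2 := HN m n Hm Hn), poincare_lipschitz; auto. }
destruct (Cauchy _ gradient_bound_fst) as [x Hx], (Cauchy _ gradient_bound_snd) as [y Hy].
destruct (HC 1 Rlt_0_1) as [N HN].
set (be := fun z => - / 2 * ln (1 - dist2 0 z)).
set (d := exp (- 2 * (be (u N) + 1))); assert (Hd : 0 < d) by apply exp_pos.
assert (Bd : forall n, (N <= n)%nat -> d <= 1 - dist2 0 (u n)).
{ intros n Hn; pose proof (unit_disk_pos _ (Hu n)) as P.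
  pose proof (poincare_lipschitz be _ _ gradient_bound_exhaustion (Hu N) (Hu n)) as L.
  specialize (HN N n (Nat.le_refl N) Hn); apply Rabs_le_between in L.
  unfold d; rewrite <- (exp_ln (1 - dist2 0 (u n))) by lra.
  assert (ln (1 - dist2 0 (u n)) = -2 * be (u n)) by (unfold be; field).
  rewrite H; left; apply exp_increasing; lra. }
set (z := (x, y) : C).
assert (Bz : d <= 1 - dist2 0 z).
{ assert (L : is_lim_seq (fun n => 1 - (fst (u n) * fst (u n) + snd (u n) * snd (u n))) (1 - (x * x + y * y))).
  { apply is_lim_seq_minus'; [apply is_lim_seq_const|].
    apply is_lim_seq_plus'; apply is_lim_seq_mult'; assumption. }
  replace (1 - dist2 0 z) with (1 - (x * x + y * y)) by (unfold dist2; simpl; ring).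
  refine (is_lim_seq_le_loc (fun _ => d) (fun n => 1 - (fst (u n) * fst (u n) + snd (u n) * snd (u n)))
    (Finite d) (Finite (1 - (x * x + y * y))) _ (is_lim_seq_const d) L).
  exists N; intros n Hn; pose proof (Bd n Hn) as B; unfold dist2 in B; simpl in B; lra. }
assert (Dz : unit_disk z) by (apply unit_disk_disk; unfold disk; lra).
exists z; split; [exact Dz|]; apply is_lim_seq_spec; intros eps.
apply is_lim_seq_spec in Hx; apply is_lim_seq_spec in Hy.
assert (He : 0 < eps * d / 2) by (apply Rdiv_lt_0_compat; [apply Rmult_lt_0_compat; [apply cond_pos|exact Hd]|lra]).
destruct (Hx (mkposreal _ He)) as [N1 H1], (Hy (mkposreal _ He)) as [N2 H2]; simpl in H1, H2.
exists (N + N1 + N2)%nat; intros n Hn.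
pose proof (poincare_segment_bound (u n) z d (Hu n) Dz Hd (Bd n ltac:(lia)) Bz) as B.
assert (P0 : 0 <= metric_dist unit_disk poincare (u n) z).
{ apply Rle_trans with (2 := poincare_lipschitz fst _ _ gradient_bound_fst (Hu n) Dz), Rabs_pos. }
rewrite Rminus_0_r, Rabs_pos_eq by exact P0; apply Rle_lt_trans with (1 := B).
assert (M : Cmod (z - u n) < eps * d).
{ apply Rle_lt_trans with (1 := Cmod_le_Rabs _).
  specialize (H1 n ltac:(lia)); specialize (H2 n ltac:(lia)).
  rewrite Rabs_minus_sym in H1; rewrite Rabs_minus_sym in H2.
  change (Rabs (x - fst (u n)) + Rabs (y - snd (u n)) < eps * d); lra. }
apply Rmult_lt_reg_l with d; [exact Hd|]; rewrite <- Rmult_assoc, Rinv_r, Rmult_1_l by lra; lra.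
Qed.

Lemma poincare_hyperbolic : hyperbolic_metric unit_disk poincare.
Proof.
split; [exact poincare_density|split; [exact poincare_curvature|exact poincare_complete]].
Qed.

(** The extremal function: [2/PI] times the argument of [(1 + z) / (1 - z)],
    which maps the disk onto a strip. *)
Definition strip_function (z : C) : R := 2 / PI * atan (2 * snd z / (1 - dist2 0 z)).

(** The derivative of [log ((1 + z) / (1 - z))]; its imaginary and real parts give
    the gradient of [strip_function]. *)
Definition strip_derivative (z : C) : C := (2 / (1 - z * z))%C.

Lemma one_minus_sqr_neq_0 z : unit_disk z -> (1 - z * z)%C <> 0.
Proof.
intros Hz E; assert (E' : (z * z)%C = 1) by (replace (z * z)%C with (1 - (1 - z * z))%C by ring; rewrite E; ring).
apply (f_equal Cmod) in E'; rewrite Cmod_mult, Cmod_1 in E'; unfold unit_disk in Hz.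
pose proof (Cmod_ge_0 z); nra.
Qed.

Lemma strip_derivative_holo : holo_on unit_disk strip_derivative.
Proof.
apply holo_on_intro; intros z Hz; eexists.
apply (holo_at_div (fun _ => 2%C) (fun z => 1 - z * z)%C); [apply one_minus_sqr_neq_0, Hz|apply holo_at_const|].
apply holo_at_minus; [apply holo_at_const|apply holo_at_mult; apply holo_at_id].
Qed.

Lemma strip_function_grad z : unit_disk z ->
  has_grad strip_function z (2 / PI * snd (strip_derivative z)) (2 / PI * fst (strip_derivative z)).
Proof.
intros Hz; pose proof (unit_disk_pos z Hz) as B; assert (P := PI_RGT_0).
assert (A : forall v, is_derive atan v (/ (1 + v ^ 2))).
{ intros v; apply is_derive_Reals, derivable_pt_lim_atan. }
pose proof (C_norm2_pos _ (one_minus_sqr_neq_0 z Hz)) as N.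
assert (G := has_grad_scal (2 / PI) _ _ _ _ (has_grad_fun atan (fun z => 2 * snd z * / (1 - dist2 0 z)) z _ _ _
  (A _) (has_grad_mult _ _ z _ _ _ _ (has_grad_scal 2 _ _ _ _ (has_grad_Im z))
    (has_grad_inv (fun z => 1 - dist2 0 z) z _ _ ltac:(lra)
       (has_grad_minus _ _ _ _ _ _ _ (has_grad_const 1 z) (has_grad_dist2 0 z)))))).
unfold dist2 in *; destruct z as [x y]; unfold strip_derivative; simpl in *.
eapply has_grad_eq; [exact G| |]; field; repeat split; nra.
Qed.

Lemma strip_function_second_order :
  second_order unit_disk strip_function
    (fun z => 2 / PI * snd (strip_derivative z)) (fun z => 2 / PI * fst (strip_derivative z))
    (fun z => 2 / PI * snd (cderiv strip_derivative z)) (fun z => 2 / PI * fst (cderiv strip_derivative z))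
    (fun z => 2 / PI * fst (cderiv strip_derivative z)) (fun z => 2 / PI * - snd (cderiv strip_derivative z)).
Proof.
intros z Hz; destruct (strip_derivative_holo z Hz) as [H1 H2].
split; [apply strip_function_grad, Hz|split; apply has_grad_scal; assumption].
Qed.

Lemma strip_function_harmonic : rho_harmonic unit_disk (fun _ => 1) strip_function.
Proof.
assert (P := PI_RGT_0); split; [|split].
- intros z _; unfold strip_function; pose proof (atan_bound (2 * snd z / (1 - dist2 0 z))) as B.
  split; apply Rmult_lt_reg_l with (PI / 2); try lra;
  replace (PI / 2 * (2 / PI * atan (2 * snd z / (1 - dist2 0 z)))) with (atan (2 * snd z / (1 - dist2 0 z)))
    by (field; lra); lra.
- apply (second_order_C2 unit_disk _ _ _ _ _ _ _ open_unit_disk strip_function_second_order).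
  intros z Hz.
  pose proof (holo_at_continuous _ _ _ (cderiv_holo unit_disk _ open_unit_disk strip_derivative_holo z Hz)) as K.
  pose proof (continuous_fst_C _ _ K); pose proof (continuous_snd_C _ _ K); pose proof (cont_const (2 / PI) z).
  repeat split; apply cont_mult; auto; apply cont_opp; assumption.
- intros z Hz; rewrite (second_order_laplacian _ _ _ _ _ _ _ _ z open_unit_disk strip_function_second_order Hz).
  rewrite Derive_const; unfold Rdiv; ring.
Qed.

Lemma strip_function_lower t : 0 < t < 1 ->
  4 / PI * (t * (1 - t ^ 2) / (1 + t ^ 2) ^ 2) <= strip_function (0, t).
Proof.
intros Ht; assert (P := PI_RGT_0); assert (Ht2 : 0 < 1 - t ^ 2) by nra.
unfold strip_function; simpl snd.
replace (1 - dist2 0 (0, t)) with (1 - t ^ 2) by (unfold dist2; simpl; ring).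
set (x := 2 * t / (1 - t ^ 2)).
assert (Hx : 0 < x) by (apply Rdiv_lt_0_compat; lra).
assert (A : x / (1 + x ^ 2) <= atan x).
{ destruct (MVT_cor2 atan (fun v => / (1 + v ^ 2)) 0 x Hx) as [c [Hc1 Hc2]].
  - intros v _; apply derivable_pt_lim_atan.
  - rewrite atan_0, !Rminus_0_r in Hc1; rewrite Hc1; unfold Rdiv; rewrite (Rmult_comm x).
    apply Rmult_le_compat_r; [lra|]; apply Rinv_le_contravar; nra. }
replace (4 / PI * (t * (1 - t ^ 2) / (1 + t ^ 2) ^ 2)) with (2 / PI * (x / (1 + x ^ 2))).
- apply Rmult_le_compat_l; [apply Rlt_le, Rdiv_lt_0_compat; lra|exact A].
- unfold x; field; repeat split; nra.
Qed.

(* The derivative of [artanh] is at least 1. *)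
Lemma artanh_ge x : 0 <= x < 1 -> x <= artanh x.
Proof.
intros [[Hx| <-] Hx1].
- assert (A0 : artanh 0 = 0).
  { unfold artanh; replace ((1 + 0) / (1 - 0)) with 1 by field; rewrite ln_1; ring. }
  destruct (MVT_cor2 artanh (fun x => / (1 - x ^ 2)) 0 x Hx) as [c [Hc1 Hc2]].
  + intros v Hv; apply is_derive_Reals, artanh_derive; lra.
  + rewrite A0, !Rminus_0_r in Hc1; rewrite Hc1.
    assert (1 <= / (1 - c ^ 2)).
    { rewrite <- Rinv_1 at 1; apply Rinv_le_contravar; nra. }
    nra.
- unfold artanh; replace ((1 + 0) / (1 - 0)) with 1 by field; rewrite ln_1; lra.
Qed.

(** On the imaginary axis near 0 the hyperbolic distance from 0 to [(0, t)] is
    [t + o(t)], while [strip_function] grows like [4 / PI * t]. *)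
Theorem contraction_sharp c : c < 4 / PI ->
  exists z w : C, unit_disk z /\ unit_disk w /\
    c * metric_dist unit_disk poincare z w
    < disk_dist (RtoC (strip_function z)) (RtoC (strip_function w)).
Proof.
intros Hc; assert (P := PI_RGT_0).
assert (D0 : unit_disk 0) by (unfold unit_disk; rewrite Cmod_0; lra).
assert (K : forall t, 0 < t < 1 -> unit_disk (0, t) /\
  0 <= metric_dist unit_disk poincare 0 (0, t) <= t / (1 - t ^ 2) /\
  4 / PI * (t * (1 - t ^ 2) / (1 + t ^ 2) ^ 2)
  <= disk_dist (RtoC (strip_function 0)) (RtoC (strip_function (0, t)))).
{ intros t Ht; assert (Ht2 : 0 < 1 - t ^ 2) by nra.
  assert (Ed : dist2 0 (0, t) = t ^ 2) by (unfold dist2; simpl; ring).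
  assert (Dt : unit_disk (0, t)) by (apply unit_disk_disk; unfold disk; rewrite Ed; lra).
  split; [exact Dt|split; [split|]].
  - apply Rle_trans with (2 := poincare_lipschitz fst _ _ gradient_bound_fst D0 Dt), Rabs_pos.
  - apply Rle_trans with (/ (1 - t ^ 2) * Cmod ((0, t) - 0)).
    + apply poincare_segment_bound; auto; [unfold dist2; simpl; nra|rewrite Ed; lra].
    + right; replace (Cmod ((0, t) - 0)) with t; [field; lra|].
      assert (E : Cmod ((0, t) - 0) ^ 2 = t ^ 2) by (rewrite Cmod_sqr; simpl; ring).
      pose proof (Cmod_ge_0 ((0, t) - 0)); nra.
  - destruct strip_function_harmonic as (R1 & _ & _).
    rewrite disk_dist_real by (apply R1; assumption).
    assert (S0 : strip_function 0 = 0).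
    { unfold strip_function; simpl snd; replace (2 * 0 / (1 - dist2 0 0)) with 0.
      - rewrite atan_0; ring.
      - unfold Rdiv; ring. }
    assert (A0 : artanh 0 = 0).
    { unfold artanh; replace ((1 + 0) / (1 - 0)) with 1 by field; rewrite ln_1; ring. }
    pose proof (strip_function_lower t Ht) as L.
    assert (0 < 4 / PI * (t * (1 - t ^ 2) / (1 + t ^ 2) ^ 2)).
    { apply Rmult_lt_0_compat; apply Rdiv_lt_0_compat; try lra.
      - apply Rmult_lt_0_compat; lra.
      - apply pow_lt; nra. }
    rewrite S0, A0, Rminus_0_l, Rabs_Ropp; pose proof (R1 _ Dt).
    pose proof (artanh_ge (strip_function (0, t)) ltac:(lra)).
    rewrite Rabs_pos_eq; lra. }
destruct (Rle_lt_dec c 0) as [Hn|Hp].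
- destruct (K (1 / 2) ltac:(lra)) as (K1 & K2 & K3); exists 0, (0, 1 / 2); split; [exact D0|split; [exact K1|]].
  apply Rle_lt_trans with 0; [nra|]; apply Rlt_le_trans with (2 := K3).
  apply Rmult_lt_0_compat; [apply Rdiv_lt_0_compat|]; lra.
- (* [t ^ 2 = x] must satisfy [(1 + x) ^ 2 < kap (1 - x) ^ 2]; for [x <= 1/2] the
     quotient of the squares is at most [1 + 16 x] *)
  set (kap := 4 / PI / c).
  assert (Hkap : 1 < kap).
  { unfold kap; apply Rmult_lt_reg_r with c; [exact Hp|]; unfold Rdiv at 1; rewrite Rmult_assoc, Rinv_l by lra; lra. }
  set (x := Rmin (1 / 2) ((kap - 1) / 17)).
  assert (Hx0 : 0 < x) by (apply Rmin_pos; lra).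
  assert (Hx1 : x <= 1 / 2) by apply Rmin_l.
  assert (Hx2 : x <= (kap - 1) / 17) by apply Rmin_r.
  assert (Hs : sqrt x ^ 2 = x) by (apply pow2_sqrt; lra).
  assert (Hs0 : 0 < sqrt x) by (apply sqrt_lt_R0, Hx0).
  assert (Hs1 : sqrt x < 1) by nra.
  destruct (K (sqrt x) ltac:(lra)) as (K1 & K2 & K3); rewrite Hs in K2, K3.
  exists 0, (0, sqrt x); split; [exact D0|split; [exact K1|]].
  apply Rlt_le_trans with (2 := K3).
  apply Rle_lt_trans with (c * (sqrt x / (1 - x))); [apply Rmult_le_compat_l; lra|].
  assert (Q : (1 + x) ^ 2 < kap * (1 - x) ^ 2).
  { assert (1 + x <= (1 + 4 * x) * (1 - x)) by nra.
    assert ((1 + x) ^ 2 <= ((1 + 4 * x) * (1 - x)) ^ 2) by (apply pow_incr; lra).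
    rewrite Rpow_mult_distr in H0.
    assert ((1 + 4 * x) ^ 2 < kap) by nra.
    assert (0 < (1 - x) ^ 2) by (apply pow_lt; lra); nra. }
  assert (Ek : 4 / PI = kap * c) by (unfold kap; field; lra).
  rewrite Ek.
  assert (0 < (1 + x) ^ 2) by (apply pow_lt; lra).
  apply Rmult_lt_reg_r with ((1 - x) * (1 + x) ^ 2 / (c * sqrt x)).
  { apply Rdiv_lt_0_compat; [apply Rmult_lt_0_compat; lra|apply Rmult_lt_0_compat; lra]. }
  replace (c * (sqrt x / (1 - x)) * ((1 - x) * (1 + x) ^ 2 / (c * sqrt x))) with ((1 + x) ^ 2) by (field; lra).
  replace (kap * c * (sqrt x * (1 - x) / (1 + x) ^ 2) * ((1 - x) * (1 + x) ^ 2 / (c * sqrt x)))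
    with (kap * (1 - x) ^ 2) by (field; lra).
  exact Q.
Qed.

Theorem corollary1p4 :
  (forall (Omega : C -> Prop) (lam : C -> R) (r : R -> R) (f : C -> R),
     hyperbolic_domain Omega ->
     hyperbolic_metric Omega lam ->
     (forall t, -1 < t < 1 -> 0 < r t) ->
     smooth_on_unit_interval r ->
     (forall w : C, -1 < Re w < 1 -> 0 <= gaussian_curvature (strip_density r) w) ->
     rho_harmonic Omega r f ->
     forall z w : C, Omega z -> Omega w ->
       disk_dist (RtoC (f z)) (RtoC (f w)) <= 4 / PI * metric_dist Omega lam z w)
  /\
  (forall c : R, c < 4 / PI ->
     exists (Omega : C -> Prop) (lam : C -> R) (r : R -> R) (f : C -> R),
       hyperbolic_domain Omega /\
       hyperbolic_metric Omega lam /\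
       (forall t, -1 < t < 1 -> 0 < r t) /\
       smooth_on_unit_interval r /\
       (forall w : C, -1 < Re w < 1 -> 0 <= gaussian_curvature (strip_density r) w) /\
       rho_harmonic Omega r f /\
       exists z w : C, Omega z /\ Omega w /\
         c * metric_dist Omega lam z w < disk_dist (RtoC (f z)) (RtoC (f w))).
Proof.
split.
- intros Omega lam r f H1 H2 H3 H4 H5 H6 z w; apply (rho_harmonic_contraction Omega lam r f); assumption.
- intros c Hc; exists unit_disk, poincare, (fun _ => 1), strip_function.
  split; [exact unit_disk_hyperbolic|split; [exact poincare_hyperbolic|split; [intros; lra|split]]].
  + intros n t _; apply ex_derive_n_const.
  + split; [|split; [exact strip_function_harmonic|apply contraction_sharp, Hc]].
    intros w _; unfold gaussian_curvature, strip_density.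
    rewrite (strip_laplacian (fun _ => ln 1)), (Derive_ext _ (fun _ => 0)) by (intros; apply Derive_const).
    rewrite Derive_const; unfold Rdiv; rewrite Ropp_0, Rmult_0_l; lra.
Qed.
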